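(* Let $(M^{n+1},\bar g)=(\mathbb{B}^{n+1}_{\bar r},e^{2\phi(r)}\delta)$ be a radially symmetric, conformally Euclidean metric for some $\bar r\in(0,\infty]$. Assume that the Ricci curvature $\mathrm{Ric}_{\bar g}$ is either (strictly) largest in the radial direction, or is constant (in which case $(M^{n+1},\bar g)$ is a geodesic ball in a space form). Suppose $\Sigma_0,\Sigma_1$ are compact, properly embedded free boundary minimal hypersurfaces (with respect to $\bar g$) in $\mathbb{B}_{r_0}$ for some $r_0\in(0,\bar r]$. Then $\Sigma_0$ and $\Sigma_1$ intersect in every closed half ball of $\overline{\mathbb{B}_{r_0}}$; that is, for every unit vector $a\in\mathbb{R}^{n+1}$, $$\Sigma_0\cap\Sigma_1\cap\{x\in\overline{\mathbb{B}_{r_0}}:\langle x,a\rangle\geq0\}\neq\emptyset.$$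
   Context: $\mathbb{B}^{n+1}_{s}$ is the Euclidean ball of radius $s$ centred at the origin in $\mathbb{R}^{n+1}$ (all of $\mathbb{R}^{n+1}$ if $s=\infty$), $r=|x|$, $\delta$ is the flat metric, and $\phi$ is a function of $r$ such that $e^{2\phi(r)}\delta$ is a smooth metric (up to the boundary when the boundary is involved). ''$\mathrm{Ric}_{\bar g}$ is strictly largest in the radial direction'' means that at every point other than the origin, $\mathrm{Ric}_{\bar g}(\partial_\rho,\partial_\rho)>\mathrm{Ric}_{\bar g}(v,v)$ for each $\bar g$-unit vector $v$ orthogonal to the radial $\bar g$-unit vector $\partial_\rho$; equivalently $\left(\frac{\phi'}{r}\right)'-r\left(\frac{\phi'}{r}\right)^2<0$. ''Constant'' means $\mathrm{Ric}_{\bar g}=c\,\bar g$ for a constant $c$; equivalently $\left(\frac{\phi'}{r}\right)'-r\left(\frac{\phi'}{r}\right)^2\equiv0$. A properly embedded free boundary minimal hypersurface in $\mathbb{B}_{r_0}$ is a hypersurface $\Sigma\subset\overline{\mathbb{B}_{r_0}}$, minimal with respect to $\bar g$, with $\Sigma\cap\partial\mathbb{B}_{r_0}=\partial\Sigma$, whose outer unit conormal along $\partial\Sigma$ equals the outer unit normal of $\partial\mathbb{B}_{r_0}$ (i.e. it meets $\partial\mathbb{B}_{r_0}$ orthogonally). *)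

(* Defs.v *)
From HB Require Import structures.
From mathcomp Require Import all_boot all_order all_algebra.
From mathcomp Require Import all_classical all_reals all_analysis.
Set Implicit Arguments.
Unset Strict Implicit.
Unset Printing Implicit Defensive.
Import Order.TTheory GRing.Theory Num.Theory.
Import numFieldNormedType.Exports.
Local Open Scope classical_set_scope.
Local Open Scope ring_scope.

(* The norm [`|x|] of ['rV[R]_n] is the sup norm, hence a separate Euclidean
   norm; both induce the same topology. *)
Definition edot (R : realType) (n : nat) (u v : 'rV[R]_n) : R :=
  (u *m v^T) 0 0.

Definition enorm (R : realType) (n : nat) (u : 'rV[R]_n) : R :=
  Num.sqrt (edot u u).

(* For [s = +oo] both balls are the whole space and the sphere is empty. *)
Definition oball (R : realType) (n : nat) (s : \bar R) : set 'rV[R]_n :=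
  [set x | ((enorm x)%:E < s)%E].

Definition cball (R : realType) (n : nat) (s : \bar R) : set 'rV[R]_n :=
  [set x | ((enorm x)%:E <= s)%E].

Definition esphere (R : realType) (n : nat) (s : \bar R) : set 'rV[R]_n :=
  [set x | (enorm x)%:E = s].

Definition iter_derive (R : realType) (n : nat) (vs : seq 'rV[R]_n.+1)
    (f : 'rV[R]_n.+1 -> R) : 'rV[R]_n.+1 -> R :=
  foldr (fun v h x => 'D_v h x) f vs.

(* [f] is C^oo on some open neighbourhood of [A]; for closed [A] this is
   smoothness up to the boundary, in the sense of smooth extendability. *)
Definition smooth_on (R : realType) (n : nat) (A : set 'rV[R]_n.+1)
    (f : 'rV[R]_n.+1 -> R) : Prop :=
  forall x, A x -> \forall y \near x,
    forall vs, differentiable (iter_derive vs f) y.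

Definition partial (R : realType) (n : nat) (k : 'I_n.+1)
    (f : 'rV[R]_n.+1 -> R) (x : 'rV[R]_n.+1) : R :=
  'D_(delta_mx 0 k) f x.

Definition gradient (R : realType) (n : nat) (f : 'rV[R]_n.+1 -> R)
    (x : 'rV[R]_n.+1) : 'rV[R]_n.+1 :=
  \row_k partial k f x.

(* A metric on (a subset of) R^{n+1} is given by its matrix (g_ij) in the
   standard coordinates. *)
Definition metric (R : realType) (n : nat) : Type :=
  'rV[R]_n.+1 -> 'M[R]_n.+1.

Definition smooth_metric_on (R : realType) (n : nat) (A : set 'rV[R]_n.+1)
    (g : metric R n) : Prop :=
  forall i j, smooth_on A (fun x => g x i j).

Definition gdot (R : realType) (n : nat) (g : metric R n)
    (x u v : 'rV[R]_n.+1) : R :=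
  (u *m g x *m v^T) 0 0.

(* The Christoffel symbol Gamma^k_ij. *)
Definition christoffel (R : realType) (n : nat) (g : metric R n)
    (k i j : 'I_n.+1) (x : 'rV[R]_n.+1) : R :=
  2^-1 * \sum_l invmx (g x) k l *
    (partial i (fun y => g y j l) x + partial j (fun y => g y i l) x
     - partial l (fun y => g y i j) x).

(* Sign convention: the round sphere has positive Ricci curvature. *)
Definition ricci_coef (R : realType) (n : nat) (g : metric R n)
    (i j : 'I_n.+1) (x : 'rV[R]_n.+1) : R :=
  \sum_k (partial k (christoffel g k i j) x
          - partial j (christoffel g k i k) x)
  + \sum_k \sum_l (christoffel g k k l x * christoffel g l i j x
                   - christoffel g k j l x * christoffel g l i k x).

Definition ricci (R : realType) (n : nat) (g : metric R n)
    (x u v : 'rV[R]_n.+1) : R :=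
  \sum_i \sum_j ricci_coef g i j x * u 0 i * v 0 j.

(* The covariant derivative (nabla_u X)(x). *)
Definition covariant_derive (R : realType) (n : nat) (g : metric R n)
    (u : 'rV[R]_n.+1) (X : 'rV[R]_n.+1 -> 'rV[R]_n.+1) (x : 'rV[R]_n.+1) :
    'rV[R]_n.+1 :=
  'D_u X x + \row_k \sum_i \sum_j christoffel g k i j x * u 0 i * X x 0 j.

Definition conformal_metric (R : realType) (n : nat) (phi : R -> R) :
    metric R n :=
  fun x => (expR (2 * phi (enorm x)))%:M.

Arguments conformal_metric {R} n phi.

Definition radial_unit (R : realType) (n : nat) (g : metric R n)
    (x : 'rV[R]_n.+1) : 'rV[R]_n.+1 :=
  (Num.sqrt (gdot g x x x))^-1 *: x.

Definition ricci_largest_radially (R : realType) (n : nat)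
    (A : set 'rV[R]_n.+1) (g : metric R n) : Prop :=
  forall x v, A x -> x != 0 ->
    gdot g x v v = 1 -> gdot g x v (radial_unit g x) = 0 ->
    ricci g x v v < ricci g x (radial_unit g x) (radial_unit g x).

Definition ricci_constant (R : realType) (n : nat)
    (A : set 'rV[R]_n.+1) (g : metric R n) : Prop :=
  exists c : R, forall x u v, A x -> ricci g x u v = c * gdot g x u v.

(* Embedded hypersurfaces with boundary: near an interior point, [S] is the
   zero set of a submersion [f]; near a boundary point, it is the part
   [h <= 0] of such a zero set, with [df] and [dh] independent. *)
Definition interior_chart (R : realType) (n : nat) (S : set 'rV[R]_n.+1)
    (p : 'rV[R]_n.+1) (f : 'rV[R]_n.+1 -> R) : Prop :=
  [/\ smooth_on [set p] f, gradient f p != 0 &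
      \forall y \near p, S y <-> f y = 0].

Definition boundary_chart (R : realType) (n : nat) (S : set 'rV[R]_n.+1)
    (p : 'rV[R]_n.+1) (f h : 'rV[R]_n.+1 -> R) : Prop :=
  [/\ smooth_on [set p] f, smooth_on [set p] h,
      row_free (col_mx (gradient f p) (gradient h p)), h p = 0 &
      \forall y \near p, S y <-> f y = 0 /\ h y <= 0].

Definition hs_interior (R : realType) (n : nat) (S : set 'rV[R]_n.+1) :
    set 'rV[R]_n.+1 :=
  [set p | S p /\ exists f, interior_chart S p f].

Definition hs_boundary (R : realType) (n : nat) (S : set 'rV[R]_n.+1) :
    set 'rV[R]_n.+1 :=
  [set p | S p /\ exists f h, boundary_chart S p f h].

Definition hypersurface (R : realType) (n : nat) (S : set 'rV[R]_n.+1) : Prop :=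
  S !=set0 /\ S `<=` hs_interior S `|` hs_boundary S.

Definition local_equation (R : realType) (n : nat) (S : set 'rV[R]_n.+1)
    (p : 'rV[R]_n.+1) (f : 'rV[R]_n.+1 -> R) : Prop :=
  interior_chart S p f \/ exists h, boundary_chart S p f h.

(* The [g]-unit normal field of the level sets of [f]: the coordinates of the
   [g]-gradient are g^{kl} d_l f. *)
Definition unit_normal (R : realType) (n : nat) (g : metric R n)
    (f : 'rV[R]_n.+1 -> R) (x : 'rV[R]_n.+1) : 'rV[R]_n.+1 :=
  let N := gradient f x *m (invmx (g x))^T in
  (Num.sqrt (gdot g x N N))^-1 *: N.

(* The choice of sign is irrelevant to minimality. *)
Definition second_ff (R : realType) (n : nat) (g : metric R n)
    (f : 'rV[R]_n.+1 -> R) (x u v : 'rV[R]_n.+1) : R :=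
  gdot g x (covariant_derive g u (unit_normal g f) x) v.

(* The rows of [E] form a [g]-orthonormal basis of the tangent space at [x] of
   the level set of [f]. *)
Definition tangent_frame (R : realType) (n : nat) (g : metric R n)
    (f : 'rV[R]_n.+1 -> R) (x : 'rV[R]_n.+1) (E : 'M[R]_(n, n.+1)) : Prop :=
  E *m g x *m E^T = 1%:M /\ E *m (gradient f x)^T = 0.

Definition minimal (R : realType) (n : nat) (g : metric R n)
    (S : set 'rV[R]_n.+1) : Prop :=
  forall p f E, S p -> local_equation S p f -> tangent_frame g f p E ->
    \sum_i second_ff g f p (row i E) (row i E) = 0.

(* [eta] is the outer unit conormal at the boundary point [p]: tangent to [S],
   orthogonal to the boundary of [S], unit, and pointing out of [h <= 0]. *)
Definition outer_conormal (R : realType) (n : nat) (g : metric R n)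
    (f h : 'rV[R]_n.+1 -> R) (p eta : 'rV[R]_n.+1) : Prop :=
  [/\ edot (gradient f p) eta = 0,
      forall v, edot (gradient f p) v = 0 -> edot (gradient h p) v = 0 ->
        gdot g p eta v = 0,
      gdot g p eta eta = 1 &
      0 < edot (gradient h p) eta].

(* The outer unit normal at [p] of the sphere through [p] centred at 0. *)
Definition outer_normal (R : realType) (n : nat) (g : metric R n)
    (p nu : 'rV[R]_n.+1) : Prop :=
  [/\ forall v, edot p v = 0 -> gdot g p nu v = 0,
      gdot g p nu nu = 1 &
      0 < edot p nu].

Definition free_boundary (R : realType) (n : nat) (g : metric R n)
    (S : set 'rV[R]_n.+1) : Prop :=
  forall p f h eta, S p -> boundary_chart S p f h ->
    outer_conormal g f h p eta -> outer_normal g p eta.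

Definition compact_free_boundary_minimal (R : realType) (n : nat)
    (g : metric R n) (r0 : \bar R) (S : set 'rV[R]_n.+1) : Prop :=
  [/\ hypersurface S, compact S,
      S `<=` cball r0 /\ S `&` esphere r0 = hs_boundary S,
      minimal g S & free_boundary g S].

(* Main.v *)
Require Import Defs.
From HB Require Import structures.
From mathcomp Require Import all_boot all_order all_algebra.
From mathcomp Require Import all_classical all_reals all_analysis.
From mathcomp Require Import ring lra.
Set Implicit Arguments.
Unset Strict Implicit.
Unset Printing Implicit Defensive.
Import Order.TTheory GRing.Theory Num.Theory.
Import numFieldNormedType.Exports.
Local Open Scope classical_set_scope.
Local Open Scope ring_scope.

(* Write the metric as [A^-2 delta] with [A = exp (- phi)], and let [D] be the derivative of [A]
   with respect to [rho = |x|^2].  The curvature hypothesis says that [D] is strictly increasing, or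
   constant, in [rho].  Suppose that the two hypersurfaces [S], [S'] do not meet in a closed half
   ball.  After tilting the half ball slightly, both of them have points in its interior
   [<c, x> > 0].  The functional
     [|x - y|^2 / (q x * q y)],  [q x = <c, x> + eps * psi (|x|^2)],
   which for [eps = 0] is a function of the hyperbolic distance in the half space [<c, x> > 0], then
   has a positive minimum over the pairs in [S * S'] with [q x, q y > 0].  If [psi > 2 rho psi'],
   free boundary points are excluded: moving the point towards the origin stays tangent to the
   hypersurface and decreases the functional.  At an interior minimum, test the second variation
   with the vectors [A(x) v] and [A(y) v'], where [v] runs over an orthonormal basis of the tangent
   space at [x] and [v'] is its image under the reflection exchanging [x] and [y], corrected by a
   second reflection of order [eps].  The sum over the basis only involves the mean curvatures and
   gives
     [0 <= n * bracket * (...) - eps * (excess at x + excess at y) + O (eps^2)],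
   where [bracket = (A(x) - A(y))^2 - (A(x) D(x) - A(y) D(y)) (|x|^2 - |y|^2)].
   Since [A] is convex in [rho], [bracket <= 0], so both [bracket >= 0] and [total excess <= 0] hold
   for a pair obtained in the limit [eps --> 0].  If [D] is strictly increasing, then [|x| = |y|], and
   the limiting normals are orthogonal to [x] and [y]; the excess is then positive for
   [psi = exp (- L rho)] with [L] large.  If [D] is constant, [psi = rho + b] with [b] slightly larger
   than the values of [rho] makes the excess positive. *)

(** Where [q] tends to [0] the quotient blows up as long as the two hypersurfaces stay apart, so
    minimising pairs remain inside the half ball; this makes the argument local. For [eps = 0] the
    reflection exchanging [x] and [y] is, up to scaling, the mixed second derivative of the
    functional at a critical pair, and it exchanges the two normals. This is why it transports the
    tangent frame. With [eps = 0] alone there would be no contradiction: at a free boundary point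
    [|x| >= |y|] yields only a weak inequality, and in a space form the bracket vanishes
    identically. The term [eps * psi] supplies strictness in both places. Its gain is of order
    [eps], while the two normals are then exchanged only up to a vector of order [eps], which enters
    the inequality through its square. Compactness of the set of pairs takes the place of uniform
    estimates when the parameter goes to [0]. The factors [A(x)] and [A(y)] make the test vectors
    unit for the metric. The vector terms then add up to [(A(x) - A(y))^2], and the Hessian terms,
    evaluated by minimality, to the rest of the bracket. *)

Section EuclideanProduct.
Variables (R : realType) (n : nat).
Implicit Types (u v w : 'rV[R]_n).

Lemma edotE u v : edot u v = \sum_i u 0 i * v 0 i.
Proof. by rewrite /edot mxE; apply: eq_bigr => i _; rewrite mxE. Qed.

Lemma edotC u v : edot u v = edot v u.
Proof. by rewrite !edotE; apply: eq_bigr => i _; rewrite mulrC. Qed.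

Lemma edotDl u v w : edot (u + v) w = edot u w + edot v w.
Proof. by rewrite /edot mulmxDl mxE. Qed.

Lemma edotZl c u v : edot (c *: u) v = c * edot u v.
Proof. by rewrite /edot -scalemxAl mxE. Qed.

Lemma edotNl u v : edot (- u) v = - edot u v.
Proof. by rewrite -scaleN1r edotZl mulN1r. Qed.

Lemma edotBl u v w : edot (u - v) w = edot u w - edot v w.
Proof. by rewrite edotDl edotNl. Qed.

Lemma edotDr u v w : edot u (v + w) = edot u v + edot u w.
Proof. by rewrite !(edotC u) edotDl. Qed.

Lemma edotZr c u v : edot u (c *: v) = c * edot u v.
Proof. by rewrite !(edotC u) edotZl. Qed.

Lemma edotNr u v : edot u (- v) = - edot u v.
Proof. by rewrite !(edotC u) edotNl. Qed.

Lemma edotBr u v w : edot u (v - w) = edot u v - edot u w.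
Proof. by rewrite edotDr edotNr. Qed.

Lemma edot0l u : edot 0 u = 0.
Proof. by rewrite /edot mul0mx mxE. Qed.

Lemma edot0r u : edot u 0 = 0.
Proof. by rewrite edotC edot0l. Qed.

Lemma edot_ge0 u : 0 <= edot u u.
Proof. by rewrite edotE sumr_ge0 // => i _; rewrite -expr2 sqr_ge0. Qed.

Lemma edot_eq0 u : (edot u u == 0) = (u == 0).
Proof.
apply/idP/eqP => [|->]; last by rewrite edot0l.
rewrite edotE psumr_eq0 => [/allP u0|i _]; last by rewrite -expr2 sqr_ge0.
apply/rowP => i; rewrite mxE.
by have := u0 i (mem_index_enum i); rewrite mulf_eq0 orbb => /eqP.
Qed.

Lemma edot_gt0 u : (0 < edot u u) = (u != 0).
Proof. by rewrite lt_def edot_ge0 andbT edot_eq0. Qed.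

Lemma edot_delta u i : edot u (delta_mx 0 i) = u 0 i.
Proof.
rewrite edotE (bigD1 i) //= big1 => [|j ji]; rewrite !mxE ?eqxx ?mulr1 ?addr0 //.
by rewrite (negPf ji) andbF mulr0.
Qed.

Lemma edot_cauchy u v : edot u v ^+ 2 <= edot u u * edot v v.
Proof.
have [->|v0] := eqVneq v 0; first by rewrite !edot0r expr0n mulr0.
have vv : 0 < edot v v by rewrite edot_gt0.
have := edot_ge0 (edot v v *: u - edot u v *: v).
rewrite !(edotBl, edotBr, edotZl, edotZr) (edotC v u) => H.
rewrite -subr_ge0 -(pmulr_rge0 _ vv); apply: le_trans H _.
by rewrite le_eqVlt; apply/orP; left; apply/eqP; ring.
Qed.

Lemma enorm_ge0 u : 0 <= enorm u.
Proof. exact: sqrtr_ge0. Qed.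

Lemma enorm2 u : enorm u ^+ 2 = edot u u.
Proof. by rewrite sqr_sqrtr // edot_ge0. Qed.

Lemma enorm_gt0 u : (0 < enorm u) = (u != 0).
Proof. by rewrite sqrtr_gt0 edot_gt0. Qed.

Lemma enormZ c u : enorm (c *: u) = `|c| * enorm u.
Proof.
rewrite /enorm edotZl edotZr mulrA -expr2 sqrtrM ?sqr_ge0 //.
by rewrite sqrtr_sqr.
Qed.

Lemma edot_trmx (A : 'M[R]_n) u v : edot (u *m A) v = edot u (v *m A^T).
Proof. by rewrite /edot trmx_mul trmxK mulmxA. Qed.

Lemma frame_row_norm m (E : 'M[R]_(m, n)) i : E *m E^T = 1%:M -> edot (row i E) (row i E) = 1.
Proof.
move=> EE; rewrite edotE; have := congr1 (fun M : 'M[R]_m => M i i) EE.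
rewrite mxE [RHS]mxE eqxx => H; rewrite -[RHS]H.
by apply: eq_bigr => j _; rewrite !mxE.
Qed.

Lemma frame_row_orth m (E : 'M[R]_(m, n)) N i : E *m N^T = 0 -> edot N (row i E) = 0.
Proof.
move=> EN; rewrite edotC edotE; have := congr1 (fun M : 'cV[R]_m => M i 0) EN.
rewrite mxE [RHS]mxE => H; rewrite -[RHS]H.
by apply: eq_bigr => j _; rewrite !mxE.
Qed.

End EuclideanProduct.

Section Continuity.
Variables (R : realType) (T : topologicalType) (n : nat).

Lemma edot_cvg (F : set_system T) {FF : Filter F} (f g : T -> 'rV[R]_n.+1) (a b : 'rV[R]_n.+1) :
  f @ F --> a -> g @ F --> b -> edot (f x) (g x) @[x --> F] --> edot a b.
Proof.
move=> fa gb.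
have co (h : T -> 'rV[R]_n.+1) (c : 'rV[R]_n.+1) i : h @ F --> c -> h x 0 i @[x --> F] --> c 0 i.
  move=> hc; have cc := @coord_continuous R 1 n.+1 0 i c.
  exact: (@cvg_comp _ _ _ h (fun M : 'rV[R]_n.+1 => M 0 i) _ _ _ hc cc).
rewrite edotE; under eq_fun do rewrite edotE.
apply: cvg_big => [|i _]; first exact: add_continuous.
by apply: cvgM; exact: co.
Qed.

Lemma enorm_cvg (F : set_system T) {FF : Filter F} (f : T -> 'rV[R]_n.+1) (a : 'rV[R]_n.+1) :
  f @ F --> a -> enorm (f x) @[x --> F] --> enorm a.
Proof.
move=> fa; rewrite /enorm.
have H : edot (f x) (f x) @[x --> F] --> edot a a by exact: edot_cvg.
exact: (@cvg_comp _ _ _ (fun x => edot (f x) (f x)) (@Num.sqrt R) F _ _ H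
  (@sqrt_continuous R (edot a a))).
Qed.

End Continuity.

(** * Second-order expansions *)

Lemma cvg_cstf (R : realType) T (F : set_system T) {FF : Filter F} (a : R) : (fun=> a) @ F --> a.
Proof. exact: cvg_cst. Qed.
Arguments cvg_cstf {R T F FF} a.

Lemma cvg_addf (R : realType) T (F : set_system T) {FF : Filter F} (f h : T -> R) (a b : R) :
  f @ F --> a -> h @ F --> b -> (fun t => f t + h t) @ F --> a + b.
Proof. exact: cvgD. Qed.

Lemma cvg_mulf (R : realType) T (F : set_system T) {FF : Filter F} (f h : T -> R) (a b : R) :
  f @ F --> a -> h @ F --> b -> (fun t => f t * h t) @ F --> a * b.
Proof. exact: cvgM. Qed.

Lemma cvg_sqrf (R : realType) T (F : set_system T) {FF : Filter F} (f : T -> R) (a : R) :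
  f @ F --> a -> (fun t => f t ^+ 2) @ F --> a ^+ 2.
Proof. move=> fa; under eq_fun do rewrite expr2; rewrite expr2; exact: cvg_mulf. Qed.

Section OneVariable.
Variable R : realType.

Lemma is_derive_approx (V W : normedModType R) (f : V -> W) (a v : V) (c : W) :
  is_derive a v f c ->
  forall e, 0 < e -> \forall h \near (0 : R), `|f (a + h *: v) - f a - h *: c| <= e * `|h|.
Proof.
move=> [df fc] e e0.
have H : (fun h => h^-1 *: ((f \o shift a) (h *: v) - f a)) @ 0^' --> c.
  by rewrite -fc; exact: df.
have /cvgr_dist_le/(_ _ e0) := H.
rewrite near_withinE => {}H.
near=> h.
have [->|h0] := eqVneq h 0.
  by rewrite !scale0r addr0 subrr subr0 !normr0 mulr0.
have : h != 0 -> `|c - h^-1 *: ((f \o shift a) (h *: v) - f a)| <= e by near: h.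
move=> /(_ h0).
rewrite /= (addrC _ a) -(ler_pM2r (_ : 0 < `|h|)) ?normr_gt0 //.
rewrite mulrC -normrZ scalerBr scalerA divff // scale1r distrC.
by [].
Unshelve. all: by end_near. Qed.

(* [r] is continuous at [0]: a junk value [r 0] is excluded. *)
Definition jet2 (g : R -> R) (g0 g1 g2 : R) :=
  exists2 r : R -> R, r t @[t --> 0] --> g2 &
    \forall t \near (0 : R), g t = g0 + g1 * t + r t * t ^+ 2.

Lemma cvg_idR : (fun t : R => t) @ (0:R) --> (0:R).
Proof. exact: cvg_id. Qed.

Lemma jet2_eq g g0 g1 g2 h0 h1 h2 :
  jet2 g g0 g1 g2 -> g0 = h0 -> g1 = h1 -> g2 = h2 -> jet2 g h0 h1 h2.
Proof. by move=> ? <- <- <-. Qed.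

Lemma jet2_near g h g0 g1 g2 :
  (\forall t \near (0 : R), g t = h t) -> jet2 g g0 g1 g2 -> jet2 h g0 g1 g2.
Proof.
move=> gh [r r2 rg]; exists r => //.
by apply: filterS2 gh rg => t <-.
Qed.

Lemma jet2_cst c : jet2 (cst c) c 0 0.
Proof.
exists (cst 0); first exact: cvg_cst.
by near=> t; rewrite /= !mul0r !addr0.
Unshelve. all: by end_near. Qed.

Lemma jet2_id : jet2 id 0 1 0.
Proof.
exists (cst 0); first exact: cvg_cst.
by near=> t; rewrite /= !mul0r !addr0 mul1r add0r.
Unshelve. all: by end_near. Qed.

Lemma jet2D f g f0 f1 f2 g0 g1 g2 : jet2 f f0 f1 f2 -> jet2 g g0 g1 g2 ->
  jet2 (fun t => f t + g t) (f0 + g0) (f1 + g1) (f2 + g2).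
Proof.
move=> [r rf fE] [s sg gE]; exists (fun t => r t + s t); first exact: cvgD.
by apply: filterS2 fE gE => t -> ->; ring.
Qed.

Lemma jet2M f g f0 f1 f2 g0 g1 g2 : jet2 f f0 f1 f2 -> jet2 g g0 g1 g2 ->
  jet2 (fun t => f t * g t) (f0 * g0) (f0 * g1 + f1 * g0)
    (f0 * g2 + f1 * g1 + f2 * g0).
Proof.
move=> [r rf fE] [s sg gE].
exists (fun t => f0 * s t + f1 * g1 + r t * g0 + (f1 * s t + r t * g1) * t + r t * s t * t ^+ 2).
  have -> : f0 * g2 + f1 * g1 + f2 * g0 =
    f0 * g2 + f1 * g1 + f2 * g0 + (f1 * g2 + f2 * g1) * 0 + f2 * g2 * 0 ^+ 2 by ring.
  have cI := cvg_idR.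
  exact: (cvg_addf (cvg_addf (cvg_addf (cvg_addf (cvg_mulf (cvg_cstf f0) sg) (cvg_cstf (f1 * g1)))
    (cvg_mulf rf (cvg_cstf g0))) (cvg_mulf (cvg_addf (cvg_mulf (cvg_cstf f1) sg)
    (cvg_mulf rf (cvg_cstf g1))) cI)) (cvg_mulf (cvg_mulf rf sg) (cvg_sqrf cI))).
by apply: filterS2 fE gE => t -> ->; ring.
Qed.

Lemma jet2Z c f f0 f1 f2 : jet2 f f0 f1 f2 ->
  jet2 (fun t => c * f t) (c * f0) (c * f1) (c * f2).
Proof.
move=> jf; apply: jet2_eq (jet2M (jet2_cst c) jf) _ _ _ => //; ring.
Qed.

Lemma jet2_cvg g g0 g1 g2 : jet2 g g0 g1 g2 -> g t @[t --> 0] --> g0.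
Proof.
move=> [r rg gE].
have -> : g0 = g0 + g1 * 0 + g2 * 0 ^+ 2 by ring.
have cI := cvg_idR.
apply: cvg_trans (_ : (fun t => g0 + g1 * t + r t * t ^+ 2) @ 0 --> _).
  apply: near_eq_cvg; near=> t; symmetry; near: t; exact: gE.
exact: (cvg_addf (cvg_addf (cvg_cstf g0) (cvg_mulf (cvg_cstf g1) cI)) (cvg_mulf rg (cvg_sqrf cI))).
Unshelve. all: by end_near. Qed.

(** Even for [t != 0] the increment [g t - a] may vanish, and the remainder of [F] is then evaluated
    at [0]. This is where its continuity at [0] matters. *)
Lemma jet2_comp (F g : R -> R) a a0 a1 a2 g1 g2 :
  jet2 (fun t => F (a + t)) a0 a1 a2 -> jet2 g a g1 g2 ->
  jet2 (fun t => F (g t)) a0 (a1 * g1) (a1 * g2 + a2 * g1 ^+ 2).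
Proof.
move=> [r ra FE] jg; have [s sg gE] := jg.
have gc : (fun t => g t - a) @ 0 --> (0 : R).
  have ga := jet2_cvg jg.
  have : (fun t => g t - a) @ 0 --> a - a by apply: cvgB; [exact: ga | exact: cvg_cst].
  by rewrite subrr.
exists (fun t => a1 * s t + r (g t - a) * (g1 + s t * t) * (g1 + s t * t)).
  have -> : a1 * g2 + a2 * g1 ^+ 2 = a1 * g2 + a2 * (g1 + g2 * 0) * (g1 + g2 * 0) by ring.
  have cI := cvg_idR.
  have rc : (fun t => r (g t - a)) @ 0 --> a2 by exact: (@cvg_comp _ _ _ (fun t => g t - a) r _ _ _ gc ra).
  have cs : (fun t => g1 + s t * t) @ (0 : R) --> g1 + g2 * 0.
    exact: (cvg_addf (cvg_cstf g1) (cvg_mulf sg cI)).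
  exact: (cvg_addf (cvg_mulf (cvg_cstf a1) sg) (cvg_mulf (cvg_mulf rc cs) cs)).
near=> t.
have -> : F (g t) = F (a + (g t - a)) by congr F; ring.
have -> : F (a + (g t - a)) = a0 + a1 * (g t - a) + r (g t - a) * (g t - a) ^+ 2.
  near: t; exact: (gc _ FE).
have -> : g t - a = (g1 + s t * t) * t.
  have -> : g t = a + g1 * t + s t * t ^+ 2 by near: t.
  ring.
ring.
Unshelve. all: by end_near. Qed.

(** One-sided, for curves that start at a boundary point and stay on the hypersurface for positive
    time only. *)
Lemma jet2_ge0r g g1 g2 : jet2 g 0 g1 g2 ->
  (\forall t \near (0 : R), 0 < t -> 0 <= g t) -> 0 <= g1.
Proof.
move=> [r rg gE] gp; rewrite leNgt; apply/negP => g10.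
have cI := cvg_idR.
have hc : (fun t => g1 + r t * t) @ 0 --> g1.
  have {2}-> : g1 = g1 + g2 * 0 by ring.
  exact: (cvg_addf (cvg_cstf g1) (cvg_mulf rg cI)).
have : \forall t \near (0 : R), g1 + r t * t < 0 by apply: cvgr_lt hc _ _.
move=> hn.
have : \forall t \near (0 : R), ~ (0 < t).
  near=> t => t0.
  have : g1 + r t * t < 0 by near: t.
  have : 0 < t -> 0 <= g t by near: t.
  move=> /(_ t0).
  have -> : g t = t * (g1 + r t * t).
    have -> : g t = 0 + g1 * t + r t * t ^+ 2 by near: t.
    ring.
  by rewrite pmulr_rge0 // leNgt => /negP.
move=> /nbhs_ballP[e /= e0 /(_ (e / 2))]; apply; last by rewrite divr_gt0.
rewrite /ball /= sub0r normrN gtr0_norm ?divr_gt0 //; lra.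
Unshelve. all: by end_near. Qed.

Lemma jet2_ge0 g g1 g2 : jet2 g 0 g1 g2 ->
  (\forall t \near (0 : R), 0 <= g t) -> g1 = 0 /\ 0 <= g2.
Proof.
move=> jg gp.
have g1_ge : 0 <= g1 by apply: jet2_ge0r jg _; apply: filterS gp => t.
(* Reversing time turns the one-sided statement into [g1 <= 0]. *)
have jgN : jet2 (fun t => g (- t)) 0 (- g1) g2.
  have jN : jet2 (fun t : R => - t) 0 (-1) 0.
    have := jet2Z (-1) jet2_id; rewrite !mulr0 mulr1; apply: jet2_near.
    by near=> t; rewrite mulN1r.
  have jg' : jet2 (fun t => g (0 + t)) 0 g1 g2.
    by apply: jet2_near jg; near=> t; rewrite add0r.
  apply: jet2_eq (jet2_comp jg' jN) _ _ _ => //; ring.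
have g1_le : 0 <= - g1.
  apply: jet2_ge0r jgN _.
  have cN : (fun t : R => - t) @ (0 : R) --> (0 : R).
    have : (fun t : R => - t) @ (0 : R) --> (- 0 : R) by apply: cvgN; exact: cvg_idR.
    by rewrite oppr0.
  near=> t => t0.
  have : 0 <= g (- t) by near: t; exact: (cN _ gp).
  by [].
have g10 : g1 = 0 by apply/eqP; rewrite eq_le g1_ge andbT -oppr_ge0.
split=> //.
move: jg; rewrite g10 => -[r rg gE].
rewrite leNgt; apply/negP => g20.
have : \forall t \near (0 : R), r t < 0 by apply: cvgr_lt rg _ _.
move=> rn.
have : \forall t \near (0 : R), ~ (0 < t).
  near=> t => t0.
  have : r t < 0 by near: t.
  have : 0 <= g t by near: t.
  have -> : g t = r t * t ^+ 2.
    have -> : g t = 0 + 0 * t + r t * t ^+ 2 by near: t.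
    ring.
  by rewrite pmulr_lge0 ?exprn_gt0 // leNgt => /negP.
move=> /nbhs_ballP[e /= e0 /(_ (e / 2))]; apply; last by rewrite divr_gt0.
rewrite /ball /= sub0r normrN gtr0_norm ?divr_gt0 //; lra.
Unshelve. all: by end_near. Qed.

End OneVariable.

Lemma cvg_eqr (T : Type) (U : topologicalType) (F : set_system T) (f : T -> U) (a b : U) :
  f @ F --> a -> a = b -> f @ F --> b.
Proof. by move=> ? <-. Qed.

Section Peano.
Variable R : realType.

(** Taylor's formula in Peano's form. Since [F1] is differentiable at [0], the derivative of the
    error [E] is at most [e * |x|] near [0], and the mean value theorem gives
    [|E t| <= e * t ^+ 2]. *)
Lemma peano2 (F F1 : R -> R) (c : R) :
  (\forall t \near (0 : R), is_derive (t : R) 1 F (F1 t)) -> is_derive (0 : R) 1 F1 c ->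
  jet2 F (F 0) (F1 0) (c / 2).
Proof.
move=> FF1 F1c.
pose r (t : R) := if t == 0 then c / 2 else (F t - F 0 - F1 0 * t) / t ^+ 2.
exists r; last first.
  near=> t; rewrite /r; case: eqVneq => [->|t0]; first by rewrite !mulr0 expr0n mulr0 !addr0.
  by field.
apply/cvgrPdist_le => e e0.
have := is_derive_approx F1c e0 => F1a.
have /nbhs_ballP[d /= d0 Hd] : \forall t \near (0:R), is_derive (t : R) 1 F (F1 t) /\
    `|F1 t - F1 0 - c * t| <= e * `|t|.
  near=> t; split; first by near: t.
  have : `|F1 (0 + t *: (1 : R^o)) - F1 0 - t *: (c : R^o)| <= e * `|t| by near: t; exact: F1a.
  by rewrite add0r /GRing.scale/= mulr1 (mulrC c).
near=> t; rewrite /r; case: eqVneq => [_|t0]; first by rewrite subrr normr0 ltW.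
have td : `|t| < d.
  by near: t; apply/nbhs_ballP; exists d => //= z; rewrite /ball/= sub0r normrN.
pose E (x : R) := F x - F 0 - F1 0 * x - c / 2 * x ^+ 2.
have dE (x : R) : `|x| < d -> is_derive x 1 E (F1 x - F1 0 - c * x).
  move=> xd.
  have [dF _] : is_derive (x : R) 1 F (F1 x) /\ `|F1 x - F1 0 - c * x| <= e * `|x|.
    by apply: Hd; rewrite /ball/= sub0r normrN.
  rewrite /E; apply: is_derive_eq.
  by rewrite /GRing.scale /=; field.
have E0 : E 0 = 0 by rewrite /E; ring.
have bE (x : R) : `|x| <= `|t| -> `|F1 x - F1 0 - c * x| <= e * `|t|.
  move=> xt; have [_ h] : is_derive (x : R) 1 F (F1 x) /\ `|F1 x - F1 0 - c * x| <= e * `|x|.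
    by apply: Hd; rewrite /ball/= sub0r normrN (le_lt_trans xt).
  by apply: le_trans h _; rewrite ler_pM2l.
have cE (x : R) : `|x| < d -> {for x, continuous E}.
  move=> xd; apply: differentiable_continuous; apply/derivable1_diffP.
  by have := dE _ xd => -[].
have ineq : `|E t| <= e * `|t| * `|t|.
  have [tp|tn] := ltP 0 t.
  - have [||x] := @MVT R E (fun x => F1 x - F1 0 - c * x) 0 t tp.
    + move=> x; rewrite in_itv /= => /andP[x0 xt]; apply: dE.
      by rewrite gtr0_norm //; rewrite gtr0_norm // in td; exact: lt_trans td.
    + apply: continuous_in_subspaceT => x; rewrite inE /= in_itv /= => /andP[x0 xt]; apply: cE.
      by rewrite ger0_norm //; rewrite gtr0_norm // in td; exact: le_lt_trans td.
    rewrite in_itv /= => /andP[x0 xt]; rewrite E0 !subr0 => ->.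
    rewrite normrM ler_pM2r ?normr_gt0 //; apply: bE.
    by rewrite !gtr0_norm // ltW.
  - have {}tn : t < 0 by rewrite lt_def eq_sym t0.
    have [||x] := @MVT R E (fun x => F1 x - F1 0 - c * x) t 0 tn.
    + move=> x; rewrite in_itv /= => /andP[x0 xt]; apply: dE.
      by rewrite ltr0_norm //; rewrite ltr0_norm // in td; rewrite ltrNl in td; rewrite ltrNl; exact: lt_trans x0.
    + apply: continuous_in_subspaceT => x; rewrite inE /= in_itv /= => /andP[x0 xt]; apply: cE.
      by rewrite ler0_norm //; rewrite ltr0_norm // in td; rewrite ltrNl in td; rewrite ltrNl; exact: lt_le_trans x0.
    rewrite in_itv /= => /andP[x0 xt]; rewrite E0 !sub0r => Et.
    rewrite -normrN Et normrM normrN ler_pM2r ?normr_gt0 //; apply: bE.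
    by rewrite !ltr0_norm // lerN2 ltW.
have t2 : 0 < t ^+ 2 by rewrite exprn_even_gt0.
have -> : c / 2 - (F t - F 0 - F1 0 * t) / t ^+ 2 = - E t / t ^+ 2 by rewrite /E; field.
rewrite normrM normrN normfV (gtr0_norm t2) ler_pdivrMr //.
by apply: le_trans ineq _; rewrite -mulrA -normrM -expr2 gtr0_norm.
Unshelve. all: by end_near. Qed.

(** Glues solutions found separately for each tolerance into a single function with a limit: [r t]
    is almost the solution nearest to [c]. The infimum of the distances need not be attained, hence
    the slack [|t|]. *)
Lemma choose_near (Q : R -> R -> Prop) (c : R) : Q 0 c ->
  (forall e, 0 < e -> \forall t \near (0 : R), exists2 r, Q t r & `|r - c| <= e) ->
  exists2 r : R -> R, r t @[t --> 0] --> c & \forall t \near (0 : R), Q t (r t).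
Proof.
move=> Q0 Qe.
pose D t := [set `|r - c| | r in Q t].
pose good t := [set r | Q t r /\ `|r - c| <= inf (D t) + `|t|].
have gex t : (exists r, Q t r) -> t != 0 -> good t !=set0.
  move=> [r0 Qr0] t0.
  have hD : has_inf (D t).
    split; first by exists `|r0 - c|; exists r0.
    by exists 0 => _ [? _ <-]; exact: normr_ge0.
  have t0' : 0 < `|t| by rewrite normr_gt0.
  have [_ [r Qr <-] /ltW h] := inf_adherent t0' hD.
  by exists r; split.
exists (fun t => if t == 0 then c else xget c (good t)); last first.
  near=> t; case: eqVneq => [->//|t0].
  have [r Qr _] : exists2 r, Q t r & `|r - c| <= 1 by near: t; exact: Qe.
  have [|r' Gr'] := gex t _ t0; first by exists r.
  by case: xgetP => [y _ []//|/(_ r')].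
apply/cvgrPdist_le => e e0.
have e2 : 0 < e / 2 by rewrite divr_gt0.
near=> t; case: eqVneq => [_|t0]; first by rewrite subrr normr0 ltW.
have [r Qr rc] : exists2 r, Q t r & `|r - c| <= e / 2 by near: t; exact: Qe e2.
have [|r' Gr'] := gex t _ t0; first by exists r.
have te : `|t| <= e / 2.
  near: t; apply/nbhs_ballP; exists (e / 2) => //= z.
  by rewrite /ball/= sub0r normrN => /ltW.
case: xgetP => [y _ [_ yc]|/(_ r')//].
rewrite distrC; apply: le_trans yc _.
have : inf (D t) <= e / 2.
  apply: le_trans rc; apply: ge_inf.
    by exists 0 => _ [? _ <-]; exact: normr_ge0.
  by exists r.
lra.
Unshelve. all: by end_near. Qed.

End Peano.

(** * Curves in level sets *)

Section Curves.
Variables (R : realType) (n : nat).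
Implicit Types (f h : 'rV[R]_n.+1 -> R) (p v N : 'rV[R]_n.+1).

Lemma derive_edot f p v : differentiable f p -> 'D_v f p = edot (gradient f p) v.
Proof.
move=> df; rewrite deriveE // {1}(row_sum_delta v) linear_sum /= edotE.
apply: eq_bigr => i _; rewrite linearZ /= mxE /partial deriveE // mulrC.
by [].
Qed.

Lemma smooth_near f p : smooth_on [set p] f ->
  \forall y \near p, forall vs, differentiable (iter_derive vs f) y.
Proof. by move=> /(_ p erefl). Qed.

Lemma smooth_differentiable f p : smooth_on [set p] f -> differentiable f p.
Proof. by move=> /smooth_near/nbhs_singleton/(_ [::]). Qed.

Lemma is_derive_along f (g : R -> 'rV[R]_n.+1) (t : R) w :
  differentiable f (g t) -> is_derive t 1 g w -> is_derive t 1 (f \o g) ('D_w f (g t)).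
Proof.
move=> df [/derivable1_diffP dg gw].
have dfg : differentiable (f \o g) t by exact: differentiable_comp.
apply: DeriveDef; first exact/derivable1_diffP.
rewrite deriveE // diff_comp //= deriveE //; congr ('d f (g t) _).
by rewrite -gw deriveE.
Qed.

Definition parabola p v N (k : R) (t : R) := p + t *: v + (k * t ^+ 2) *: N.

Lemma is_derive_parabola p v N k (t : R) :
  is_derive t 1 (parabola p v N k) (v + (2 * k * t) *: N).
Proof.
rewrite /parabola.
have dl : is_derive t 1 (fun t : R => t *: v) v.
  have dd : differentiable (fun t : R => t *: v) t by exact: differentiableZl.
  apply: DeriveDef; first exact/derivable1_diffP.
  by rewrite deriveE // diffZl //= diff_val scale1r.
have dq : is_derive t 1 (fun t : R => (k * t ^+ 2) *: N) ((2 * k * t) *: N).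
  have dk : is_derive t 1 (fun t : R => k * t ^+ 2) (2 * k * t).
    apply: is_derive_eq; rewrite /GRing.scale /=; ring.
  have dk' : differentiable (fun t : R => k * t ^+ 2) t by apply/derivable1_diffP; case: dk.
  have dd : differentiable (fun t : R => (k * t ^+ 2) *: N) t by exact: differentiableZl.
  apply: DeriveDef; first exact/derivable1_diffP.
  rewrite deriveE // diffZl //= -deriveE //.
  by have [_ ->] := dk.
have dp : is_derive t 1 (fun=> p) 0 by exact: is_derive_cst.
have := is_deriveD (is_deriveD dp dl) dq; rewrite add0r; exact.
Qed.

Lemma parabola_cvg p v N k : parabola p v N k t @[t --> 0] --> p.
Proof.
have [d _] := is_derive_parabola p v N k 0.
have /differentiable_continuous : differentiable (parabola p v N k) 0 by exact/derivable1_diffP.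
have p0 : parabola p v N k 0 = p by rewrite /parabola expr0n mulr0 !scale0r !addr0.
by rewrite -[X in _ -> _ --> X]p0; exact.
Qed.

Lemma jet2_parabola f p v N k : smooth_on [set p] f ->
  jet2 (f \o parabola p v N k) (f p) ('D_v f p) ('D_v (fun y => 'D_v f y) p / 2 + k * 'D_N f p).
Proof.
move=> sf.
pose g : R -> _ := parabola p v N k.
have g0 : g 0 = p by rewrite /g /parabola expr0n mulr0 !scale0r !addr0.
pose F1 (t : R) := 'D_v f (g t) + 2 * k * t * 'D_N f (g t).
have gc : g t @[t --> 0] --> p by exact: parabola_cvg.
have d1 : \forall t \near (0:R), is_derive (t : R) 1 (f \o g) (F1 t).
  have := gc _ (smooth_near sf); rewrite /nbhs /= => H.
  near=> t.
  have df : differentiable f (g t).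
    have : forall vs, differentiable (iter_derive vs f) (g t) by near: t.
    by move=> /(_ [::]).
  apply: is_derive_eq (is_derive_along df (is_derive_parabola p v N k t)) _.
  rewrite /F1 -/g.
  by rewrite !deriveE // linearD linearZ.
have dG w : is_derive (0:R) 1 (fun t => 'D_w f (g t)) ('D_v (fun y => 'D_w f y) p).
  have df : differentiable (fun y => 'D_w f y) (g 0).
    by rewrite g0; have /nbhs_singleton/(_ [:: w]) := smooth_near sf.
  have := is_derive_along df (is_derive_parabola p v N k 0).
  by rewrite -/g g0 mulr0 scale0r addr0.
have d2 : is_derive (0:R) 1 F1 ('D_v (fun y => 'D_v f y) p + 2 * k * 'D_N f p).
  have dv := dG v; have dN := dG N.
  rewrite /F1; apply: is_derive_eq.
  rewrite /GRing.scale /= g0.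
  by rewrite mulr0 mul0r add0r mulr1 (mulrC ('D_N f p)).
have := peano2 d1 d2; rewrite /= g0 => J.
apply: jet2_eq J _ _ _ => //; rewrite /F1 ?g0 ?mulr0 ?mul0r ?addr0 //.
move: ('D_v _ p) ('D_N f p) => x y; by field.
Unshelve. all: by end_near. Qed.

Definition curve p v N (s : R -> R) (t : R) := p + t *: v + (s t * t ^+ 2) *: N.

Lemma curve_cvg p v N s (k : R) : s @ (0 : R) --> k -> curve p v N s @ (0 : R) --> p.
Proof.
move=> sk.
have cI := @cvg_idR R.
have c1 : (fun t : R => s t * t ^+ 2) @ (0 : R) --> (0 : R).
  apply: (@cvg_eqr _ _ _ _ (k * (0 * 0))); last by rewrite !mulr0.
  by apply: cvgM; [exact: sk | under eq_fun do rewrite expr2; apply: cvgM].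
have c2 : (fun t : R => (s t * t ^+ 2) *: N) @ (0 : R) --> 0 *: N by apply: cvgZr_tmp.
have c3 : (fun t : R => t *: v) @ (0 : R) --> 0 *: v by apply: cvgZr_tmp.
apply: (@cvg_eqr _ _ _ _ (p + 0 *: v + 0 *: N)); last by rewrite !scale0r !addr0.
apply: cvgD; [apply: cvgD; [exact: cvg_cst | exact: c3] | exact: c2].
Qed.

(** A substitute for the implicit function theorem: the variations need only the limit of the
    quadratic coefficient, not a smooth curve. For small [t != 0], [f] is positive on the parabola
    with coefficient [k + e] and negative on the one with [k - e]; the intermediate value theorem,
    applied in the coefficient, gives a zero in between. *)
Lemma level_curve f p v : smooth_on [set p] f -> f p = 0 -> gradient f p != 0 ->
  edot (gradient f p) v = 0 ->
  exists2 s : R -> R,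
    s t @[t --> (0 : R)] --> - 'D_v (fun y => 'D_v f y) p / (2 * edot (gradient f p) (gradient f p)) &
    \forall t \near (0 : R), f (curve p v (gradient f p) s t) = 0.
Proof.
move=> sf fp0 N0 Nv; set N := gradient f p.
(* The coefficient that cancels the second-order term of [f] along the parabola. *)
pose k := - 'D_v (fun y => 'D_v f y) p / (2 * edot N N); rewrite -/k.
have NN : 0 < edot N N by rewrite edot_gt0.
have df := smooth_differentiable sf.
apply: (@choose_near R (fun t r => f (p + t *: v + (r * t ^+ 2) *: N) = 0)).
  by rewrite scale0r expr0n mulr0 scale0r !addr0.
move=> e e0.
have jet k' := jet2_parabola v N k' sf.
have val k' : 'D_v (fun y => 'D_v f y) p / 2 + k' * 'D_N f p = (k' - k) * edot N N.
  rewrite (derive_edot _ df) -/N /k -/N; field; exact: lt0r_neq0.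
clearbody k.
have [rp rpc rpE] := jet (k + e); have [rm rmc rmE] := jet (k - e).
rewrite !val !(derive_edot v df) Nv fp0 in rpc rmc rpE rmE.
have rp0 : \forall t \near (0:R), 0 < rp t.
  apply: cvgr_gt rpc _ _; rewrite addrAC subrr add0r; exact: mulr_gt0.
have rm0 : \forall t \near (0:R), rm t < 0.
  by apply: cvgr_lt rmc _ _; rewrite addrAC subrr add0r mulNr oppr_lt0 mulr_gt0.
have /nbhs_ballP[d /= d0 Hd] := smooth_near sf.
have cI := @cvg_idR R.
(* Keeps all points with coefficient in [[k - e, k + e]] in the ball where [f] is smooth, so that
   [f] is continuous along the whole segment. *)
have bnd : \forall t \near (0:R), `|t| * `|v| + (`|k| + e) * `|t| ^+ 2 * `|N| < d.
  have cb : (fun t : R => `|t| * `|v| + (`|k| + e) * `|t| ^+ 2 * `|N|) @ 0 --> (0:R).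
    have cn : (fun t : R => `|t|) @ 0 --> (0:R).
      have h : (fun t : R => `|t|) @ (0 : R) --> `|0 : R| by apply: cvg_norm; exact: cI.
      by apply: cvg_eqr h _; rewrite normr0.
    apply: (@cvg_eqr _ _ _ _ (0 * `|v| + (`|k| + e) * 0 ^+ 2 * `|N|)).
      exact: (cvg_addf (cvg_mulf cn (cvg_cstf `|v|))
        (cvg_mulf (cvg_mulf (cvg_cstf (`|k| + e)) (cvg_sqrf cn)) (cvg_cstf `|N|))).
    by rewrite expr0n !(mul0r, mulr0) addr0.
  by apply: cvgr_lt cb _ _.
near=> t.
have hp : f (parabola p v N (k + e) t) = rp t * t ^+ 2.
  have : (f \o parabola p v N (k + e)) t = 0 + 0 * t + rp t * t ^+ 2 by near: t.
  by rewrite mul0r !add0r.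
have hm : f (parabola p v N (k - e) t) = rm t * t ^+ 2.
  have : (f \o parabola p v N (k - e)) t = 0 + 0 * t + rm t * t ^+ 2 by near: t.
  by rewrite mul0r !add0r.
have rpt : 0 < rp t by near: t.
have rmt : rm t < 0 by near: t.
have bt : `|t| * `|v| + (`|k| + e) * `|t| ^+ 2 * `|N| < d by near: t.
have le : k - e <= k + e by move: e0; clear; lra.
have [||c] := @IVT R (fun s => f (p + t *: v + (s * t ^+ 2) *: N)) (k - e) (k + e) 0 le.
- apply: continuous_in_subspaceT => s; rewrite inE /= in_itv /= => /andP[s1 s2].
  have h1 : (fun s : R => p + t *: v + (s * t ^+ 2) *: N) @ s --> p + t *: v + (s * t ^+ 2) *: N.
    apply: cvgD; first exact: cvg_cst.
    by apply: cvgZr_tmp; apply: cvgM; [exact: cvg_id | exact: cvg_cst].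
  suff h2 : {for p + t *: v + (s * t ^+ 2) *: N, continuous f}.
    exact: (@cvg_comp _ _ _ _ f _ _ _ h1 h2).
  apply: differentiable_continuous.
  suff : forall vs, differentiable (iter_derive vs f) (p + t *: v + (s * t ^+ 2) *: N) by move=> /(_ [::]).
  apply: Hd; rewrite -ball_normE /= -addrA opprD addrA subrr sub0r normrN.
  apply: le_lt_trans bt; apply: le_trans (ler_normD _ _) _; rewrite !normrZ lerD2l.
  rewrite -expr2; apply: ler_wpM2r => //; apply: ler_wpM2r; first exact: exprn_ge0.
  have := ler_norm k; have := ler_norm (- k); rewrite normrN.
  by move: s1 s2; clear; rewrite ler_norml => *; apply/andP; split; lra.
- have -> : f (p + t *: v + ((k - e) * t ^+ 2) *: N) = rm t * t ^+ 2 by rewrite -hm.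
  have -> : f (p + t *: v + ((k + e) * t ^+ 2) *: N) = rp t * t ^+ 2 by rewrite -hp.
  rewrite ge_min le_max; apply/andP; split; apply/orP; [left|right].
    by rewrite mulr_le0_ge0 ?sqr_ge0 // ltW.
  by rewrite mulr_ge0 ?sqr_ge0 // ltW.
rewrite in_itv /= => /andP[c1 c2] fc; exists c => //.
by move: c1 c2; clear; rewrite ler_norml => *; apply/andP; split; lra.
Unshelve. all: by end_near. Qed.

End Curves.

Section Charts.
Variables (R : realType) (n : nat).
Implicit Types (f h : 'rV[R]_n.+1 -> R) (p v N : 'rV[R]_n.+1) (S : set 'rV[R]_n.+1).

Lemma is_derive_curve p v N s (k : R) : s @ (0 : R) --> k ->
  is_derive (0 : R) 1 (curve p v N s) v.
Proof.
move=> sk.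
have c0 : curve p v N s 0 = p by rewrite /curve expr0n mulr0 !scale0r !addr0.
have cI := @cvg_idR R.
have lim : (fun t : R => t^-1 *: ((curve p v N s \o shift 0) (t *: (1 : R^o)) - curve p v N s 0)) @ (0 : R)^' --> v.
  have h1 : (fun t : R => v + (s t * t) *: N) @ (0 : R) --> v.
    apply: (@cvg_eqr _ _ _ _ (v + (k * 0) *: N)); last by rewrite mulr0 scale0r addr0.
    apply: cvgD; first exact: cvg_cst.
    by apply: cvgZr_tmp; apply: cvgM; [exact: sk | exact: cI].
  have h2 : (fun t : R => v + (s t * t) *: N) @ (0 : R)^' --> v.
    by apply: cvg_trans h1; apply: cvg_app; exact: cvg_within.
  apply: cvg_trans h2; apply: near_eq_cvg; rewrite near_withinE; near=> t => t0.
  have t1 : t *: (1 : R^o) = t by rewrite /GRing.scale /= mulr1.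
  rewrite /= c0 addr0 t1 /curve.
  have -> : p + t *: v + (s t * t ^+ 2) *: N - p = t *: (v + (s t * t) *: N).
    by apply/rowP => i; rewrite !mxE; ring.
  by rewrite scalerA mulVf // scale1r.
apply: DeriveDef; first by apply/cvg_ex; exists v.
exact: cvg_lim lim.
Unshelve. all: by end_near. Qed.

Lemma interior_curve S p f v : S p -> interior_chart S p f -> edot (gradient f p) v = 0 ->
  exists2 s : R -> R,
    s t @[t --> (0 : R)] --> - 'D_v (fun y => 'D_v f y) p / (2 * edot (gradient f p) (gradient f p)) &
    \forall t \near (0 : R), S (curve p v (gradient f p) s t).
Proof.
move=> Sp [sf N0 nS] vN.
have fp : f p = 0 by apply/(nbhs_singleton nS).
have [s sc sf0] := level_curve sf fp N0 vN.
exists s => //.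
have cc := @curve_cvg R n p v (gradient f p) s _ sc.
have := cc _ nS; rewrite /nbhs /= => nS'.
near=> t.
have h : S (curve p v (gradient f p) s t) <-> f (curve p v (gradient f p) s t) = 0 by near: t.
by apply/h; near: t.
Unshelve. all: by end_near. Qed.

Lemma row_free2 (u w : 'rV[R]_n.+1) : row_free (col_mx u w) -> forall c, (u != 0) /\ (w - c *: u != 0).
Proof.
move=> /row_freeP[B hB] c.
split.
  apply/eqP => u0; have : (row_mx (1 : 'M[R]_1) (0 : 'M[R]_1)) *m col_mx u w *m B = 0.
    by rewrite mul_row_col u0 mulmx0 mul0mx addr0 mul0mx.
  rewrite -mulmxA hB mulmx1 => /matrixP/(_ 0 (lshift 1 0)).
  by rewrite row_mxEl !mxE eqxx => /eqP; rewrite oner_eq0.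
apply/eqP => /eqP; rewrite subr_eq0 => /eqP wu.
have : (row_mx ((- c)%:M : 'M[R]_1) (1 : 'M[R]_1)) *m col_mx u w *m B = 0.
  by rewrite mul_row_col wu mul1mx mul_scalar_mx scaleNr addNr mul0mx.
rewrite -mulmxA hB mulmx1 => /matrixP/(_ 0 (rshift 1 0)).
by rewrite row_mxEr !mxE eqxx => /eqP; rewrite oner_eq0.
Qed.

(** The curve in the level set of [f] leaves [p] in a direction in which [h] decreases to first
    order, so the quadratic correction cannot push it out of [h <= 0]. *)
Lemma boundary_curve S p f h v : S p -> boundary_chart S p f h ->
  edot (gradient f p) v = 0 -> edot (gradient h p) v < 0 ->
  exists k, exists2 s : R -> R, s t @[t --> (0 : R)] --> (k : R) &
    \forall t \near (0 : R), 0 < t -> S (curve p v (gradient f p) s t).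
Proof.
move=> Sp [sf sh rf hp nS] vN vH.
have [fp _] : f p = 0 /\ h p <= 0 by apply/(nbhs_singleton nS).
have [N0 _] := row_free2 rf 0.
have [s sc sf0] := level_curve sf fp N0 vN.
eexists; exists s; first exact: sc.
set N := gradient f p in sc sf0 N0 vN *.
have cc := @curve_cvg R n p v N s _ sc.
have := cc _ nS; rewrite /nbhs /= => nS'.
have c0 : curve p v N s 0 = p by rewrite /curve expr0n mulr0 !scale0r !addr0.
have dh : differentiable h (curve p v N s 0) by rewrite c0; exact: smooth_differentiable.
have dd := is_derive_along dh (@is_derive_curve p v N s _ sc).
rewrite c0 derive_edot in dd; last by rewrite -c0.
have e0 : 0 < - edot (gradient h p) v / 2 by rewrite divr_gt0 // oppr_gt0.
have ap := is_derive_approx dd e0.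
near=> t => t0.
have hS : S (curve p v N s t) <-> f (curve p v N s t) = 0 /\ h (curve p v N s t) <= 0 by near: t.
apply/hS; split; first by near: t.
have : `|(h \o curve p v N s) (0 + t *: (1 : R^o)) - (h \o curve p v N s) 0 - t *: (edot (gradient h p) v : R^o)|
    <= (- edot (gradient h p) v / 2) * `|t| by near: t; exact: ap.
rewrite /= c0 hp add0r subr0 /GRing.scale /= mulr1 (gtr0_norm t0) ler_norml => /andP[_ H].
have : t * edot (gradient h p) v < 0 by rewrite pmulr_rlt0.
move: H; set a := edot _ _; set b := h _ => H1 H2.
have : b <= t * a / 2 by lra.
lra.
Unshelve. all: by end_near. Qed.

End Charts.

Section ConformalMetric.
Variables (R : realType) (n : nat) (phi : R -> R).
Implicit Types (p u v : 'rV[R]_n.+1).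
Local Notation g := (conformal_metric n phi).

Lemma gdot_conformal p u v : gdot g p u v = expR (2 * phi (enorm p)) * edot u v.
Proof. by rewrite /gdot /conformal_metric mul_mx_scalar -scalemxAl mxE. Qed.

(** The conormal is the normalised component of [gradient h p] tangent to the hypersurface. The free
    boundary condition makes it a positive multiple of [p]; hence [- p] is tangent and points
    inward, which every boundary argument exploits. *)
Lemma free_boundary_radial S p f h : free_boundary g S -> S p -> boundary_chart S p f h ->
  edot (gradient f p) p = 0 /\ 0 < edot (gradient h p) p.
Proof.
move=> fb Sp bc; have [sf sh rf hp nS] := bc.
set F := gradient f p in rf *; set H := gradient h p in rf *.
pose c := edot H F / edot F F.
have [F0 e0] := row_free2 rf c.
set e := H - c *: F in e0.
have FF : edot F F != 0 by rewrite edot_eq0.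
have Fe : edot F e = 0 by rewrite /e edotBr edotZr /c (edotC H F) divfK // subrr.
have ee : 0 < edot e e by rewrite edot_gt0.
have He : edot H e = edot e e by rewrite {2}/e edotBl edotZl Fe mulr0 subr0.
have s0 : 0 < expR (2 * phi (enorm p)) by exact: expR_gt0.
set s := expR _ in s0.
pose mu := (Num.sqrt (s * edot e e))^-1.
have mu0 : 0 < mu by rewrite invr_gt0 sqrtr_gt0 mulr_gt0.
have [nu1 _ nu3] : outer_normal g p (mu *: e).
  apply: (fb p f h) => //; split; rewrite -/F -/H.
  - by rewrite edotZr Fe mulr0.
  - move=> v Fv Hv; rewrite gdot_conformal edotZl {1}/e edotBl edotZl Fv Hv; ring.
  - rewrite gdot_conformal -/s edotZl edotZr.
    have -> : s * (mu * (mu * edot e e)) = mu ^+ 2 * (s * edot e e) by ring.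
    rewrite /mu exprVn sqr_sqrtr; last first.
      by rewrite mulr_ge0 // ltW.
    by rewrite mulVf // mulf_neq0 // gt_eqF.
  - by rewrite edotZr He mulr_gt0.
have pe : 0 < edot p e by move: nu3; rewrite edotZr pmulr_rgt0.
have p0 : p != 0 by apply: contraTneq pe => ->; rewrite edot0l ltxx.
have pp : 0 < edot p p by rewrite edot_gt0.
pose d := edot p e / edot p p.
have d0 : 0 < d by rewrite divr_gt0.
have pv : edot p (e - d *: p) = 0 by rewrite edotBr edotZr /d divfK ?subrr // gt_eqF.
have := nu1 _ pv; rewrite gdot_conformal edotZl => /eqP.
rewrite -/s mulf_eq0 (gt_eqF s0) mulf_eq0 (gt_eqF mu0) /= => /eqP ev.
have : edot (e - d *: p) (e - d *: p) == 0 by rewrite edotBl edotZl ev pv mulr0 subrr.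
rewrite edot_eq0 subr_eq0 => /eqP edp.
split.
  by move: Fe; rewrite edp edotZr => /eqP; rewrite mulf_eq0 (gt_eqF d0) /= => /eqP.
by move: ee; rewrite -He edp edotZr pmulr_rgt0.
Qed.

Lemma fbm_points r0 S p : compact_free_boundary_minimal g r0 S -> S p ->
  (exists2 f, interior_chart S p f & ((enorm p)%:E < r0)%E) \/
  (exists f h, [/\ boundary_chart S p f h, edot (gradient f p) p = 0,
     0 < edot (gradient h p) p & (enorm p)%:E = r0]).
Proof.
move=> [[_ cov] _ [Sr bd] _ fb] Sp.
have pr := Sr _ Sp; rewrite /cball /= in pr.
have [e|ne] := pselect ((enorm p)%:E = r0).
  right; have : (S `&` esphere r0) p by split; [exact: Sp | exact: e].
  rewrite bd => -[_ [f [h bc]]]; exists f, h.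
  by have [] := free_boundary_radial fb Sp bc.
left; have [|hb] := cov _ Sp; last first.
  by case: ne; have [] : (S `&` esphere r0) p by rewrite bd.
move=> [_ [f ic]]; exists f => //.
by rewrite lt_neqAle pr andbT; apply/eqP.
Qed.

End ConformalMetric.

Section ScalarDerivatives.
Variables (R : realType) (V : normedModType R) (p v : V).
Implicit Types f h : V -> R.

Lemma derivable_mulf f h : derivable f p v -> derivable h p v ->
  derivable (fun y => f y * h y) p v.
Proof. exact: derivableM. Qed.

Lemma derive_mulf f h : derivable f p v -> derivable h p v ->
  'D_v (fun y => f y * h y) p = f p * 'D_v h p + h p * 'D_v f p.
Proof. exact: deriveM. Qed.

Lemma derive_lincomb m (a : 'I_m -> R) (f : 'I_m -> V -> R) :
  (forall i, derivable (f i) p v) ->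
  'D_v (\sum_i (a i *: f i)) p = \sum_i a i * 'D_v (f i) p.
Proof.
move=> df; rewrite derive_sum; last by move=> i; exact: derivableZ.
by apply: eq_bigr => i _; rewrite deriveZ.
Qed.

End ScalarDerivatives.

(** * Conformally flat metrics *)

Section ConformalCurvature.
Variables (R : realType) (n : nat) (phi : R -> R).
Implicit Types (p u v x : 'rV[R]_n.+1) (f : 'rV[R]_n.+1 -> R).
Local Notation g := (conformal_metric n phi).

Definition cfactor x : R := expR (2 * phi (enorm x)).

Lemma cfactor_gt0 x : 0 < cfactor x.
Proof. exact: expR_gt0. Qed.

(* The partial derivatives of [phi(|x|)]. *)
Definition dlog (i : 'I_n.+1) x : R := partial i cfactor x / (2 * cfactor x).

Lemma conformalE x i j : g x i j = cfactor x *+ (i == j).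
Proof. by rewrite /conformal_metric mxE. Qed.

Lemma partial_conformal i j l x :
  partial i (fun y => g y j l) x = (j == l)%:R * partial i cfactor x.
Proof.
rewrite (_ : (fun y => g y j l) = fun y => cfactor y *+ (j == l)); last first.
  by apply/funext => y; exact: conformalE.
case: (j == l); first by rewrite mul1r.
rewrite mul0r /partial.
exact: derive_cst.
Qed.

Lemma invmx_conformal x : invmx (g x) = (cfactor x)^-1%:M.
Proof. by rewrite /conformal_metric invmx_scalar. Qed.

Lemma christoffel_conformal k i j x : christoffel g k i j x =
  (k == j)%:R * dlog i x + (k == i)%:R * dlog j x - (i == j)%:R * dlog k x.
Proof.
rewrite /christoffel (bigD1 k) //= big1 => [|l lk]; last first.
  by rewrite invmx_conformal mxE eq_sym (negPf lk) mulr0n mul0r.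
rewrite invmx_conformal !mxE eqxx mulr1n addr0 !partial_conformal /dlog.
have s0 := cfactor_gt0 x; move: (partial _ _ _) (partial _ _ _) (partial _ _ _) (cfactor x) s0 => a b c s s0.
rewrite (eq_sym k j) (eq_sym k i); field; exact: lt0r_neq0.
Qed.

Lemma sum_delta (F : 'I_n.+1 -> R) k : \sum_i (k == i)%:R * F i = F k.
Proof.
rewrite (bigD1 k) //= eqxx mul1r big1 ?addr0 // => i ik.
by rewrite eq_sym (negPf ik) mul0r.
Qed.

Lemma christoffel_sum (d v N : 'rV[R]_n.+1) k :
  \sum_i \sum_j ((k == j)%:R * d 0 i + (k == i)%:R * d 0 j - (i == j)%:R * d 0 k)
     * v 0 i * N 0 j = edot d v * N 0 k + edot d N * v 0 k - edot v N * d 0 k.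
Proof.
transitivity (\sum_i (d 0 i * v 0 i * N 0 k + (k == i)%:R * (v 0 i * edot d N) -
    v 0 i * N 0 i * d 0 k)).
  apply: eq_bigr => i _.
  transitivity (\sum_j ((k == j)%:R * (d 0 i * v 0 i * N 0 j) +
     (k == i)%:R * v 0 i * (d 0 j * N 0 j) - (i == j)%:R * (d 0 k * v 0 i * N 0 j))).
    by apply: eq_bigr => j _; ring.
  rewrite sumrB big_split /= (sum_delta (fun j => d 0 i * v 0 i * N 0 j)).
  rewrite (sum_delta (fun j => d 0 k * v 0 i * N 0 j)) -mulr_sumr -edotE; ring.
rewrite sumrB big_split /= -!mulr_suml.
by rewrite (sum_delta (fun i => v 0 i * edot d N)) -!edotE (mulrC (v 0 k)).
Qed.

Lemma covariant_term (v N x : 'rV[R]_n.+1) :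
  \row_k \sum_i \sum_j christoffel g k i j x * v 0 i * N 0 j =
  edot (\row_i dlog i x) v *: N + edot (\row_i dlog i x) N *: v
    - edot v N *: \row_i dlog i x.
Proof.
set d := \row_i dlog i x.
have dE i : dlog i x = d 0 i by rewrite mxE.
apply/rowP => k; rewrite [LHS]mxE.
under eq_bigr => i _ do under eq_bigr => j _ do rewrite christoffel_conformal !dE.
rewrite christoffel_sum; clearbody d.
by rewrite !mxE.
Qed.

(** The derivative of [k] multiplies [edot (gradient f p) v = 0]. Normalising the normal therefore
    changes the second fundamental form by a factor only. *)
Lemma edot_derive_scale (k : 'rV[R]_n.+1 -> R) f p v :
  smooth_on [set p] f -> derivable k p v -> edot (gradient f p) v = 0 ->
  edot ('D_v (fun y => k y *: gradient f y) p) v = k p * 'D_v (fun y => 'D_v f y) p.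
Proof.
move=> sf dk vN.
have dpar i : derivable (partial i f) p v.
  by apply: diff_derivable; have /nbhs_singleton/(_ [:: delta_mx 0 i]) := smooth_near sf.
have coef i : (fun y => (k y *: gradient f y) 0 i) = (fun y => k y * partial i f y).
  by apply/funext => y; rewrite !mxE.
have dkX : derivable (fun y => k y *: gradient f y) p v.
  by apply/derivable_mxP => i j; rewrite (ord1 i) coef; exact: (derivable_mulf dk (dpar j)).
rewrite derive_mx // edotE.
have -> : 'D_v (fun y => 'D_v f y) p = \sum_i v 0 i * 'D_v (partial i f) p.
  transitivity ('D_v (\sum_i (v 0 i *: partial i f)) p).
    apply: near_eq_derive; near=> y.
    have : forall vs, differentiable (iter_derive vs f) y by near: y; exact: smooth_near.
    move=> /(_ [::]) df; rewrite derive_edot // edotE fct_sumE; apply: eq_bigr => i _.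
    by rewrite !mxE mulrC.
  exact: (derive_lincomb (fun i => v 0 i) dpar).
transitivity (\sum_i (k p * (v 0 i * 'D_v (partial i f) p) + 'D_v k p * (gradient f p 0 i * v 0 i))).
  apply: eq_bigr => i _; rewrite mxE coef (derive_mulf dk (dpar i)) mxE.
  by move: (k p) (v 0 i) (partial i f p) ('D_v _ _) ('D_v _ _) => *; ring.
by rewrite big_split /= -!mulr_sumr -edotE vN mulr0 addr0.
Unshelve. all: by end_near. Qed.

Lemma second_derive_scale f p (k : R) v : smooth_on [set p] f ->
  'D_(k *: v) (fun y => 'D_(k *: v) f y) p = k ^+ 2 * 'D_v (fun y => 'D_v f y) p.
Proof.
move=> sf.
have df : \forall y \near p, differentiable f y.
  by apply: filterS (smooth_near sf) => y /(_ [::]).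
have dfp : differentiable (fun y => 'D_v f y) p.
  by have /nbhs_singleton/(_ [:: v]) := smooth_near sf.
transitivity ('D_(k *: v) (k *: (fun y => 'D_v f y)) p).
  apply: near_eq_derive; near=> y.
  have dfy : differentiable f y by near: y.
  by rewrite deriveE // linearZ /= -deriveE.
rewrite deriveZ; last exact: diff_derivable.
by rewrite !deriveE // linearZ /= /GRing.scale /= mulrA -expr2.
Unshelve. all: by end_near. Qed.

Definition normal_scale f x : R :=
  (Num.sqrt ((cfactor x)^-1 * edot (gradient f x) (gradient f x)))^-1 * (cfactor x)^-1.

Lemma unit_normal_conformal f :
  unit_normal g f = fun x => normal_scale f x *: gradient f x.
Proof.
apply/funext => x; rewrite /unit_normal invmx_conformal tr_scalar_mx mul_mx_scalar.
rewrite scalerA /normal_scale gdot_conformal -/(cfactor x) edotZl edotZr.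
congr ((Num.sqrt _)^-1 * _ *: _).
by rewrite mulrA divff ?mul1r // gt_eqF // cfactor_gt0.
Qed.

Lemma derivable_normal_scale f p v : smooth_on [set p] f -> differentiable cfactor p ->
  gradient f p != 0 -> derivable (normal_scale f) p v.
Proof.
move=> sf dc N0.
have c0 : cfactor p != 0 by rewrite gt_eqF // cfactor_gt0.
have dV : derivable (fun x => (cfactor x)^-1) p v.
  by apply: derivableV => //; exact: diff_derivable.
apply: derivable_mulf dV.
have dE : differentiable (fun x => edot (gradient f x) (gradient f x)) p.
  have -> : (fun x => edot (gradient f x) (gradient f x)) =
      \sum_i (partial i f * partial i f).
    apply/funext => x; rewrite edotE fct_sumE; apply: eq_bigr => i _; by rewrite !mxE.
  apply: differentiable_sum => i.
  have h : differentiable (partial i f) p.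
    by have /nbhs_singleton/(_ [:: delta_mx 0 i]) := smooth_near sf.
  exact: differentiableM.
have pos : 0 < (cfactor p)^-1 * edot (gradient f p) (gradient f p).
  by rewrite mulr_gt0 ?invr_gt0 ?cfactor_gt0 // edot_gt0.
apply: derivableV; first by rewrite gt_eqF // sqrtr_gt0.
apply: diff_derivable.
apply: (@differentiable_comp _ _ _ _ (fun x => (cfactor x)^-1 * edot (gradient f x) (gradient f x)) (@Num.sqrt R)).
  by apply: (@differentiableM _ _ (fun x => (cfactor x)^-1)); [exact: differentiableV | exact: dE].
by apply/derivable1_diffP; have [] := is_derive1_sqrt pos.
Qed.

(** Of the three Christoffel terms in [covariant_term] only the one along [v] survives: the other
    two produce a factor [edot (gradient f p) v]. *)
Lemma second_ff_conformal f p v (w : R) : smooth_on [set p] f -> gradient f p != 0 ->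
  differentiable cfactor p -> (\row_i dlog i p) = w *: p -> edot (gradient f p) v = 0 ->
  second_ff g f p v v = cfactor p * normal_scale f p *
    ('D_v (fun y => 'D_v f y) p + w * edot p (gradient f p) * edot v v).
Proof.
move=> sf N0 dc gr vN.
rewrite /second_ff gdot_conformal -/(cfactor p) /covariant_derive covariant_term.
rewrite unit_normal_conformal gr !(edotDl, edotBl, edotNl, edotZl, edotZr).
rewrite edot_derive_scale //; last exact: derivable_normal_scale.
rewrite (edotC v) vN; ring.
Qed.

(** Translates minimality into the Euclidean trace of the Hessian. Scaling the frame by [k] makes it
    [g]-orthonormal, and each of its [n] vectors contributes the same multiple of the derivative of
    [phi] along the normal. *)
Lemma minimal_trace S f p (E : 'M[R]_(n, n.+1)) (w : R) : minimal g S -> S p ->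
  interior_chart S p f -> differentiable cfactor p -> (\row_i dlog i p) = w *: p ->
  E *m E^T = 1%:M -> E *m (gradient f p)^T = 0 ->
  \sum_i 'D_(row i E) (fun y => 'D_(row i E) f y) p = - (n%:R * w * edot p (gradient f p)).
Proof.
move=> mS Sp ic dc gr EE EN.
have [sf N0 _] := ic.
have c0 := cfactor_gt0 p.
pose k := (Num.sqrt (cfactor p))^-1.
have k0 : 0 < k by rewrite invr_gt0 sqrtr_gt0.
have k2 : k ^+ 2 = (cfactor p)^-1 by rewrite exprVn sqr_sqrtr // ltW.
have rowN i := frame_row_orth i EN.
have rowE i := frame_row_norm i EE.
have tf : tangent_frame g f p (k *: E).
  split; last by rewrite -scalemxAl EN scaler0.
  have -> : (k *: E)^T = k *: E^T by apply/matrixP => i j; rewrite !mxE.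
  rewrite /conformal_metric mul_mx_scalar -/(cfactor p) -!scalemxAl -scalemxAr EE.
  by rewrite !scalerA -[_ * k * k]mulrA -expr2 k2 divff ?scale1r // gt_eqF.
have := mS p f _ Sp (or_introl ic) tf.
rewrite (eq_bigr (fun i => cfactor p * normal_scale f p * k ^+ 2 *
    ('D_(row i E) (fun y => 'D_(row i E) f y) p + w * edot p (gradient f p)))); last first.
  move=> i _; have -> : row i (k *: E) = k *: row i E by apply/rowP => j; rewrite !mxE.
  rewrite (@second_ff_conformal _ _ _ w) //; last by rewrite edotZr rowN mulr0.
  rewrite second_derive_scale // edotZl edotZr rowE; ring.
rewrite -mulr_sumr => /eqP; rewrite mulf_eq0 gt_eqF /=; last first.
  rewrite !mulr_gt0 ?exprn_gt0 // ?invr_gt0 // sqrtr_gt0 mulr_gt0 ?invr_gt0 //.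
  by rewrite edot_gt0.
rewrite big_split /= sumr_const card_ord -mulr_natl addr_eq0 => /eqP ->; ring.
Qed.

End ConformalCurvature.

(** * Ricci curvature of a conformally flat metric *)

Section RicciAlgebra.
Variables (R : realType) (n : nat).

Lemma christoffel_square (d : 'I_n.+1 -> R) i j :
  \sum_k \sum_l ((k == l)%:R * d j + (k == j)%:R * d l - (j == l)%:R * d k) *
    ((l == k)%:R * d i + (l == i)%:R * d k - (i == k)%:R * d l) =
  n%:R * d i * d j + 3 * d i * d j - 2 * (i == j)%:R * \sum_k d k ^+ 2.
Proof.
set s := \sum_k d k ^+ 2.
pose X k l : R := (l == k)%:R * d i + (l == i)%:R * d k - (i == k)%:R * d l.
have dX k : \sum_l d l * X k l = 2 * d i * d k - (i == k)%:R * s.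
  transitivity (\sum_l ((k == l)%:R * (d l * d i) + (i == l)%:R * (d l * d k) - (i == k)%:R * d l ^+ 2)).
    by apply: eq_bigr => l _; rewrite /X (eq_sym l k) (eq_sym l i); ring.
  rewrite sumrB big_split /= (sum_delta (fun l => d l * d i)) (sum_delta (fun l => d l * d k)).
  by rewrite -mulr_sumr -/s; ring.
transitivity (\sum_k (d i * d j + (j == k)%:R * (2 * d i * d k - (i == k)%:R * s) -
    ((j == k)%:R * (d k * d i) + (i == j)%:R * d k ^+ 2 - (i == k)%:R * (d k * d j)))).
  apply: eq_bigr => k _.
  transitivity (\sum_l ((k == l)%:R * (d j * X k l) + (k == j)%:R * (d l * X k l) - (j == l)%:R * (d k * X k l))).
    by apply: eq_bigr => l _; rewrite /X; ring.
  rewrite sumrB big_split /= (sum_delta (fun l => d j * X k l)) (sum_delta (fun l => d k * X k l)).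
  rewrite -mulr_sumr dX /X eqxx mulr1n (eq_sym k j) (eq_sym k i) (eq_sym j i); ring.
rewrite sumrB big_split /= sumrB big_split /=.
rewrite (sum_delta (fun k => 2 * d i * d k - (i == k)%:R * s)) (sum_delta (fun k => d k * d i)).
rewrite (sum_delta (fun k => d k * d j)) -!mulr_sumr -/s sumr_const card_ord -[_ *+ n.+1]mulr_natl -[n.+1%:R]natr1.
by ring.
Qed.

(** The classical formula for the Ricci tensor of [e^(2 phi) delta] in dimension [n + 1], with [d]
    and [H] standing for the gradient and the Hessian of [phi]. The left side is the coordinate
    definition with the Christoffel symbols written out. *)
Lemma ricci_algebra (d : 'I_n.+1 -> R) (H : 'I_n.+1 -> 'I_n.+1 -> R) i j :
  (forall i j, H i j = H j i) ->
  \sum_k (((k == j)%:R * H i k + (k == i)%:R * H j k - (i == j)%:R * H k k) -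
    ((k == k)%:R * H i j + (k == i)%:R * H k j - (i == k)%:R * H k j)) +
  \sum_k \sum_l (((k == l)%:R * d k + (k == k)%:R * d l - (k == l)%:R * d k) *
      ((l == j)%:R * d i + (l == i)%:R * d j - (i == j)%:R * d l) -
    ((k == l)%:R * d j + (k == j)%:R * d l - (j == l)%:R * d k) *
    ((l == k)%:R * d i + (l == i)%:R * d k - (i == k)%:R * d l)) =
  - (n%:R - 1) * (H i j - d i * d j)
  - (i == j)%:R * (\sum_k H k k + (n%:R - 1) * \sum_k d k ^+ 2).
Proof.
move=> Hs.
have -> : \sum_k (((k == j)%:R * H i k + (k == i)%:R * H j k - (i == j)%:R * H k k) -
    ((k == k)%:R * H i j + (k == i)%:R * H k j - (i == k)%:R * H k j)) =
  - (n%:R - 1) * H i j - (i == j)%:R * \sum_k H k k.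
  transitivity (\sum_k ((j == k)%:R * H i k + (i == k)%:R * H j k - (i == j)%:R * H k k - H i j)).
    by apply: eq_bigr => k _; rewrite eqxx mulr1n (eq_sym k j) (eq_sym k i); ring.
  rewrite !sumrB big_split /= (sum_delta (fun k => H i k)) (sum_delta (fun k => H j k)).
  by rewrite -mulr_sumr sumr_const card_ord -[_ *+ n.+1]mulr_natl -[n.+1%:R]natr1 (Hs j i); ring.
have -> : \sum_k \sum_l (((k == l)%:R * d k + (k == k)%:R * d l - (k == l)%:R * d k) *
      ((l == j)%:R * d i + (l == i)%:R * d j - (i == j)%:R * d l) -
    ((k == l)%:R * d j + (k == j)%:R * d l - (j == l)%:R * d k) *
    ((l == k)%:R * d i + (l == i)%:R * d k - (i == k)%:R * d l)) =
  \sum_(k < n.+1) (2 * d i * d j - (i == j)%:R * \sum_k d k ^+ 2) -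
  (n%:R * d i * d j + 3 * d i * d j - 2 * (i == j)%:R * \sum_k d k ^+ 2).
  rewrite -christoffel_square -sumrB; apply: eq_bigr => k _.
  rewrite sumrB; congr (_ - _).
  transitivity (\sum_l ((j == l)%:R * (d l * d i) + (i == l)%:R * (d l * d j) - (i == j)%:R * d l ^+ 2)).
    by apply: eq_bigr => l _; rewrite eqxx mulr1n (eq_sym l j) (eq_sym l i); ring.
  rewrite sumrB big_split /= (sum_delta (fun l => d l * d i)) (sum_delta (fun l => d l * d j)).
  by rewrite -mulr_sumr; ring.
by rewrite sumr_const card_ord -[_ *+ n.+1]mulr_natl -[n.+1%:R]natr1; ring.
Qed.

End RicciAlgebra.

Section RicciConformal.
Variables (R : realType) (n : nat) (phi : R -> R).
Implicit Types (u v x : 'rV[R]_n.+1).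
Local Notation g := (conformal_metric n phi).
Local Notation dlog := (dlog phi).

Lemma ricci_coef_conformal x (H : 'I_n.+1 -> 'I_n.+1 -> R) i j :
  (forall i k, is_derive x (delta_mx 0 k) (dlog i) (H i k)) ->
  (forall i j, H i j = H j i) ->
  ricci_coef g i j x = - (n%:R - 1) * (H i j - dlog i x * dlog j x)
  - (i == j)%:R * (\sum_k H k k + (n%:R - 1) * \sum_k dlog k x ^+ 2).
Proof.
move=> dH Hs; rewrite -ricci_algebra // /ricci_coef.
have pC l k i' j' : partial l (christoffel g k i' j') x =
    (k == j')%:R * H i' l + (k == i')%:R * H j' l - (i' == j')%:R * H k l.
  have -> : christoffel g k i' j' =
      (k == j')%:R *: dlog i' + (k == i')%:R *: dlog j' - (i' == j')%:R *: dlog k.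
    by apply/funext => y; exact: christoffel_conformal.
  have := is_deriveB (is_deriveD (is_deriveZ (k == j')%:R (dH i' l)) (is_deriveZ (k == i')%:R (dH j' l)))
    (is_deriveZ (i' == j')%:R (dH k l)).
  by move=> [_ <-].
congr (_ + _).
  by apply: eq_bigr => k _; rewrite !pC.
by apply: eq_bigr => k _; apply: eq_bigr => l _; rewrite !christoffel_conformal.
Qed.

(** For radial [phi], [u] is [phi' / r] and [w] is [(phi' / r)' / r]. *)
Lemma ricci_radial x (u w : R) v v' :
  (forall i, dlog i x = u * x 0 i) ->
  (forall i k, is_derive x (delta_mx 0 k) (dlog i) (u * (i == k)%:R + w * (x 0 i * x 0 k))) ->
  ricci g x v v' = - (n%:R - 1) * (w - u ^+ 2) * edot x v * edot x v'
   - (2 * n%:R * u + w * edot x x + (n%:R - 1) * u ^+ 2 * edot x x) * edot v v'.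
Proof.
move=> du dH; rewrite /ricci.
pose A := - (n%:R - 1) * (w - u ^+ 2).
pose B := - (2 * n%:R * u + w * edot x x + (n%:R - 1) * u ^+ 2 * edot x x).
have coef i j : ricci_coef g i j x = A * (x 0 i * x 0 j) + (i == j)%:R * B.
  rewrite (ricci_coef_conformal _ _ dH); last first.
    by move=> a b; rewrite (eq_sym b a) (mulrC (x 0 b)).
  have -> : \sum_k (u * (k == k)%:R + w * (x 0 k * x 0 k)) = (n%:R + 1) * u + w * edot x x.
    under eq_bigr do rewrite eqxx mulr1.
    by rewrite big_split /= sumr_const card_ord -mulr_sumr -edotE -[_ *+ n.+1]mulr_natl natr1.
  have -> : \sum_k dlog k x ^+ 2 = u ^+ 2 * edot x x.
    by rewrite edotE mulr_sumr; apply: eq_bigr => k _; rewrite du; ring.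
  rewrite !du /A /B; ring.
transitivity (\sum_i (A * (x 0 i * v 0 i) * edot x v' + B * (v 0 i * v' 0 i))).
  apply: eq_bigr => i _.
  transitivity (\sum_j (A * (x 0 i * v 0 i) * (x 0 j * v' 0 j) + (i == j)%:R * (B * (v 0 i * v' 0 j)))).
    by apply: eq_bigr => j _; rewrite coef; ring.
  by rewrite big_split /= -mulr_sumr -edotE (sum_delta (fun j => B * (v 0 i * v' 0 j))).
by rewrite big_split /= -mulr_suml -!mulr_sumr -!edotE /A /B; ring.
Qed.

End RicciConformal.

(** * Radial functions *)

Section NormDerivative.
Variables (R : realType) (n : nat).
Implicit Types (x v : 'rV[R]_n.+1).

Lemma differentiable_compR (G : 'rV[R]_n.+1 -> R) (F : R -> R) x (F' : R) :
  differentiable G x -> is_derive (G x) 1 F F' -> differentiable (F \o G) x.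
Proof.
move=> dG [dF _]; apply: differentiable_comp => //.
exact/derivable1_diffP.
Qed.

Lemma is_derive_compR (G : 'rV[R]_n.+1 -> R) (F : R -> R) x v (F' : R) :
  differentiable G x -> is_derive (G x) 1 F F' -> is_derive x v (F \o G) (F' * 'D_v G x).
Proof.
move=> dG dF; have [d1 FE] := dF.
have dFG := differentiable_compR dG dF.
apply: DeriveDef; first exact: diff_derivable.
have dF' : differentiable F (G x) by exact/derivable1_diffP.
by rewrite deriveE // diff_comp //= diff1E // derive1E FE -deriveE // /GRing.scale /= mulrC.
Qed.

Lemma is_derive_coord x v i : is_derive x v (fun y : 'rV[R]_n.+1 => y 0 i) (v 0 i).
Proof.
apply: DeriveDef; first exact/diff_derivable/differentiable_coord.
have := derive_mx (@derivable_id R 'rV[R]_n.+1 x v); rewrite derive_id => /matrixP/(_ 0 i).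
by rewrite [RHS]mxE => <-.
Qed.

Lemma differentiable_edot x : differentiable (fun y : 'rV[R]_n.+1 => edot y y) x.
Proof.
have -> : (fun y : 'rV[R]_n.+1 => edot y y) =
    \sum_i ((fun y : 'rV[R]_n.+1 => y 0 i) * (fun y : 'rV[R]_n.+1 => y 0 i)).
  by apply/funext => y; rewrite edotE fct_sumE.
by apply: differentiable_sum => i; apply: differentiableM; exact: differentiable_coord.
Qed.

Lemma derive_edot2 x v : 'D_v (fun y : 'rV[R]_n.+1 => edot y y) x = 2 * edot x v.
Proof.
have -> : (fun y : 'rV[R]_n.+1 => edot y y) =
    \sum_i ((fun y : 'rV[R]_n.+1 => y 0 i) * (fun y : 'rV[R]_n.+1 => y 0 i)).
  by apply/funext => y; rewrite edotE fct_sumE.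
have dc i : derivable (fun y : 'rV[R]_n.+1 => y 0 i) x v by have [] := is_derive_coord x v i.
rewrite derive_sum; last by move=> i; exact: derivableM.
rewrite edotE mulr_sumr; apply: eq_bigr => i _.
rewrite deriveM //; have [_ ->] := is_derive_coord x v i.
by rewrite /GRing.scale /=; ring.
Qed.

Lemma differentiable_enorm x : x != 0 -> differentiable (@enorm R n.+1) x.
Proof.
move=> x0; apply: (differentiable_compR (differentiable_edot x)).
by apply: is_derive1_sqrt; rewrite edot_gt0.
Qed.

Lemma derive_enorm x v : x != 0 -> 'D_v (@enorm R n.+1) x = edot x v / enorm x.
Proof.
move=> x0; have pos : 0 < edot x x by rewrite edot_gt0.
have [_] := is_derive_compR v (differentiable_edot x) (is_derive1_sqrt pos).
rewrite derive_edot2 => ->; rewrite -/(enorm x).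
have : enorm x != 0 by rewrite gt_eqF // enorm_gt0.
by move: (enorm x) (edot x v) => a b a0; field.
Qed.

End NormDerivative.

Section RadialFactor.
Variables (R : realType) (n : nat) (phi : R -> R) (B : set 'rV[R]_n.+1).
Hypothesis sB : smooth_metric_on B (conformal_metric n phi).
Implicit Types (x v : 'rV[R]_n.+1).
Local Notation cfactor := (@cfactor R n phi).
Local Notation dlog := (@dlog R n phi).

Lemma smooth_cfactor x : B x -> smooth_on [set x] cfactor.
Proof.
move=> Bx _ ->.
have -> : cfactor = fun x => conformal_metric n phi x 0 0.
  by apply/funext => y; rewrite conformalE eqxx mulr1n.
exact: sB.
Qed.

Let e0 : 'rV[R]_n.+1 := delta_mx 0 0.

Lemma enorm_axis (r : R) : enorm (r *: e0) = `|r|.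
Proof. by rewrite enormZ /enorm edot_delta mxE !eqxx sqrtr1 mulr1. Qed.

(* [B] meets the axis at [r]; for the radially symmetric [B] of the theorem this is
   a condition on the radius only. *)
Definition radius (r : R) := 0 < r /\ B (r *: e0).

(* [curl] is [phi' / r], and [slope] is the derivative of [conf] with respect to [r ^ 2]; it has the
   sign opposite to [phi' / r], and [(phi' / r)' - r (phi' / r) ^ 2 < 0] says that it increases. *)
Definition dphi (s : R) : R := 'D_e0 cfactor (s *: e0) / (2 * cfactor (s *: e0)).
Definition curl (s : R) : R := dphi s / s.
Definition conf (s : R) : R := expR (- phi s).
Definition slope (s : R) : R := - (curl s / 2 * conf s).

Lemma is_derive_axis (s : R) : is_derive (s : R) 1 (fun t : R => t *: e0) e0.
Proof.
have := @is_derive_parabola R n 0 e0 0 0 s.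
rewrite mulr0 mul0r scale0r addr0; apply: near_eq_is_derive.
by near=> t; rewrite /parabola mul0r scale0r add0r addr0.
Unshelve. all: by end_near. Qed.

(** Smoothness is assumed of the metric, not of [phi], so the regularity of [phi] is read off from
    the metric along one axis. For [s < 0] the metric does not see [phi s]. *)
Lemma phi_axis (s : R) : 0 < s -> phi s = ln (cfactor (s *: e0)) / 2.
Proof. by move=> s0; rewrite /cfactor enorm_axis gtr0_norm // expRK; field. Qed.

Lemma axis_cvg (r : R) : (fun s : R => s *: e0) @ r --> r *: e0.
Proof.
have [d _] := is_derive_axis r.
have dd : differentiable (fun s : R => s *: e0) r by exact/derivable1_diffP.
exact: (differentiable_continuous dd).
Qed.

Lemma is_derive_cfactor_axis (r : R) : differentiable cfactor (r *: e0) ->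
  is_derive (r : R) 1 (fun s => cfactor (s *: e0)) ('D_e0 cfactor (r *: e0)).
Proof. by move=> d; exact: (is_derive_along d (is_derive_axis r)). Qed.

Lemma near_axis (r : R) : radius r -> \forall s \near r,
  0 < s /\ forall vs, differentiable (iter_derive vs cfactor) (s *: e0).
Proof.
move=> [r0 Br].
have := @axis_cvg r _ (smooth_near (smooth_cfactor Br)); rewrite /nbhs /= => H.
near=> s; split; last by near: s.
by near: s; exact: lt_nbhsr.
Unshelve. all: by end_near. Qed.

Lemma is_derive_phi_at (s : R) : 0 < s -> differentiable cfactor (s *: e0) ->
  is_derive (s : R) 1 phi (dphi s).
Proof.
move=> s0 d.
have c0 : 0 < cfactor (s *: e0) by exact: cfactor_gt0.
have h := @is_derive1_comp R (@ln R) (fun s => cfactor (s *: e0)) s _ _ (is_derive1_ln c0) (is_derive_cfactor_axis d).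
have h2 : is_derive (s : R) 1 (2^-1 *: (@ln R \o (fun s => cfactor (s *: e0)))) (dphi s).
  apply: is_derive_eq (is_deriveZ 2^-1 h) _.
  rewrite /dphi /GRing.scale /=; move: (cfactor _) c0 ('D_e0 _ _) => c c0 b.
  by field; rewrite gt_eqF.
apply: near_eq_is_derive h2; near=> t.
rewrite phi_axis; last by near: t; exact: lt_nbhsr.
by rewrite mulrC.
Unshelve. all: by end_near. Qed.

Lemma is_derive_phi (r : R) : radius r -> \forall s \near r, is_derive (s : R) 1 phi (dphi s).
Proof.
move=> /near_axis; apply: filterS => s [s0 /(_ [::]) d].
exact: is_derive_phi_at.
Qed.

Lemma derivable_dphi (r : R) : radius r -> derivable dphi r 1.
Proof.
move=> rr; have [_ d] := nbhs_singleton (near_axis rr).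
have c0 : cfactor (r *: e0) != 0 by rewrite gt_eqF // cfactor_gt0.
have [d1 _] := is_derive_along (d [:: e0]) (is_derive_axis r).
have [d2 _] := is_derive_along (d [::]) (is_derive_axis r).
have d3 : derivable (fun s : R => 2 * cfactor (s *: e0)) (r : R) (1 : R) by exact: (@derivableZ R R^o R^o _ 2 _ _ d2).
apply: derivableM; first exact: d1.
by apply: derivableV => //; rewrite mulf_neq0.
Qed.

Definition dcurl (r : R) : R := 'D_1 curl r.

Lemma is_derive_curl (r : R) : radius r -> is_derive (r : R) 1 curl (dcurl r).
Proof.
move=> rr; apply/derivableP; apply: derivableM; first exact: derivable_dphi.
apply: derivableV; [by rewrite gt_eqF //; case: rr | exact: derivable_id].
Qed.

Lemma is_derive_conf_at (s : R) : 0 < s -> is_derive (s : R) 1 phi (dphi s) ->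
  is_derive (s : R) 1 conf (2 * s * slope s).
Proof.
move=> s0 d.
have dN := is_deriveN d.
have -> : conf = expR \o (- phi) by [].
apply: is_derive_eq (@is_derive1_comp R expR (- phi) s _ _ (is_derive_expR _) dN) _.
rewrite /slope /curl /conf.
by move: (expR _) (dphi s) => a b; field; rewrite gt_eqF.
Qed.

Lemma is_derive_conf (r : R) : radius r -> is_derive (r : R) 1 conf (2 * r * slope r).
Proof.
move=> rr; apply: is_derive_conf_at; first by case: rr.
exact: (nbhs_singleton (is_derive_phi rr)).
Qed.

Lemma is_derive_slope (r : R) : radius r -> is_derive (r : R) 1 slope
  (- (conf r / 2) * (dcurl r - r * curl r ^+ 2)).
Proof.
move=> rr; have r0 : r != 0 by rewrite gt_eqF //; case: rr.
have h := is_deriveN (is_deriveM (is_deriveZ 2^-1 (is_derive_curl rr)) (is_derive_conf rr)).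
have -> : slope = - ((2^-1 *: curl) * conf).
  by apply/funext => s; rewrite /slope mulrC (mulrC (curl s)) mulrC.
apply: is_derive_eq h _; rewrite /slope /GRing.scale /=.
have sc (a b : R) : a *: (b : R^o) = a * b by []; rewrite !sc.
by move: (conf r) (curl r) (dcurl r) => a b c; field.
Qed.

Lemma conf_gt0 (s : R) : 0 < conf s.
Proof. exact: expR_gt0. Qed.

Lemma dlog_radial_at x i : x != 0 -> is_derive (enorm x) 1 phi (dphi (enorm x)) ->
  dlog i x = curl (enorm x) * x 0 i.
Proof.
move=> x0 dp.
have d2 : is_derive (enorm x) 1 (fun s => expR (2 * phi s)) (expR (2 * phi (enorm x)) * (2 * dphi (enorm x))).
  exact: (@is_derive1_comp R expR (2 *: phi) _ _ _ (is_derive_expR _) (is_deriveZ 2 dp)).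
have [_] := is_derive_compR (delta_mx 0 i) (differentiable_enorm x0) d2.
rewrite derive_enorm // edot_delta /dlog /partial => ->.
rewrite -/(cfactor x) /curl.
have := cfactor_gt0 phi x; have : 0 < enorm x by rewrite enorm_gt0.
move: (cfactor x) (enorm x) (dphi _) (x 0 i) => a b c d b0 a0.
by field; rewrite !gt_eqF.
Qed.

Lemma dlog_radial x i : radius (enorm x) -> dlog i x = curl (enorm x) * x 0 i.
Proof.
move=> rr; apply: dlog_radial_at; first by case: rr; rewrite enorm_gt0.
exact: (nbhs_singleton (is_derive_phi rr)).
Qed.

Lemma is_derive_dlog x i k : radius (enorm x) ->
  is_derive x (delta_mx 0 k) (dlog i)
    (curl (enorm x) * (i == k)%:R + dcurl (enorm x) / enorm x * (x 0 i * x 0 k)).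
Proof.
move=> rr; have x0 : x != 0 by case: rr; rewrite enorm_gt0.
have h1 := is_derive_compR (delta_mx 0 k) (differentiable_enorm x0) (is_derive_curl rr).
have h2 := is_derive_coord x (delta_mx 0 k) i.
have h := is_deriveM h1 h2.
apply: near_eq_is_derive (is_derive_eq h _).
  have cn : {for x, continuous (@enorm R n.+1)}.
    exact: (differentiable_continuous (differentiable_enorm x0)).
  have := cn _ (near_axis rr); rewrite /nbhs /= => H.
  near=> y.
  have [y0 dy] : 0 < enorm y /\ forall vs, differentiable (iter_derive vs cfactor) (enorm y *: e0).
    by near: y.
  have yn : y != 0 by rewrite -enorm_gt0.
  by rewrite (dlog_radial_at i yn (is_derive_phi_at y0 (dy [::]))).
rewrite derive_enorm // edot_delta mxE eqxx /=.
have sc (a b : R) : a *: (b : R^o) = a * b by []; rewrite !sc /=.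
by move: (dcurl (enorm x)) (curl (enorm x)) => a b; move: (enorm x) => c; ring.
Unshelve. all: by end_near. Qed.

Lemma ricci_radial_conformal x v v' : radius (enorm x) ->
  ricci (conformal_metric n phi) x v v' =
  - (n%:R - 1) * (dcurl (enorm x) / enorm x - curl (enorm x) ^+ 2) * edot x v * edot x v'
   - (2 * n%:R * curl (enorm x) + dcurl (enorm x) / enorm x * edot x x
      + (n%:R - 1) * curl (enorm x) ^+ 2 * edot x x) * edot v v'.
Proof.
move=> rr; apply: ricci_radial => [i|i k]; first exact: dlog_radial.
exact: is_derive_dlog.
Qed.

(** The part of the Ricci tensor proportional to the metric cancels between the radial and a
    transverse unit vector. What remains is [dcurl r - r * curl r ^+ 2] times [- (n%:R - 1)] and a
    positive factor, so strict positivity determines its sign. *)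
Lemma slope_derive_gt0 (A : set 'rV[R]_n.+1) (r : R) : (0 < n)%N ->
  ricci_largest_radially A (conformal_metric n phi) -> A (r *: e0) -> radius r ->
  0 < - (conf r / 2) * (dcurl r - r * curl r ^+ 2).
Proof.
move=> n0 ric Ar rr; have r0 : 0 < r by case: rr.
pose x := r *: e0.
have nx : enorm x = r by rewrite enorm_axis gtr0_norm.
have x0 : x != 0 by rewrite -enorm_gt0 nx.
have c0 := cfactor_gt0 phi x.
pose k := (Num.sqrt (cfactor x))^-1.
have k0 : 0 < k by rewrite invr_gt0 sqrtr_gt0.
have k2 : cfactor x * k ^+ 2 = 1 by rewrite exprVn sqr_sqrtr ?divff ?gt_eqF // ltW.
pose v : 'rV[R]_n.+1 := k *: delta_mx 0 ord_max.
have ee : edot (delta_mx 0 ord_max : 'rV[R]_n.+1) (delta_mx 0 ord_max) = 1.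
  by rewrite edot_delta mxE !eqxx.
have xv : edot x v = 0.
  rewrite edotZl edotZr edot_delta mxE eqxx /=.
  have -> : (ord_max == 0 :> 'I_n.+1) = false by apply/negP => /eqP/(congr1 val)/=; case: (n) n0.
  by rewrite !mulr0.
have vv : edot v v = k ^+ 2 by rewrite edotZl edotZr ee mulr1.
have xx : edot x x = r ^+ 2 by rewrite -enorm2 nx.
have := ric x v Ar x0; clearbody x.
rewrite !gdot_conformal -/(cfactor x) vv k2 edotZr (edotC v) xv !mulr0 => /(_ erefl erefl).
have rr' : radius (enorm x) by rewrite nx.
set h := radial_unit _ _.
have hE : h = (k / r) *: x.
  rewrite /h /radial_unit gdot_conformal -/(cfactor x) xx sqrtrM; last exact: ltW.
  by rewrite sqrtr_sqr gtr0_norm // invfM.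
rewrite !ricci_radial_conformal // xv vv hE !edotZr !edotZl xx !nx.
rewrite -subr_gt0.
have nn : 0 <= n%:R - 1 :> R by rewrite subr_ge0 ler1n.
have C0 := conf_gt0 r.
move: nn; set N := n%:R - 1; set u := curl r; set w := dcurl r => nn.
move=> H.
have {H} H : 0 < - (N * (w - r * u ^+ 2) * (r * k ^+ 2)).
  apply: lt_le_trans H _; rewrite le_eqVlt; apply/orP; left; apply/eqP.
  by field; rewrite gt_eqF.
have rk : 0 < r * k ^+ 2 by rewrite mulr_gt0 // exprn_gt0.
have : N * (w - r * u ^+ 2) < 0.
  by move: H; rewrite oppr_gt0 pmulr_llt0.
have [wn|wp] := ltP (w - r * u ^+ 2) 0.
  by rewrite mulNr -mulrN mulr_gt0 ?oppr_gt0 // divr_gt0.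
by rewrite ltNge mulr_ge0.
Qed.

End RadialFactor.

(** * The curvature hypothesis and the convexity of the profile *)

Lemma first_integral_limit (R : realType) (c : R) (f g : R -> R) (a b : R) :
  f @ (0 : R) --> a -> g @ (0 : R) --> b ->
  s ^+ 2 * (c / 4) * f s + s * g s / 2 + s ^+ 2 * g s ^+ 2 / 4 @[s --> (0 : R)] --> (0 : R).
Proof.
move=> fa gb; have cI := @cvg_idR R.
apply: (@cvg_eqr _ _ _ _ (0 ^+ 2 * (c / 4) * a + 0 * b / 2 + 0 ^+ 2 * b ^+ 2 / 4)); last first.
  by rewrite expr0n !(mul0r, mulr0) !addr0.
exact: (cvg_addf (cvg_addf (cvg_mulf (cvg_mulf (cvg_sqrf cI) (cvg_cstf (c / 4))) fa)
  (cvg_mulf (cvg_mulf cI gb) (cvg_cstf 2^-1))) (cvg_mulf (cvg_mulf (cvg_sqrf cI) (cvg_sqrf gb))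
  (cvg_cstf 4^-1))).
Qed.

Section RadialProfile.
Variables (R : realType) (n : nat) (phi : R -> R) (rbar r0 : \bar R).
Hypothesis n_gt0 : (0 < n)%N.
Hypothesis sm : smooth_metric_on (oball rbar `|` cball r0) (conformal_metric n phi).
Let B : set 'rV[R]_n.+1 := oball rbar `|` cball r0.
Local Notation cfactor := (@cfactor R n phi).
Local Notation radius := (radius B).
Local Notation curl := (@curl R n phi).
Local Notation dcurl := (@dcurl R n phi).
Local Notation dphi := (@dphi R n phi).
Local Notation slope := (@slope R n phi).
Local Notation conf := (conf phi).
Let e0 : 'rV[R]_n.+1 := delta_mx 0 0.

Lemma oball_axis (r : R) : 0 <= r -> (r%:E < rbar)%E -> (oball rbar : set 'rV[R]_n.+1) (r *: e0).
Proof. by move=> r_ge0 rr; rewrite /oball /= enorm_axis ger0_norm. Qed.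

Lemma radius_lt (r : R) : 0 < r -> (r%:E < rbar)%E -> radius r.
Proof. by move=> rp rr; split=> //; left; apply: oball_axis => //; exact: ltW. Qed.

Lemma radius_le (r : R) : 0 < r -> (r%:E <= r0)%E -> radius r.
Proof. by move=> rp rr; split=> //; right; rewrite /cball /= enorm_axis gtr0_norm. Qed.

(** For [n > 1] the trace-free part of the Ricci tensor has to vanish, and comparing the radial with
    one transverse direction detects it. *)
Lemma constant_curl_high (c : R) (r : R) : (1 < n)%N ->
  (forall x u v, (oball rbar : set 'rV[R]_n.+1) x ->
     ricci (conformal_metric n phi) x u v = c * gdot (conformal_metric n phi) x u v) ->
  0 < r -> (r%:E < rbar)%E -> dcurl r - r * curl r ^+ 2 = 0.
Proof.
move=> n1 ric rp rr.
have rad := radius_lt rp rr.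
pose x := r *: e0; pose v : 'rV[R]_n.+1 := delta_mx 0 ord_max.
have nx : enorm x = r by rewrite enorm_axis gtr0_norm.
have ox : (oball rbar : set 'rV[R]_n.+1) x by apply: oball_axis => //; exact: ltW.
have rx : radius (enorm x) by rewrite nx.
have o0 : (ord_max == 0 :> 'I_n.+1) = false by apply/negP => /eqP/(congr1 val)/=; case: (n) n_gt0.
have xx : edot x x = r ^+ 2 by rewrite -enorm2 nx.
have xv : edot x v = 0 by rewrite edotZl edot_delta mxE eqxx o0 mulr0.
have xe : edot x e0 = r by rewrite edotZl edot_delta mxE !eqxx mulr1.
have ee : edot e0 e0 = 1 by rewrite edot_delta mxE !eqxx.
have vv : edot v v = 1 by rewrite edot_delta mxE !eqxx.
have h1 := ric x e0 e0 ox; have h2 := ric x v v ox.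
move: h1 h2; rewrite !(ricci_radial_conformal sm) // !gdot_conformal xx xe xv ee vv nx.
move=> h1 h2.
have : (n%:R - 1) * (dcurl r / r - curl r ^+ 2) * r ^+ 2 = 0.
  move: h1 h2; set a := expR _; set u := curl r; set w := dcurl r.
  move: (n%:R) => N h1 h2.
  have : - (N - 1) * (w / r - u ^+ 2) * r * r = 0 by move: h1 h2; lra.
  by move=> h; rewrite -[LHS]opprK -[RHS]oppr0; congr (- _); rewrite -[RHS]h; ring.
have nn : (n%:R - 1 : R) != 0 by rewrite subr_eq0 (eqr_nat R n 1) gtn_eqF.
move=> /eqP; rewrite mulf_eq0 sqrf_eq0 (gt_eqF rp) orbF mulf_eq0 (negPf nn) /= subr_eq0 => /eqP h.
by rewrite -h mulrCA divff ?mulr1 ?subrr // gt_eqF.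
Qed.

(* On surfaces the condition [Ric = c g] is the second order equation
   [r u' = - c e^(2 phi) - 2 u] for [u = phi' / r]; the quantity [F] below is a first
   integral of it, and it vanishes at the origin. *)
Lemma constant_curl_low (c : R) (r : R) : n = 1%N ->
  (forall x u v, (oball rbar : set 'rV[R]_n.+1) x ->
     ricci (conformal_metric n phi) x u v = c * gdot (conformal_metric n phi) x u v) ->
  0 < r -> (r%:E < rbar)%E -> dcurl r - r * curl r ^+ 2 = 0.
Proof.
move=> n1 ric rp rr.
have nR : n%:R = 1 :> R by rewrite n1.
have ode s : 0 < s -> s <= r -> s * dcurl s = - c * cfactor (s *: e0) - 2 * curl s.
  move=> sp sr; have srb : (s%:E < rbar)%E by apply: le_lt_trans rr; rewrite lee_fin.
  have rad := radius_lt sp srb.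
  pose x := s *: e0; pose v : 'rV[R]_n.+1 := delta_mx 0 ord_max.
  have nx : enorm x = s by rewrite enorm_axis gtr0_norm.
  have ox : (oball rbar : set 'rV[R]_n.+1) x by apply: oball_axis => //; exact: ltW.
  have rx : radius (enorm x) by rewrite nx.
  have o0 : (ord_max == 0 :> 'I_n.+1) = false by apply/negP => /eqP/(congr1 val)/=; case: (n) n_gt0.
  have xx : edot x x = s ^+ 2 by rewrite -enorm2 nx.
  have xv : edot x v = 0 by rewrite edotZl edot_delta mxE eqxx o0 mulr0.
  have vv : edot v v = 1 by rewrite edot_delta mxE !eqxx.
  have := ric x v v ox.
  rewrite (ricci_radial_conformal sm) // gdot_conformal -/(cfactor x) xx xv vv nx nR.
  move: (dcurl s) (curl s) (cfactor x) => a b d h.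
  have -> : s * a = a / s * s ^+ 2 by field; rewrite gt_eqF.
  by move: h; lra.
pose F s : R := s ^+ 2 * (c / 4 * cfactor (s *: e0) + curl s / 2 + s ^+ 2 * curl s ^+ 2 / 4).
have dF s : 0 < s -> s <= r -> is_derive (s : R) 1 F 0.
  move=> sp sr; have srb : (s%:E < rbar)%E by apply: le_lt_trans rr; rewrite lee_fin.
  have rad := radius_lt sp srb.
  have du := is_derive_curl sm rad.
  have [_ /(_ [::]) dc] := nbhs_singleton (near_axis sm rad).
  have dcf := is_derive_cfactor_axis dc.
  have c0 := cfactor_gt0 phi (s *: e0).
  have dcE : 'D_e0 cfactor (s *: e0) = 2 * s * curl s * cfactor (s *: e0).
    rewrite /curl /dphi; move: ('D__ _ _) (cfactor (s *: e0)) c0 => a b b0.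
    by field; rewrite !gt_eqF.
  rewrite dcE in dcf.
  have dI : is_derive (s : R) 1 (fun t : R => t ^+ 2) (2 * s).
    by apply: is_derive_eq; rewrite /GRing.scale /=; ring.
  have d1 := is_deriveD (is_deriveD (is_deriveZ (c / 4) dcf) (is_deriveZ 2^-1 du))
     (is_deriveZ 4^-1 (is_deriveM dI (is_deriveM du du))).
  have := is_deriveM dI d1.
  have -> : (fun t : R => t ^+ 2) * (c / 4 *: (fun t : R => cfactor (t *: e0)) + 2^-1 *: curl
       + 4^-1 *: ((fun t : R => t ^+ 2) * (curl * curl))) = F.
    apply/funext => t; rewrite /F -[LHS]/(t ^+ 2 * (c / 4 * cfactor (t *: e0) + 2^-1 * curl t + 4^-1 * (t ^+ 2 * (curl t * curl t)))).
    by move: (cfactor _) (curl _) => a b; field.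
  move=> h; apply: is_derive_eq h _.
  have sc (a b : R) : a *: (b : R^o) = a * b by []; rewrite !sc.
  rewrite -[((_ + _) : R -> R) s]/(c / 4 * cfactor (s *: e0) + 2^-1 * curl s + 4^-1 * (s ^+ 2 * (curl s * curl s))).
  rewrite -[(curl * curl) s]/(curl s * curl s).
  have := ode s sp sr; move: (dcurl s) (curl s) (cfactor _) => w u a h.
  have -> : w = (- c * a - 2 * u) / s by rewrite -h; field; rewrite gt_eqF.
  by field; rewrite gt_eqF.
have cF s : 0 < s -> s <= r -> {for s, continuous F}.
  move=> sp sr; have [d _] := dF s sp sr.
  by apply: differentiable_continuous; exact/derivable1_diffP.
have Fc s : 0 < s -> s <= r -> F s = F r.
  move=> sp sr; have [||x _] := @MVT_segment R F (fun=> 0) s r sr.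
  - move=> x; rewrite in_itv /= => /andP[x1 x2]; apply: dF; [exact: lt_trans x1 | exact: ltW].
  - apply: continuous_in_subspaceT => x; rewrite inE /= in_itv /= => /andP[x1 x2].
    by apply: cF => //; exact: lt_le_trans x1.
  by rewrite mul0r => /eqP; rewrite subr_eq0 => /eqP.
(* [G] is [F] with [s * curl s] replaced by [dphi s]: the latter is continuous at the origin,
   whereas [curl] divides by [s]. *)
pose G s : R := s ^+ 2 * (c / 4) * cfactor (s *: e0) + s * dphi s / 2 + s ^+ 2 * dphi s ^+ 2 / 4.
have FG s : 0 < s -> F s = G s.
  move=> sp; rewrite /F /G /curl; move: (dphi s) (cfactor _) => a b.
  by field; rewrite gt_eqF.
have G0 : G s @[s --> (0 : R)] --> (0 : R).
  have B0 : B (0 *: e0) by left; apply: oball_axis => //; apply: lt_trans rr; rewrite lte_fin.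
  have sc := smooth_near (smooth_cfactor sm B0).
  have dv vs : {for 0 *: e0, continuous (iter_derive vs cfactor)}.
    by apply: differentiable_continuous; exact: (nbhs_singleton sc).
  have c1 := @cvg_comp _ _ _ (fun s : R => s *: e0) _ _ _ _ (@axis_cvg R n 0) (dv [::]).
  have c2 := @cvg_comp _ _ _ (fun s : R => s *: e0) _ _ _ _ (@axis_cvg R n 0) (dv [:: e0]).
  have cn : 2 * cfactor (0 *: e0) != 0 by rewrite mulf_neq0 // gt_eqF // cfactor_gt0.
  have c3 : dphi s @[s --> (0 : R)] --> dphi 0.
    apply: cvgM; first exact: c2.
    by apply: cvgV => //; apply: cvgM; [exact: cvg_cst | exact: c1].
  exact: (first_integral_limit c c1 c3).
have Fr : F r = 0.
  apply/eqP/negPn/negP => Fn.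
  have /cvgr_dist_lt/(_ _ (_ : 0 < `|F r|))[|e /= ep He] := G0; first by rewrite normr_gt0.
  pose s := Num.min (e / 2) r.
  have sp : 0 < s by rewrite lt_min rp divr_gt0.
  have sr : s <= r by rewrite ge_min lexx orbT.
  have se : s < e by rewrite gt_min; apply/orP; left; lra.
  have := He s; rewrite /= !sub0r !normrN gtr0_norm // => /(_ se).
  by rewrite -FG // Fc // ltxx.
have := ode r rp (lexx r).
move: Fr; rewrite /F => /eqP; rewrite mulf_eq0 sqrf_eq0 (gt_eqF rp) /=.
move: (dcurl r) (curl r) (cfactor _) => w u a /eqP h1 h2.
(* Eliminating [c * cfactor] between the first integral and the differential equation leaves
   [r * w = r ^+ 2 * u ^+ 2]. *)
have : r * (w - r * u ^+ 2) = 0.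
  have -> : r * (w - r * u ^+ 2) = r * w - r ^+ 2 * u ^+ 2 by ring.
  by rewrite h2; lra.
by move=> /eqP; rewrite mulf_eq0 (gt_eqF rp) => /eqP.
Qed.

End RadialProfile.

Section ProfileConvexity.
Variables (R : realType) (n : nat) (phi : R -> R) (rbar r0 : \bar R).
Hypothesis n_gt0 : (0 < n)%N.
Hypothesis r0_le : (r0 <= rbar)%E.
Hypothesis sm : smooth_metric_on (oball rbar `|` cball r0) (conformal_metric n phi).
Let B : set 'rV[R]_n.+1 := oball rbar `|` cball r0.
Local Notation radius := (radius B).
Local Notation curl := (@curl R n phi).
Local Notation dcurl := (@dcurl R n phi).
Local Notation slope := (@slope R n phi).
Local Notation conf := (conf phi).

Lemma MVT_at (f df : R -> R) (s t : R) : s < t ->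
  (forall x, s <= x -> x <= t -> is_derive (x : R) 1 f (df x)) ->
  exists2 x, s < x < t & f t - f s = df x * (t - s).
Proof.
move=> st d.
have [||x] := @MVT R f df s t st.
- by move=> x; rewrite in_itv /= => /andP[x1 x2]; apply: d; exact: ltW.
- apply: continuous_in_subspaceT => x; rewrite inE /= in_itv /= => /andP[x1 x2].
  have [dx _] := d x x1 x2.
  by apply: differentiable_continuous; exact/derivable1_diffP.
by rewrite in_itv /= => xi ->; exists x.
Qed.

Let rad (s t x : R) : 0 < s -> (t%:E <= r0)%E -> s <= x -> x <= t -> radius x.
Proof.
move=> s0 tr sx xt; apply: radius_le; first exact: lt_le_trans sx.
by apply: le_trans tr; rewrite lee_fin.
Qed.

(** The mean value theorem evaluates the derivative of [slope] strictly between [s] and [t], hence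
    in the open ball where the curvature is controlled, even when [t], [r0] and [rbar] coincide. *)
Lemma slope_alternative :
  ricci_largest_radially (oball rbar) (conformal_metric n phi) \/
    ricci_constant (oball rbar) (conformal_metric n phi) ->
  (forall s t : R, 0 < s -> s < t -> (t%:E <= r0)%E -> slope s < slope t) \/
  (forall s t : R, 0 < s -> s < t -> (t%:E <= r0)%E -> slope s = slope t).
Proof.
have key (s t : R) : 0 < s -> s < t -> (t%:E <= r0)%E -> exists2 x, s < x < t &
    slope t - slope s = - (conf x / 2) * (dcurl x - x * curl x ^+ 2) * (t - s).
  move=> s0 st tr; apply: (MVT_at st (df := fun x => - (conf x / 2) * (dcurl x - x * curl x ^+ 2))).
  by move=> x sx xt; exact: (is_derive_slope sm (rad s0 tr sx xt)).
have lt_rbar (s t x : R) : 0 < s -> (t%:E <= r0)%E -> s < x < t -> 0 < x /\ (x%:E < rbar)%E.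
  move=> s0 tr /andP[sx xt]; split; first exact: lt_trans sx.
  by apply: lt_le_trans r0_le; apply: lt_le_trans tr; rewrite lte_fin.
move=> [ric|[c ric]]; [left|right] => s t s0 st tr;
  have [x xst E] := key s t s0 st tr; have [x0 xr] := lt_rbar s t x s0 tr xst.
  rewrite -subr_gt0 E mulr_gt0 ?subr_gt0 //.
  apply: (slope_derive_gt0 sm n_gt0 ric); last exact: radius_lt.
  by apply: oball_axis => //; exact: ltW.
apply/eqP; rewrite eq_sym -subr_eq0 E.
suff -> : dcurl x - x * curl x ^+ 2 = 0 by rewrite mulr0 mul0r.
have [n1|n1] := ltnP 1 n; first exact: (constant_curl_high n_gt0 sm n1 (fun x u v h => ric x u v h)).
by apply: (constant_curl_low n_gt0 sm _ (fun x u v h => ric x u v h)) => //; apply/eqP; rewrite eqn_leq n1.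
Qed.

(* The tangent at [s] of the profile, as a function of the squared radius. *)
Lemma conf_tangent (s t k : R) : 0 < s -> s < t -> (t%:E <= r0)%E ->
  exists2 x, s < x < t & conf t - conf s - k * (t ^+ 2 - s ^+ 2) =
    2 * x * (slope x - k) * (t - s).
Proof.
move=> s0 st tr.
have [x sx xt|x xst E] := @MVT_at (conf - k *: (fun y : R => y ^+ 2)) (fun x => 2 * x * (slope x - k)) s t st.
  have dI : is_derive (x : R) 1 (fun y : R => y ^+ 2) (2 * x).
    by apply: is_derive_eq; rewrite /GRing.scale /=; ring.
  apply: is_derive_eq (is_deriveB (is_derive_conf sm (rad s0 tr sx xt)) (is_deriveZ k dI)) _.
  by rewrite /GRing.scale /=; ring.
exists x => //; rewrite -E.
rewrite -[(conf - _) t]/(conf t - k * t ^+ 2) -[(conf - _) s]/(conf s - k * s ^+ 2).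
by move: (conf _) (conf _) => a b; ring.
Qed.

Definition bracket (s t : R) : R := (conf s - conf t) ^+ 2 -
  (conf s * slope s - conf t * slope t) * (s ^+ 2 - t ^+ 2).

Lemma bracketC s t : bracket s t = bracket t s.
Proof. rewrite /bracket; move: (conf s) (conf t) (slope s) (slope t) => a b c d; ring. Qed.

(** For [a < b] the bracket is [- conf a] times the error of the tangent at [a], plus [conf b] times
    the error of the tangent at [b]. Strict convexity in the squared radius makes the first error
    positive and the second negative. *)
Lemma bracket_lt0 (s t : R) :
  (forall s t : R, 0 < s -> s < t -> (t%:E <= r0)%E -> slope s < slope t) ->
  0 < s -> (s%:E <= r0)%E -> 0 < t -> (t%:E <= r0)%E -> s != t -> bracket s t < 0.
Proof.
move=> mono.
have key (a b : R) : 0 < a -> a < b -> (b%:E <= r0)%E -> bracket a b < 0.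
  move=> a0 ab br; have b0 : 0 < b by exact: lt_trans ab.
  have [x /andP[ax xb] E] := conf_tangent (slope a) a0 ab br.
  have [y /andP[ay yb] E'] := conf_tangent (slope b) a0 ab br.
  have h1 : 0 < conf b - conf a - slope a * (b ^+ 2 - a ^+ 2).
    rewrite E !mulr_gt0 ?subr_gt0 //; first exact: lt_trans ax.
    by apply: mono => //; apply: le_trans br; rewrite lee_fin ltW.
  have h2 : conf b - conf a - slope b * (b ^+ 2 - a ^+ 2) < 0.
    have y0 : 0 < y by exact: lt_trans ay.
    rewrite E' -mulrA mulrC pmulr_llt0; last by rewrite !mulr_gt0.
    rewrite pmulr_llt0 ?subr_gt0 // subr_lt0.
    by apply: mono => //; exact: lt_trans ay.
  have A0 := conf_gt0 phi a; have B0 := conf_gt0 phi b.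
  rewrite /bracket.
  have -> : (conf a - conf b) ^+ 2 - (conf a * slope a - conf b * slope b) * (a ^+ 2 - b ^+ 2) =
    - (conf a * (conf b - conf a - slope a * (b ^+ 2 - a ^+ 2)))
    + conf b * (conf b - conf a - slope b * (b ^+ 2 - a ^+ 2)).
    by move: (conf a) (conf b) (slope a) (slope b) => *; ring.
  apply: ltr_nDl; last by rewrite pmulr_rlt0.
  by rewrite oppr_lt0 mulr_gt0.
move=> s0 sr t0 tr st; case: (ltgtP s t) st => // st _; first exact: key.
by rewrite bracketC; exact: key.
Qed.

Lemma conf_affine :
  (forall s t : R, 0 < s -> s < t -> (t%:E <= r0)%E -> slope s = slope t) ->
  forall s t : R, 0 < s -> (s%:E <= r0)%E -> 0 < t -> (t%:E <= r0)%E ->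
    slope s = slope t /\ conf s - slope s * s ^+ 2 = conf t - slope t * t ^+ 2.
Proof.
move=> cst.
have key (a b : R) : 0 < a -> a < b -> (b%:E <= r0)%E ->
    slope a = slope b /\ conf a - slope a * a ^+ 2 = conf b - slope b * b ^+ 2.
  move=> a0 ab br; have sab := cst a b a0 ab br; split=> //.
  have [x /andP[ax xb]] := conf_tangent (slope a) a0 ab br.
  rewrite -(cst a x) //; last by apply: le_trans br; rewrite lee_fin ltW.
  rewrite subrr mulr0 mul0r -sab; move: (conf a) (conf b) (slope a) => u v w; lra.
move=> s t s0 sr t0 tr; case: (ltgtP s t) => [st|ts|->//]; first exact: key.
by have [-> ->] := key _ _ t0 ts sr.
Qed.

Lemma conf_continuous (r : R) : 0 < r -> (r%:E <= r0)%E -> {for r, continuous conf}.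
Proof.
move=> rp rr; have rd : radius r by exact: radius_le.
have [d _] := is_derive_conf sm rd.
by apply: differentiable_continuous; exact/derivable1_diffP.
Qed.

Lemma slope_continuous (r : R) : 0 < r -> (r%:E <= r0)%E -> {for r, continuous slope}.
Proof.
move=> rp rr; have rd : radius r by exact: radius_le.
have [d _] := is_derive_slope sm rd.
by apply: differentiable_continuous; exact/derivable1_diffP.
Qed.

Lemma minimal_trace_radial S f p (E : 'M[R]_(n, n.+1)) :
  minimal (conformal_metric n phi) S -> S p -> p != 0 -> ((enorm p)%:E <= r0)%E ->
  interior_chart S p f -> E *m E^T = 1%:M -> E *m (gradient f p)^T = 0 ->
  conf (enorm p) * \sum_i 'D_(row i E) (fun y => 'D_(row i E) f y) p =
    2 * n%:R * slope (enorm p) * edot p (gradient f p).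
Proof.
move=> mS Sp p0 pr ic EE EN.
have rp : radius (enorm p) by apply: radius_le; rewrite ?enorm_gt0.
have Bp : B p by right.
have dc := smooth_differentiable (smooth_cfactor sm Bp).
have gr : \row_i dlog phi i p = curl (enorm p) *: p.
  by apply/rowP => i; rewrite !mxE (dlog_radial sm).
rewrite (minimal_trace mS Sp ic dc gr EE EN) /slope.
by move: (edot _ _) (conf _) (curl _) => a b c; field.
Qed.

End ProfileConvexity.

(** * Test functions on a hypersurface *)

Section Reflections.
Variables (R : realType) (n : nat).
Implicit Types (u v z N : 'rV[R]_n.+1).

(* For [z = 0] this is the identity, since [2 / 0 = 0]. *)
Definition refl z : 'M[R]_n.+1 := 1%:M - (2 / edot z z) *: (z^T *m z).

Lemma reflE u z : u *m refl z = u - (2 * edot u z / edot z z) *: z.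
Proof.
rewrite /refl mulmxBr mulmx1 -scalemxAr mulmxA.
have -> : u *m z^T = (edot u z)%:M by rewrite [LHS]mx11_scalar.
rewrite mul_scalar_mx scalerA; congr (_ - _ *: _); ring.
Qed.

Lemma tr_refl z : (refl z)^T = refl z.
Proof.
apply/matrixP => i j; rewrite !mxE eq_sym; congr (_ - _ * _).
by rewrite !big_ord1 !mxE mulrC.
Qed.

Lemma edot_reflr u v z : edot u (v *m refl z) = edot (u *m refl z) v.
Proof. by rewrite edot_trmx tr_refl. Qed.

Lemma refl_involutive u z : u *m refl z *m refl z = u.
Proof.
rewrite !reflE; have [->|z0] := eqVneq z 0; first by rewrite !scaler0 !subr0.
have zz : edot z z != 0 by rewrite edot_eq0.
rewrite edotBl edotZl -addrA -opprD -scalerDl.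
rewrite [X in _ - X *: _](_ : _ = 0) ?scale0r ?subr0 //; by field.
Qed.

Lemma refl_mul z : refl z *m refl z = 1%:M.
Proof. by apply/row_matrixP => i; rewrite row_mul !rowE mulmx1 -!rowE rowE refl_involutive. Qed.

Lemma edot_refl u v z : edot (u *m refl z) (v *m refl z) = edot u v.
Proof. by rewrite edot_reflr refl_involutive. Qed.

Definition unitv N := (enorm N)^-1 *: N.

Lemma edot_unitv N : N != 0 -> edot (unitv N) (unitv N) = 1.
Proof.
move=> N0; rewrite /unitv edotZl edotZr -enorm2.
by have := N0; rewrite -enorm_gt0 => h; field; rewrite gt_eqF.
Qed.

(** The frame consists of the rows other than row [0] of the reflection exchanging the first basis
    vector with the unit normal. The last clause is Parseval's identity with the normal direction
    removed; it evaluates all sums over the frame. *)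
Lemma exists_frame N : N != 0 -> exists E : 'M[R]_(n, n.+1),
  [/\ E *m E^T = 1%:M, E *m N^T = 0 &
      forall u v, \sum_i edot u (row i E) * edot v (row i E) =
        edot u v - edot u N * edot v N / edot N N].
Proof.
move=> N0; pose e0 : 'rV[R]_n.+1 := delta_mx 0 0.
pose nu := unitv N; pose H := refl (nu - e0).
have nn : edot nu nu = 1 by exact: edot_unitv.
have ee : edot e0 e0 = 1 by rewrite edot_delta mxE !eqxx.
have H0 : e0 *m H = nu.
  rewrite /H reflE; have [/eqP|z0] := eqVneq (nu - e0) 0.
    by rewrite subr_eq0 => /eqP ->; rewrite subrr scaler0 subr0.
  have zz : edot (nu - e0) (nu - e0) != 0 by rewrite edot_eq0.
  have zE : edot (nu - e0) (nu - e0) = - (2 * edot e0 (nu - e0)).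
    rewrite !(edotBl, edotBr) nn ee (edotC e0); ring.
  rewrite (_ : 2 * _ / _ = -1).
    by rewrite scaleN1r opprK addrC subrK.
  by rewrite {1}(_ : 2 * edot e0 (nu - e0) = - edot (nu - e0) (nu - e0)) ?mulNr ?divff // zE opprK.
have HH : H *m H^T = 1%:M by rewrite tr_refl refl_mul.
have HtH : H^T *m H = 1%:M by rewrite tr_refl refl_mul.
have rH i : edot (row i H) nu = (i == 0)%:R.
  have -> : nu = row 0 H by rewrite rowE H0.
  have := congr1 (fun M : 'M[R]_n.+1 => M i 0) HH; rewrite mxE [RHS]mxE => <-.
  by rewrite edotE; apply: eq_bigr => j _; rewrite !mxE.
pose E : 'M[R]_(n, n.+1) := \matrix_(i, j) H (lift 0 i) j.
have NE : N = enorm N *: nu.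
  by rewrite /nu /unitv scalerA divff ?scale1r // gt_eqF // enorm_gt0.
exists E; split.
- apply/matrixP => i j; have := congr1 (fun M : 'M[R]_n.+1 => M (lift 0 i) (lift 0 j)) HH.
  rewrite !mxE (inj_eq (lift_inj (h := 0))) => <-.
  by apply: eq_bigr => k _; rewrite !mxE.
- apply/matrixP => i j; rewrite (ord1 j) [RHS]mxE NE.
  transitivity (enorm N * edot (row (lift 0 i) H) nu).
    by rewrite -edotZr edotE mxE; apply: eq_bigr => k _; rewrite !mxE.
  by rewrite rH mulr0.
- move=> u v.
  have rE i : row i E = row (lift 0 i) H by apply/rowP => j; rewrite !mxE.
  have cH w i : edot w (row i H) = (w *m H^T) 0 i.
    by rewrite edotE mxE; apply: eq_bigr => j _; rewrite !mxE.
  have full : \sum_i edot u (row i H) * edot v (row i H) = edot u v.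
    under eq_bigr do rewrite !cH.
    by rewrite -edotE edot_trmx trmxK -mulmxA HtH mulmx1.
  rewrite -full [in RHS]big_ord_recl.
  under eq_bigr do rewrite rE.
  have -> : row 0 H = nu by rewrite rowE H0.
  have e1 : edot u N * edot v N / edot N N = edot u nu * edot v nu.
    have k0 : enorm N != 0 by rewrite gt_eqF // enorm_gt0.
    move: (enorm N) k0 NE => k k0 NE; clearbody nu; rewrite NE !edotZr !edotZl nn.
    by field.
  by rewrite e1 addrAC subrr add0r.
Qed.

End Reflections.

Section TestFunctions.
Variables (R : realType) (n : nat) (psi psi1 psi2 : R -> R).
Hypothesis psi_jet : forall r, jet2 (fun t => psi (r + t)) (psi r) (psi1 r) (psi2 r / 2).
Implicit Types (c p v N x : 'rV[R]_n.+1).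

Definition test c (eps : R) x := edot c x + eps * psi (edot x x).
Definition dtest c (eps : R) x := c + (2 * eps * psi1 (edot x x)) *: x.

Lemma jet2_edot_curve c p v N s (k : R) : s @ (0 : R) --> k ->
  jet2 (fun t => edot c (curve p v N s t)) (edot c p) (edot c v) (k * edot c N).
Proof.
move=> sk; exists (fun t => s t * edot c N); first by apply: cvgM => //; exact: cvg_cst.
near=> t; rewrite /curve !edotDr !edotZr; move: (edot _ _) (edot _ _) (edot _ _) (s t) => *; ring.
Unshelve. all: by end_near. Qed.

Lemma jet2_sqnorm_curve p v N s (k : R) : s @ (0 : R) --> k ->
  jet2 (fun t => edot (curve p v N s t) (curve p v N s t)) (edot p p) (2 * edot p v)
    (edot v v + 2 * k * edot p N).
Proof.
move=> sk.
exists (fun t => edot v v + 2 * s t * edot p N + 2 * s t * edot v N * t + s t * s t * edot N N * (t * t)).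
  have cI := @cvg_idR R.
  move: (edot v v) (edot p N) (edot v N) (edot N N) => a b c d.
  apply: (@cvg_eqr _ _ _ _ (a + 2 * k * b + 2 * k * c * 0 + k * k * d * (0 * 0))); last ring.
  have c2 : (fun t : R => 2 * s t) @ (0 : R) --> 2 * k by apply: cvgM; [exact: cvg_cst | exact: sk].
  apply: cvgD; first apply: cvgD; first apply: cvgD; first exact: cvg_cst.
  - by apply: cvgM; [exact: c2 | exact: cvg_cst].
  - by apply: cvgM; [apply: cvgM; [exact: c2 | exact: cvg_cst] | exact: cI].
  - apply: cvgM; last by apply: cvgM; exact: cI.
    by apply: cvgM; [apply: cvgM; exact: sk | exact: cvg_cst].
near=> t; rewrite /curve !(edotDr, edotDl, edotZr, edotZl) (edotC v p) (edotC N p) (edotC N v).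
move: (edot p p) (edot p v) (edot v v) (edot p N) (edot v N) (edot N N) (s t) => *; ring.
Unshelve. all: by end_near. Qed.

Lemma jet2_test c eps p v N s (k : R) : s @ (0 : R) --> k ->
  jet2 (fun t => test c eps (curve p v N s t)) (test c eps p) (edot (dtest c eps p) v)
    (k * edot (dtest c eps p) N +
     eps * (psi1 (edot p p) * edot v v + 2 * psi2 (edot p p) * edot p v ^+ 2)).
Proof.
move=> sk.
have j1 := @jet2_edot_curve c p v N s k sk.
have j2 := jet2_comp (psi_jet (edot p p)) (@jet2_sqnorm_curve p v N s k sk).
apply: jet2_eq (jet2D j1 (jet2Z eps j2)) _ _ _ => //; rewrite /dtest !edotDl !edotZl.
  by move: (edot _ _) (psi1 _) (edot _ _) => *; ring.
move: (psi1 _) (psi2 _) (edot c N) (edot p N) (edot v v) (edot p v) => *; by field.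
Qed.

(** Lagrange multipliers: the component of [w] orthogonal to [N] is itself a tangent vector, so [w]
    annihilates it and it vanishes. *)
Lemma tangent_multiplier (N w : 'rV[R]_n.+1) : N != 0 ->
  (forall v, edot N v = 0 -> edot w v = 0) -> w = (edot w N / edot N N) *: N.
Proof.
move=> N0 h; apply/eqP; rewrite -subr_eq0 -edot_eq0.
have NN : edot N N != 0 by rewrite edot_eq0.
set k := edot w N / edot N N.
have o : edot N (w - k *: N) = 0.
  by rewrite edotBr edotZr /k (edotC w N) divfK ?subrr.
by rewrite [X in edot X _]/(_ - _) edotBl edotZl (h _ o) o mulr0 subr0.
Qed.

Section AtPoint.
Variables (phi : R -> R) (rbar r0 : \bar R).
Hypothesis n_gt0 : (0 < n)%N.
Hypothesis sm : smooth_metric_on (oball rbar `|` cball r0) (conformal_metric n phi).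
Local Notation slope := (@slope R n phi).
Local Notation conf := (conf phi).
Local Notation g := (conformal_metric n phi).

Lemma boundary_inward S p f h c eps : S p -> boundary_chart S p f h ->
  edot (gradient f p) p = 0 -> 0 < edot (gradient h p) p ->
  test c eps p = 0 -> (\forall y \near p, S y -> 0 <= test c eps y) ->
  edot (dtest c eps p) p <= 0.
Proof.
move=> Sp bc fp hp q0 qge.
have vN : edot (gradient f p) (- p) = 0 by rewrite edotNr fp oppr0.
have vH : edot (gradient h p) (- p) < 0 by rewrite edotNr oppr_lt0.
have [k [s sk sS]] := boundary_curve Sp bc vN vH.
have jt := @jet2_test c eps p (- p) (gradient f p) s k sk.
rewrite q0 in jt.
have : 0 <= edot (dtest c eps p) (- p).
  apply: jet2_ge0r jt _.
  have cc := @curve_cvg R n p (- p) (gradient f p) s _ sk.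
  have := cc _ qge; rewrite /nbhs /= => H.
  near=> t => t0.
  have hS : 0 < t -> S (curve p (- p) (gradient f p) s t) by near: t.
  have hq : S (curve p (- p) (gradient f p) s t) -> 0 <= test c eps (curve p (- p) (gradient f p) s t) by near: t.
  exact: hq (hS t0).
by rewrite edotNr oppr_ge0.
Unshelve. all: by end_near. Qed.

(* With [A = conf] and [D = slope], this is
   [n (psi' A + D (psi - 2 rho psi')) + 2 A psi'' (rho - tau)], [tau] being the squared normal
   component of [x], multiplied by [|w|^2] for a normal vector [w]. *)
Definition excess (x w : 'rV[R]_n.+1) : R :=
  let rho := edot x x in
  n%:R * (psi1 rho * conf (enorm x) + slope (enorm x) * (psi rho - 2 * rho * psi1 rho)) * edot w w
  + 2 * conf (enorm x) * psi2 rho * (rho * edot w w - edot x w ^+ 2).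

(** At the minimum [w] is a multiple of the normal. Summed over a frame, the second variation
    contains the trace of the Hessian, which minimality expresses through [edot p w]; and
    [test c eps p = 0] makes [edot p w] proportional to [eps]. The linear part of the test function
    thus drops out. *)
Lemma interior_min S p f c eps :
  minimal g S -> S p -> p != 0 -> ((enorm p)%:E <= r0)%E -> interior_chart S p f ->
  test c eps p = 0 -> (\forall y \near p, S y -> 0 <= test c eps y) ->
  0 <= eps * excess p (dtest c eps p).
Proof.
move=> mS Sp p0 pr ic q0 qge.
have [sf N0 nS] := ic.
set N := gradient f p in N0 *; set w := dtest c eps p.
have NN : 0 < edot N N by rewrite edot_gt0.
pose D2 v := 'D_v (fun y => 'D_v f y) p.
have key v : edot N v = 0 -> edot w v = 0 /\
    0 <= (- D2 v / (2 * edot N N)) * edot w N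
      + eps * (psi1 (edot p p) * edot v v + 2 * psi2 (edot p p) * edot p v ^+ 2).
  move=> vN; have [s sk sS] := interior_curve Sp ic vN.
  have jt := @jet2_test c eps p v N s _ sk.
  rewrite q0 in jt; apply: jet2_ge0 jt _.
  have cc := @curve_cvg R n p v N s _ sk.
  have := cc _ qge; rewrite /nbhs /= => H.
  near=> t.
  have hS : S (curve p v N s t) by near: t.
  have hq : S (curve p v N s t) -> 0 <= test c eps (curve p v N s t) by near: t.
  exact: hq.
have wN := tangent_multiplier N0 (fun v h => (key v h).1).
set lam := edot w N / edot N N in wN.
have [E [EE EN Esum]] := exists_frame N0.
have rowN i := frame_row_orth i EN.
have rowE i := frame_row_norm i EE.
have tr := minimal_trace_radial sm mS Sp p0 pr ic EE EN.
rewrite -/N in tr.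
have sum0 : 0 <= \sum_i ((- D2 (row i E) / (2 * edot N N)) * edot w N
      + eps * (psi1 (edot p p) + 2 * psi2 (edot p p) * edot p (row i E) ^+ 2)).
  apply: sumr_ge0 => i _; have [_] := key _ (rowN i).
  by rewrite rowE mulr1.
have sumE : \sum_i ((- D2 (row i E) / (2 * edot N N)) * edot w N
      + eps * (psi1 (edot p p) + 2 * psi2 (edot p p) * edot p (row i E) ^+ 2)) =
   - (lam / 2) * \sum_i D2 (row i E) +
   eps * (n%:R * psi1 (edot p p) + 2 * psi2 (edot p p) * (edot p p - edot p N ^+ 2 / edot N N)).
  have -> : edot p p - edot p N ^+ 2 / edot N N = \sum_i edot p (row i E) ^+ 2.
    by rewrite expr2 -Esum; apply: eq_bigr => i _; rewrite expr2.
  rewrite big_split /=; congr (_ + _).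
    rewrite mulr_sumr; apply: eq_bigr => i _; rewrite /lam; move: (D2 _) (edot w N) (edot N N) NN => a b d d0.
    by field; rewrite gt_eqF.
  by rewrite -mulr_sumr big_split /= sumr_const card_ord -mulr_sumr -[_ *+ n]mulr_natl.
rewrite sumE in sum0.
have lamp : lam * edot p N = edot p w by rewrite wN edotZr.
have wp : edot p w = eps * (2 * edot p p * psi1 (edot p p) - psi (edot p p)).
  have cp : edot c p = - (eps * psi (edot p p)).
    by move: q0; rewrite /test => /eqP; rewrite addr_eq0 => /eqP.
  by rewrite /w /dtest edotDr edotZr (edotC p c) cp; move: (edot p p) (psi (edot p p)) (psi1 (edot p p)) => *; ring.
have ww : edot w w = lam ^+ 2 * edot N N by rewrite wN edotZl edotZr; ring.
have A0 := conf_gt0 phi (enorm p).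
(* The factor [conf (enorm p)] allows the use of [tr], and [edot w w] clears the division by
   [edot N N]. *)
have : 0 <= conf (enorm p) * (- (lam / 2) * \sum_i D2 (row i E) +
   eps * (n%:R * psi1 (edot p p) + 2 * psi2 (edot p p) * (edot p p - edot p N ^+ 2 / edot N N))) * edot w w.
  by rewrite !mulr_ge0 // ?edot_ge0 // ltW.
suff -> : eps * excess p w = conf (enorm p) * (- (lam / 2) * \sum_i D2 (row i E) +
   eps * (n%:R * psi1 (edot p p) + 2 * psi2 (edot p p) * (edot p p - edot p N ^+ 2 / edot N N))) * edot w w by [].
have hT : conf (enorm p) * (- (lam / 2) * \sum_i D2 (row i E)) = - (n%:R * slope (enorm p) * edot p w).
  transitivity (- (lam / 2) * (conf (enorm p) * \sum_i D2 (row i E))); first by ring.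
  by rewrite tr -lamp; move: (slope _) (edot p N) => *; field.
rewrite [X in _ = X * _]mulrDr hT.
rewrite /excess.
have pw2 : edot p w ^+ 2 = lam ^+ 2 * edot p N ^+ 2 by rewrite -lamp; ring.
have -> : edot p p * edot w w - edot p w ^+ 2 = edot w w * (edot p p - edot p N ^+ 2 / edot N N).
  rewrite pw2 ww; move: (edot p p) (edot p N) (edot N N) NN => a b d d0.
  by field; rewrite gt_eqF.
rewrite wp.
move: (edot p p) (edot w w) (edot p p - _ / _) (conf _) (slope _) (psi _) (psi1 _) (psi2 _).
by move=> *; ring.
Unshelve. all: by end_near. Qed.

End AtPoint.
End TestFunctions.

(** * Bounds on compact sets and weights *)

Section CompactBounds.
Variables (R : realType) (T : topologicalType).

Lemma compact_argmin (K : set T) (f : T -> R) : K !=set0 -> compact K ->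
  (forall x, K x -> {for x, continuous f}) -> exists2 x, K x & forall y, K y -> f x <= f y.
Proof.
move=> K0 cK cf.
have [|x xK fx] := @compact_EVT_min T R f K K0 cK.
  by apply: continuous_in_subspaceT => x /set_mem; exact: cf.
exists x; first exact: set_mem.
by move=> y /mem_set; exact: fx.
Qed.

Lemma compact_bounded (K : set T) (f : T -> R) : K !=set0 -> compact K ->
  (forall x, K x -> {for x, continuous f}) -> exists2 M, 0 < M & forall x, K x -> `|f x| <= M.
Proof.
move=> K0 cK cf.
have [|x xK fx] := @compact_argmin K (fun x => - `|f x|) K0 cK.
  move=> x Kx; apply: cvgN; apply: cvg_norm; exact: cf.
exists (`|f x| + 1); first by rewrite ltr_wpDl.
move=> y Ky; have := fx y Ky; rewrite lerN2 => h.
by apply: le_trans h _; rewrite lerDl.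
Qed.

Lemma compact_pos (K : set T) (f : T -> R) : K !=set0 -> compact K ->
  (forall x, K x -> {for x, continuous f}) -> (forall x, K x -> 0 < f x) ->
  exists2 m, 0 < m & forall x, K x -> m <= f x.
Proof.
move=> K0 cK cf f0; have [x Kx fx] := compact_argmin K0 cK cf.
by exists (f x) => //; exact: f0.
Qed.

End CompactBounds.

Section Weights.
Variable R : realType.

Lemma small_factor (K d : R) : 0 < d -> exists e, [/\ 0 < e, e <= 1 & e * K <= d].
Proof.
move=> d0; exists (Num.min 1 (d / (`|K| + 1))).
have K1 : 0 < `|K| + 1 by rewrite ltr_wpDl.
have e0 : 0 < Num.min 1 (d / (`|K| + 1)) by rewrite lt_min ltr01 divr_gt0.
split=> //; first by rewrite ge_min lexx.
apply: le_trans (_ : Num.min 1 (d / (`|K| + 1)) * (`|K| + 1) <= _).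
  by rewrite ler_pM2l // (le_trans (ler_norm _)) // lerDl.
by rewrite -ler_pdivlMr // ge_min lexx orbT.
Qed.

Definition expw (L r : R) : R := expR (- (L * r)).

Lemma expw_gt0 L r : 0 < expw L r.
Proof. exact: expR_gt0. Qed.

Lemma expw_le1 L r : 0 <= L -> 0 <= r -> expw L r <= 1.
Proof. by move=> L0 r0; rewrite /expw -expR0 ler_expR oppr_le0 mulr_ge0. Qed.

Lemma is_derive_expw L (a t : R) : is_derive (t : R) 1 (fun t => expw L (a + t)) (- L * expw L (a + t)).
Proof.
have dl : is_derive (t : R) 1 (fun t : R => - (L * (a + t))) (- L).
  by apply: is_derive_eq; rewrite /GRing.scale /=; ring.
apply: is_derive_eq (@is_derive1_comp R expR (fun t : R => - (L * (a + t))) t _ _ (is_derive_expR _) dl) _.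
by rewrite mulrC.
Qed.

Lemma expw_jet L r : jet2 (fun t => expw L (r + t)) (expw L r) (- L * expw L r) (L ^+ 2 * expw L r / 2).
Proof.
have h1 : \forall t \near (0 : R), is_derive (t : R) 1 (fun t => expw L (r + t)) (- L * expw L (r + t)).
  by near=> t; exact: is_derive_expw.
have h2 : is_derive (0 : R) 1 (fun t => - L * expw L (r + t)) (L ^+ 2 * expw L (r + 0)).
  apply: is_derive_eq (is_deriveZ (- L) (is_derive_expw L r 0)) _.
  by rewrite /GRing.scale /=; ring.
have := peano2 h1 h2; rewrite addr0 => J; exact: J.
Unshelve. all: by end_near. Qed.

Definition affw (b r : R) : R := r + b.

Lemma affw_jet b r : jet2 (fun t => affw b (r + t)) (affw b r) 1 (0 / 2).
Proof.
have := jet2D (jet2_cst (r + b)) (jet2_id R); rewrite addr0 add0r mul0r => J.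
rewrite addr0 in J; apply: jet2_near J; near=> t.
by rewrite /affw /cst addrAC.
Unshelve. all: by end_near. Qed.

Lemma jet_continuous (psi : R -> R) r a b : jet2 (fun t => psi (r + t)) (psi r) a b ->
  {for r, continuous psi}.
Proof.
move=> J; have h := jet2_cvg J.
have sh : (fun s => s - r) @ r --> (0 : R).
  apply: (@cvg_eqr _ _ _ _ (r - r)); last exact: subrr.
  by apply: cvgB; [exact: cvg_id | exact: cvg_cst].
have := @cvg_comp _ _ _ (fun s => s - r) _ _ _ _ sh h.
have -> : (fun t => psi (r + t)) \o (fun s => s - r) = psi by apply/funext => s /=; rewrite addrC subrK.
exact.
Qed.

End Weights.

Section TestContinuity.
Variables (R : realType) (n : nat).

Lemma edot_continuous (c x : 'rV[R]_n.+1) : {for x, continuous (edot c)}.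
Proof.
have h1 : (fun _ : 'rV[R]_n.+1 => c) @ x --> c
  by exact: (@cvg_cst _ c _ (nbhs x) (nbhs_filter x)).
have h2 : (fun y : 'rV[R]_n.+1 => y) @ x --> x by exact: cvg_id.
exact: (@edot_cvg R _ n (nbhs x) (nbhs_filter x) _ _ _ _ h1 h2).
Qed.

Lemma sqnorm_continuous (x : 'rV[R]_n.+1) : {for x, continuous (fun y : 'rV[R]_n.+1 => edot y y)}.
Proof.
have h2 : (fun y : 'rV[R]_n.+1 => y) @ x --> x by exact: cvg_id.
exact: (@edot_cvg R _ n (nbhs x) (nbhs_filter x) _ _ _ _ h2 h2).
Qed.

Lemma enorm_continuous (x : 'rV[R]_n.+1) : {for x, continuous (@enorm R n.+1)}.
Proof.
have h2 : (fun y : 'rV[R]_n.+1 => y) @ x --> x by exact: cvg_id.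
exact: (@enorm_cvg R _ n (nbhs x) (nbhs_filter x) _ _ h2).
Qed.

Lemma test_continuous (psi : R -> R) c eps (x : 'rV[R]_n.+1) :
  {for edot x x, continuous psi} -> {for x, continuous (test psi c eps)}.
Proof.
move=> cp.
have h2 : {for x, continuous (fun y : 'rV[R]_n.+1 => psi (edot y y))}.
  exact: (@cvg_comp _ _ _ (fun y : 'rV[R]_n.+1 => edot y y) psi _ _ _ (@sqnorm_continuous x) cp).
have h3 : {for x, continuous (fun y : 'rV[R]_n.+1 => eps * psi (edot y y))}.
  by apply: (@continuousM _ _ (cst eps)) => //; exact: cst_continuous.
exact: (@continuousD _ _ _ (edot c) _ x (@edot_continuous c x) h3).
Qed.

End TestContinuity.

(** * Half balls *)

Section HalfBalls.
Variables (R : realType) (n : nat) (phi : R -> R) (rbar r0 : \bar R).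
Hypothesis n_gt0 : (0 < n)%N.
Hypothesis sm : smooth_metric_on (oball rbar `|` cball r0) (conformal_metric n phi).
Local Notation slope := (@slope R n phi).
Local Notation conf := (conf phi).
Local Notation g := (conformal_metric n phi).
Implicit Types (S : set 'rV[R]_n.+1) (c x : 'rV[R]_n.+1).

Lemma conf_norm_continuous x : x != 0 -> ((enorm x)%:E <= r0)%E ->
  {for x, continuous (fun y : 'rV[R]_n.+1 => conf (enorm y))}.
Proof.
move=> x0 xr; have xp : 0 < enorm x by rewrite enorm_gt0.
exact: (@cvg_comp _ _ _ (@enorm R n.+1) conf _ _ _ (@enorm_continuous R n x) (conf_continuous sm xp xr)).
Qed.

Lemma slope_norm_continuous x : x != 0 -> ((enorm x)%:E <= r0)%E ->
  {for x, continuous (fun y : 'rV[R]_n.+1 => slope (enorm y))}.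
Proof.
move=> x0 xr; have xp : 0 < enorm x by rewrite enorm_gt0.
exact: (@cvg_comp _ _ _ (@enorm R n.+1) slope _ _ _ (@enorm_continuous R n x) (slope_continuous sm xp xr)).
Qed.

Lemma exists_orthogonal c : c != 0 -> exists2 b : 'rV[R]_n.+1, b != 0 & edot b c = 0.
Proof.
move=> c0; have [E [EE EN _]] := exists_frame c0.
pose i := Ordinal n_gt0; exists (row i E); last by rewrite edotC (frame_row_orth i EN).
by rewrite -edot_eq0 (frame_row_norm i EE) oner_eq0.
Qed.

(** Apart from the common factor [expw L rho], the term with the second derivative grows like
    [L ^+ 2] and the others at most like [L]. The bound on [edot x w] keeps [w] away from the radial
    direction, so at least half of the quadratic term survives. *)
Lemma excess_expw_gt0 (L rho0 R2 A0 A1 D1 : R) x (w : 'rV[R]_n.+1) :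
  1 <= L -> 0 < A0 -> 0 < rho0 -> 0 <= D1 -> rho0 <= edot x x -> edot x x <= R2 ->
  A0 <= conf (enorm x) -> conf (enorm x) <= A1 -> `|slope (enorm x)| <= D1 ->
  n%:R * (A1 + D1 * (1 + 2 * R2)) < A0 * rho0 * L ->
  w != 0 -> edot x w ^+ 2 <= edot x x * edot w w / 2 ->
  0 < excess (expw L) (fun r => - L * expw L r) (fun r => L ^+ 2 * expw L r) phi x w.
Proof.
move=> L1 A00 rho00 D10 rho0x xR2 A0c cA1 sD1 big w0 xw.
have ww : 0 < edot w w by rewrite edot_gt0.
rewrite /excess; set rho := edot x x in rho0x xR2 xw *.
have e0 := expw_gt0 L rho.
set A := conf _ in A0c cA1 *; set D := slope _ in sD1 *; set e := expw L rho in e0 *.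
have -> : n%:R * (- L * e * A + D * (e - 2 * rho * (- L * e))) * edot w w
   + 2 * A * (L ^+ 2 * e) * (rho * edot w w - edot x w ^+ 2) =
  e * (n%:R * (- L * A + D * (1 + 2 * rho * L)) * edot w w
   + 2 * A * L ^+ 2 * (rho * edot w w - edot x w ^+ 2)) by ring.
rewrite pmulr_rgt0 //.
have L0 : 0 < L by exact: lt_le_trans L1.
have Ap : 0 < A by exact: lt_le_trans A0c.
have h1 : A * L ^+ 2 * rho * edot w w <= 2 * A * L ^+ 2 * (rho * edot w w - edot x w ^+ 2).
  have -> : A * L ^+ 2 * rho * edot w w = 2 * A * L ^+ 2 * (rho * edot w w / 2) by field.
  rewrite ler_pM2l; last by rewrite !mulr_gt0 // exprn_gt0.
  by move: xw; lra.
apply: lt_le_trans (_ : (n%:R * (- L * A + D * (1 + 2 * rho * L)) + A * L ^+ 2 * rho) * edot w w <= _); last first.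
  by rewrite mulrDl lerD2l.
rewrite pmulr_lgt0 //.
have h2 : A0 * rho0 * L * L <= A * L ^+ 2 * rho.
  have -> : A * L ^+ 2 * rho = A * rho * L * L by ring.
  rewrite !ler_pM2r //; apply: ler_pM => //; exact: ltW.
have rhop : 0 < rho by exact: lt_le_trans rho0x.
have h3 : - (D1 * (1 + 2 * R2)) * L <= D * (1 + 2 * rho * L).
  have p1 : 0 <= 1 + 2 * rho * L by rewrite addr_ge0 // !mulr_ge0 // ltW.
  apply: le_trans (_ : - D1 * (1 + 2 * rho * L) <= _); last first.
    by apply: ler_wpM2r => //; rewrite lerNl (le_trans (ler_norm _)) // normrN.
  rewrite !mulNr lerN2 -[D1 * _ * L]mulrA; apply: ler_wpM2l => //.
  rewrite [leRHS]mulrDl mul1r; apply: lerD => //.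
  by rewrite ler_pM2r // ler_pM2l.
have nn : 0 <= n%:R :> R by exact: ler0n.
have h4 : - (n%:R * (A1 + D1 * (1 + 2 * R2))) * L <= n%:R * (- L * A + D * (1 + 2 * rho * L)).
  rewrite mulNr -[n%:R * _ * L]mulrA -mulrN; apply: ler_wpM2l => //.
  rewrite mulrDl opprD; apply: lerD; last by rewrite -mulNr.
  by rewrite mulNr lerN2 (mulrC A1) ler_pM2l.
have h5 : n%:R * (A1 + D1 * (1 + 2 * R2)) * L < A0 * rho0 * L * L by rewrite ltr_pM2r.
move: h2 h4 h5; rewrite mulNr; lra.
Qed.

Lemma large_exponent S : S !=set0 -> compact S -> (forall x, S x -> x != 0) ->
  (forall x, S x -> ((enorm x)%:E <= r0)%E) ->
  exists2 L, 1 <= L & forall x w, S x -> w != 0 -> edot x w ^+ 2 <= edot x x * edot w w / 2 ->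
    0 < excess (expw L) (fun r => - L * expw L r) (fun r => L ^+ 2 * expw L r) phi x w.
Proof.
move=> S0 cS ne0 nrm.
have [rho0 rho00 rho0P] := compact_pos S0 cS (fun x _ => @sqnorm_continuous R n x)
  (fun x Sx => etrans (edot_gt0 x) (ne0 x Sx)).
have [R2 R20 R2P] := compact_bounded S0 cS (fun x _ => @sqnorm_continuous R n x).
have [A0 A00 A0P] := compact_pos S0 cS (fun x Sx => conf_norm_continuous (ne0 x Sx) (nrm x Sx))
  (fun x _ => conf_gt0 phi _).
have [A1 A10 A1P] := compact_bounded S0 cS (fun x Sx => conf_norm_continuous (ne0 x Sx) (nrm x Sx)).
have [D1 D10 D1P] := compact_bounded S0 cS (fun x Sx => slope_norm_continuous (ne0 x Sx) (nrm x Sx)).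
pose L := 1 + n%:R * (A1 + D1 * (1 + 2 * R2)) / (A0 * rho0).
have q0 : 0 <= n%:R * (A1 + D1 * (1 + 2 * R2)).
  by rewrite mulr_ge0 ?ler0n // addr_ge0 ?mulr_ge0 ?addr_ge0 ?mulr_ge0 // ltW.
have ar : 0 < A0 * rho0 by exact: mulr_gt0.
have L1 : 1 <= L by rewrite /L lerDl divr_ge0 // ltW.
have bigL : n%:R * (A1 + D1 * (1 + 2 * R2)) < A0 * rho0 * L.
  rewrite /L; move: (n%:R * _) (A0 * rho0) ar => N q q1.
  have -> : q * (1 + N / q) = q + N by field; rewrite gt_eqF.
  by rewrite ltrDr.
exists L => // x w Sx w0; apply: (excess_expw_gt0 L1 A00 rho00 (ltW D10) (rho0P x Sx) _ (A0P x Sx)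
  _ (D1P x Sx) bigL w0).
  by apply: le_trans (R2P x Sx); exact: ler_norm.
by apply: le_trans (A1P x Sx); exact: ler_norm.
Qed.

(** Were the hypersurface in the open half space opposite to [c], a hyperplane could be rotated
    about the subspace orthogonal to [b] and [e] until it touches. Contact with a plain hyperplane
    is no contradiction; the weight [- eps * expw L] bends it so that contact is impossible, at
    interior points because the excess is positive, at boundary points because the radial derivative
    has the wrong sign. *)
Lemma meets_closed_half_ball S c : compact_free_boundary_minimal g r0 S -> c != 0 ->
  exists2 x, S x & 0 <= edot x c.
Proof.
move=> fbm c0; apply: contrapT => noS.
have neg x : S x -> edot x c < 0.
  by move=> Sx; rewrite ltNge; apply/negP => h; apply: noS; exists x.
have [[S0 _] cS [Sr _] mS _] := fbm.
have [b b0 bc] := exists_orthogonal c0.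
pose e : 'rV[R]_n.+1 := - c.
have be : edot b e = 0 by rewrite /e edotNr bc oppr0.
have epos x : S x -> 0 < edot e x by move=> Sx; rewrite /e edotNl oppr_gt0 edotC neg.
have ne0 x : S x -> x != 0.
  by move=> Sx; apply: contraTneq (epos x Sx) => ->; rewrite edot0r ltxx.
have nrm x : S x -> ((enorm x)%:E <= r0)%E by move=> Sx; exact: Sr.
have [rho0 rho00 rho0P] := compact_pos S0 cS (fun x _ => @sqnorm_continuous R n x)
  (fun x Sx => etrans (edot_gt0 x) (ne0 x Sx)).
have [R2 R20 R2P] := compact_bounded S0 cS (fun x _ => @sqnorm_continuous R n x).
have [L L1 LP] := large_exponent S0 cS ne0 nrm.
have [M M0 MP] := compact_bounded S0 cS (fun x _ => @edot_continuous R n b x).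
have bb : 0 < edot b b by rewrite edot_gt0.
have L0 : 0 < L by exact: lt_le_trans L1.
(* [K1] makes the weight perturb [edot w b] by at most half of [edot b b], hence
   [edot w w >= edot b b / 4]. [K2] then makes [edot p w ^+ 2] at most half of
   [edot p p * edot w w]. *)
pose K1 := 4 * L * M; pose K2 := 8 * (1 + 2 * R2 * L) ^+ 2.
have K10 : 0 <= K1 by rewrite /K1 !mulr_ge0 // ltW.
have K20 : 0 <= K2 by rewrite /K2 mulr_ge0 // sqr_ge0.
have [eps [eps0 eps1 epsK]] := @small_factor R (K1 + K2) (Num.min (edot b b) (rho0 * edot b b))
  ltac:(by rewrite lt_min bb mulr_gt0).
have eK1 : eps * K1 <= edot b b.
  apply: le_trans (_ : eps * (K1 + K2) <= _); first by rewrite ler_pM2l // lerDl.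
  by apply: le_trans epsK _; rewrite ge_min lexx.
have eK2 : eps * K2 <= rho0 * edot b b.
  apply: le_trans (_ : eps * (K1 + K2) <= _); first by rewrite ler_pM2l // lerDr.
  by apply: le_trans epsK _; rewrite ge_min lexx orbT.
pose f x := test (expw L) b (- eps) x / edot e x.
have cf x : S x -> {for x, continuous f}.
  move=> Sx; apply: continuousM.
    exact: (@test_continuous R n (expw L) b (- eps) x (jet_continuous (expw_jet L _))).
  apply: continuousV; last exact: edot_continuous.
  by rewrite gt_eqF // epos.
have [p Sp pmin] := compact_argmin S0 cS cf.
(* [s] is the slope at first contact: the test function with vector [b - s *: e] is nonnegative on
   the hypersurface and vanishes at [p]. *)
pose s := f p; pose c' := b - s *: e.
have tE x : test (expw L) c' (- eps) x = test (expw L) b (- eps) x - s * edot e x.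
  by rewrite /test /c' edotBl edotZl; ring.
have t0 : test (expw L) c' (- eps) p = 0.
  by rewrite tE /s /f divfK ?subrr // gt_eqF // epos.
have tge x : S x -> 0 <= test (expw L) c' (- eps) x.
  by move=> Sx; rewrite tE subr_ge0 -ler_pdivlMr ?epos //; exact: pmin.
have tnear : \forall y \near p, S y -> 0 <= test (expw L) c' (- eps) y.
  by near=> y; exact: tge.
pose psi1 r := - L * expw L r; pose psi2 r := L ^+ 2 * expw L r.
pose w := dtest psi1 c' (- eps) p.
have rp0 := rho0P p Sp.
have rpR : edot p p <= R2 by apply: le_trans (R2P p Sp); exact: ler_norm.
have rpp : 0 <= edot p p by exact: edot_ge0.
have e0 := expw_gt0 L (edot p p).
have e1 : expw L (edot p p) <= 1 by apply: expw_le1 => //; exact: ltW.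
(* The vanishing of the test function fixes [edot c' p], so [edot w p] is of order [eps] while [w]
   stays bounded below: [w] is nearly orthogonal to [p]. *)
have wp : edot w p = eps * expw L (edot p p) * (1 + 2 * edot p p * L).
  have cp : edot c' p = eps * expw L (edot p p).
    by move: t0; rewrite /test mulNr => /eqP; rewrite subr_eq0 => /eqP.
  rewrite /w /dtest edotDl edotZl cp /psi1.
  move: (edot p p) (expw L (edot p p)) => u v; ring.
have wp0 : 0 < edot w p.
  by rewrite wp mulr_gt0 ?mulr_gt0 // ltr_wpDr // !mulr_ge0 // ltW.
have [[h ic _]|[h [k [bc' hp kp _]]]] := fbm_points fbm Sp; last first.
  have := boundary_inward (expw_jet L) Sp bc' hp kp t0 tnear.
  by rewrite -/psi1 -/w leNgt wp0.
have := interior_min (expw_jet L) sm mS Sp (ne0 p Sp) (nrm p Sp) ic t0 tnear.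
rewrite -/psi1 -/psi2 -/w mulNr oppr_ge0 pmulr_rle0 // leNgt => /negP; apply.
have wb : edot b b / 2 <= edot w b.
  have -> : edot w b = edot b b + 2 * eps * L * expw L (edot p p) * edot p b.
    have cb : edot c' b = edot b b by rewrite /c' -scaleNr edotDl edotZl (edotC e) be mulr0 addr0.
    rewrite /w /dtest edotDl edotZl cb /psi1.
    move: (edot b b) (edot p b) (edot p p) (expw L (edot p p)) => *; ring.
  have Mp := MP p Sp; rewrite ler_norml (edotC b p) in Mp.
  have {Mp} Mp : - M <= edot p b by case/andP: Mp.
  have : - (2 * eps * L * M) <= 2 * eps * L * expw L (edot p p) * edot p b.
    apply: le_trans (_ : - (2 * eps * L * expw L (edot p p) * M) <= _).
      rewrite lerN2 ler_pM2r // -[leRHS]mulr1 ler_pM2l // !mulr_gt0 //.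
    rewrite -mulrN ler_pM2l // !mulr_gt0 //.
  by move: eK1; rewrite /K1; lra.
have w0 : w != 0.
  by apply: contraTneq wp0 => ->; rewrite edot0l ltxx.
have ww : edot b b / 4 <= edot w w.
  have := edot_cauchy w b => cs.
  rewrite -(ler_pM2r bb); apply: le_trans cs.
  have -> : edot b b / 4 * edot b b = (edot b b / 2) ^+ 2 by field.
  by rewrite lerXn2r // ?nnegrE ?(le_trans _ wb) // divr_ge0 // ltW.
apply: (LP p w Sp w0).
rewrite edotC wp.
have b1 : (eps * expw L (edot p p) * (1 + 2 * edot p p * L)) ^+ 2 <= (eps * (1 + 2 * R2 * L)) ^+ 2.
  have q1 : 0 <= 1 + 2 * edot p p * L by rewrite addr_ge0 // !mulr_ge0 // ltW.
  rewrite lerXn2r // ?nnegrE ?mulr_ge0 ?addr_ge0 ?mulr_ge0 //; try exact: ltW.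
  apply: ler_pM => //; rewrite ?mulr_ge0 //; try exact: ltW.
    by rewrite -[leRHS]mulr1 ler_pM2l.
  by rewrite lerD2l ler_pM2r // ler_pM2l.
apply: le_trans b1 _.
have b2 : (eps * (1 + 2 * R2 * L)) ^+ 2 <= rho0 * edot b b / 8.
  have -> : (eps * (1 + 2 * R2 * L)) ^+ 2 = eps * (eps * (1 + 2 * R2 * L) ^+ 2) by ring.
  apply: le_trans (_ : 1 * (eps * (1 + 2 * R2 * L) ^+ 2) <= _).
    by apply: ler_wpM2r => //; rewrite mulr_ge0 ?sqr_ge0 // ltW.
  by move: eK2; rewrite /K2; move: ((1 + 2 * R2 * L) ^+ 2) => X; lra.
apply: le_trans b2 _.
have : rho0 * (edot b b / 4) <= edot p p * edot w w.
  by apply: ler_pM => //; [exact: ltW | rewrite divr_ge0 // ltW].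
lra.
Unshelve. all: by end_near. Qed.

End HalfBalls.

(** * Tilting the half ball *)

Section Tilt.
Variables (R : realType) (n : nat) (phi : R -> R) (rbar r0 : \bar R).
Hypothesis n_gt0 : (0 < n)%N.
Hypothesis sm : smooth_metric_on (oball rbar `|` cball r0) (conformal_metric n phi).
Local Notation g := (conformal_metric n phi).
Implicit Types (S : set 'rV[R]_n.+1) (a b c x p : 'rV[R]_n.+1).

Lemma linear_contact S f p c : S p -> (forall x, S x -> edot c x <= 0) -> edot c p = 0 ->
  interior_chart S p f \/
    (exists h, [/\ boundary_chart S p f h, edot (gradient f p) p = 0 & 0 < edot (gradient h p) p]) ->
  gradient f p != 0 /\ (forall v, edot (gradient f p) v = 0 -> edot c v = 0).
Proof.
move=> Sp cS cp ch.
have N0 : gradient f p != 0.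
  case: ch => [[]//|[h [[_ _ rf _ _] _ _]]].
  by have [] := row_free2 rf 0.
split=> //.
have push v s (k : R) : s @ (0 : R) --> k ->
    (\forall t \near (0 : R), 0 < t -> S (curve p v (gradient f p) s t)) -> edot c v <= 0.
  move=> sk sS.
  have := @jet2_edot_curve R n (- c) p v (gradient f p) s k sk.
  rewrite !edotNl cp oppr0 => J.
  have : 0 <= - edot c v.
    apply: jet2_ge0r J _; apply: filterS sS => t h /h /cS.
    by rewrite edotNl oppr_ge0.
  by rewrite oppr_ge0.
suff key v : edot (gradient f p) v = 0 -> edot c v <= 0.
  move=> v vN; apply/eqP; rewrite eq_le key //= -oppr_le0 -edotNr key //.
  by rewrite edotNr vN oppr0.
move=> vN; case: ch => [ic|[h [bc fp hp]]].
  have [s sk sS] := interior_curve Sp ic vN.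
  by apply: push sk _; apply: filterS sS.
(* At a boundary point any tangent vector becomes inward pointing after subtraction of a large
   multiple of [p]. Since [edot c p = 0], this does not change its product with [c]. *)
pose K := (`|edot (gradient h p) v| + 1) / edot (gradient h p) p.
have v1 : edot (gradient f p) (v - K *: p) = 0 by rewrite edotBr edotZr vN fp mulr0 subrr.
have v2 : edot (gradient h p) (v - K *: p) < 0.
  rewrite edotBr edotZr /K divfK ?gt_eqF // subr_lt0.
  by apply: le_lt_trans (ler_norm _) _; rewrite ltrDl.
have [k [s sk sS]] := boundary_curve Sp bc v1 v2.
by have := push _ s k sk sS; rewrite edotBr edotZr cp mulr0 subr0.
Qed.

(* If [S] lies below two of the tilted hyperplanes, then it lies in a wedge, and touches the
   edge of the wedge by [meets_closed_half_ball]. *)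
Lemma tilt_unique S a b (t1 t2 : R) : compact_free_boundary_minimal g r0 S ->
  a != 0 -> b != 0 -> edot a b = 0 -> t1 < t2 ->
  (forall x, S x -> edot (a + t1 *: b) x <= 0) ->
  (forall x, S x -> edot (a + t2 *: b) x <= 0) -> False.
Proof.
move=> fbm a0 b0 ab t12 P1 P2.
pose c := a + ((t1 + t2) / 2) *: b.
have c0 : c != 0.
  have : 0 < edot c a by rewrite edotDl edotZl (edotC b) ab mulr0 addr0 edot_gt0.
  by apply: contraTneq => ->; rewrite edot0l ltxx.
have [p Sp pc] := meets_closed_half_ball n_gt0 sm fbm c0.
have h1 := P1 p Sp; have h2 := P2 p Sp.
(* At [p] the middle functional is the mean of the other two; it is nonnegative there and they are
   nonpositive, so all three vanish. *)
have [e1 e2] : edot (a + t1 *: b) p = 0 /\ edot (a + t2 *: b) p = 0.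
  move: pc h1 h2; rewrite edotC /c !edotDl !edotZl; move: (edot a p) (edot b p) => u w pc h1 h2.
  have -> : u + t1 * w = 2 * (u + (t1 + t2) / 2 * w) - (u + t2 * w) by field.
  have e : u + (t1 + t2) / 2 * w = (u + t1 * w) / 2 + (u + t2 * w) / 2 by field.
  rewrite e in pc *; split; lra.
have [f ch] : exists f, interior_chart S p f \/
    (exists h, [/\ boundary_chart S p f h, edot (gradient f p) p = 0 & 0 < edot (gradient h p) p]).
  have [[f ic _]|[f [h [bc fp hp _]]]] := fbm_points fbm Sp; exists f; [by left | right].
  by exists h.
have [N0 k1] := linear_contact Sp P1 e1 ch.
have [_ k2] := linear_contact Sp P2 e2 ch.
have m1 := tangent_multiplier N0 k1; have m2 := tangent_multiplier N0 k2.
move: m1 m2; move: (_ / _) (_ / _) => l2 l1; set N := gradient f p in N0 *; move=> m1 m2.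
have t0 : t2 - t1 != 0 by rewrite subr_eq0 gt_eqF.
(* Both hyperplanes are tangent to the hypersurface at [p], so [a] and [b] are multiples of one
   normal, which nonzero orthogonal vectors cannot be. *)
have bN : b = ((l2 - l1) / (t2 - t1)) *: N.
  have : (t2 - t1) *: b = (l2 - l1) *: N.
    rewrite !scalerBl -m1 -m2; apply/rowP => i; rewrite !mxE; ring.
  move=> h; transitivity ((t2 - t1)^-1 *: ((t2 - t1) *: b)).
    by rewrite scalerA mulVf // scale1r.
  by rewrite h scalerA mulrC.
have aN : a = (l1 - t1 * ((l2 - l1) / (t2 - t1))) *: N.
  by rewrite scalerBl -scalerA -bN -m1 addrK.
have NN : edot N N != 0 by rewrite edot_eq0.
have {aN} [k aN] : exists k, a = k *: N by eexists; exact: aN.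
have {bN} [k' bN] : exists k, b = k *: N by eexists; exact: bN.
move: ab; rewrite aN bN edotZl edotZr => /eqP; rewrite !mulf_eq0 (negPf NN) orbF => /orP[/eqP z|/eqP z].
  by move: a0; rewrite aN z scale0r eqxx.
by move: b0; rewrite bN z scale0r eqxx.
Qed.

Lemma compact_meet S S' : compact S -> compact S' -> compact (S `&` S').
Proof.
move=> cS cS'; rewrite setIC; apply: compact_closedI => //.
by apply: compact_closed => //; exact: norm_hausdorff.
Qed.

(* [c = a + s b] for small [s]: by [tilt_unique] each hypersurface stays out of the open half ball
   for at most one [s]. *)
Lemma tilt S S' a : compact_free_boundary_minimal g r0 S ->
  compact_free_boundary_minimal g r0 S' -> a != 0 ->
  (forall x, S x -> S' x -> edot a x < 0) ->
  exists c, [/\ c != 0, (exists2 m, 0 < m & forall x, S x -> S' x -> edot c x <= - m),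
    (exists2 x, S x & 0 < edot c x) & (exists2 x, S' x & 0 < edot c x)].
Proof.
move=> fbm fbm' a0 sep.
have [_ cS _ _ _] := fbm; have [_ cS' _ _ _] := fbm'.
have cI := compact_meet cS cS'.
have [b b0 ba] := exists_orthogonal n_gt0 a0.
have ab : edot a b = 0 by rewrite edotC.
have [t t0 sept] : exists2 t, 0 < t & forall s, 0 < s -> s <= t ->
    exists2 m, 0 < m & forall x, S x -> S' x -> edot (a + s *: b) x <= - m.
  have [[y0 Iy0]|no] := pselect (exists x, (S `&` S') x); last first.
    exists 1 => // s _ _; exists 1 => // x Sx S'x; case: no; exists x; by [].
  have I0 : S `&` S' !=set0 by exists y0.
  have [m m0 mP] := @compact_pos R _ (S `&` S') (edot (- a)) I0 cI
    (fun x _ => @edot_continuous R n (- a) x)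
    (fun x Ix => ltac:(by rewrite edotNl oppr_gt0; case: Ix; exact: sep)).
  have [M M0 MP] := @compact_bounded R _ (S `&` S') (edot b) I0 cI (fun x _ => @edot_continuous R n b x).
  exists (m / (2 * M)); first by rewrite divr_gt0 // mulr_gt0.
  move=> s s0 st; exists (m / 2); first by rewrite divr_gt0.
  move=> x Sx S'x; rewrite edotDl edotZl.
  have h1 := mP x (conj Sx S'x); rewrite edotNl in h1.
  have h2 : s * edot b x <= m / 2.
    apply: le_trans (_ : s * M <= _).
      by rewrite ler_pM2l // (le_trans (ler_norm _)) //; exact: MP.
    apply: le_trans (_ : m / (2 * M) * M <= _); first by rewrite ler_pM2r.
    rewrite le_eqVlt; apply/orP; left; apply/eqP; field; by rewrite gt_eqF.
  lra.
have pick (T : set 'rV[R]_n.+1) s : ~ (forall x, T x -> edot (a + s *: b) x <= 0) ->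
    exists2 x, T x & 0 < edot (a + s *: b) x.
  move=> h; apply: contrapT => no; apply: h => x Tx; rewrite leNgt; apply/negP => xp.
  by apply: no; exists x.
have fin s : 0 < s -> s <= t -> ~ (forall x, S x -> edot (a + s *: b) x <= 0) ->
    ~ (forall x, S' x -> edot (a + s *: b) x <= 0) ->
    exists c, [/\ c != 0, (exists2 m, 0 < m & forall x, S x -> S' x -> edot c x <= - m),
    (exists2 x, S x & 0 < edot c x) & (exists2 x, S' x & 0 < edot c x)].
  move=> s0 st h h'; exists (a + s *: b); split; [|exact: sept|exact: pick|exact: pick].
  have : 0 < edot (a + s *: b) a by rewrite edotDl edotZl ba mulr0 addr0 edot_gt0.
  by apply: contraTneq => ->; rewrite edot0l ltxx.
have u := fun t1 t2 => @tilt_unique S a b t1 t2 fbm a0 b0 ab.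
have u' := fun t1 t2 => @tilt_unique S' a b t1 t2 fbm' a0 b0 ab.
pose P s := forall x, S x -> edot (a + s *: b) x <= 0.
pose P' s := forall x, S' x -> edot (a + s *: b) x <= 0.
have l1 : t / 4 < t / 2 by lra.
have l2 : t / 2 < t by lra.
have l3 : t / 4 < t by lra.
have p4 : 0 < t / 4 by lra.
have p2 : 0 < t / 2 by lra.
(* Each hypersurface rules out at most one of the slopes [t / 4], [t / 2] and [t], so one of the
   three serves both. *)
have [A1|A1] := pselect (P t); have [A2|A2] := pselect (P (t / 2));
have [B1|B1] := pselect (P' t); have [B2|B2] := pselect (P' (t / 2));
  try by [exact: (fin t) | case: (u _ _ l2) | case: (u' _ _ l2)];
  try (by apply: (fin (t / 2)) => //; exact: ltW);
  apply: (fin (t / 4)) => //; try exact: ltW;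
  by [move=> h; apply: (u _ _ l3 h) | move=> h; apply: (u _ _ l1 h) |
      move=> h; apply: (u' _ _ l3 h) | move=> h; apply: (u' _ _ l1 h)].
Qed.

End Tilt.

(** * The two-point functional *)

Section TwoPoint.
Variables (R : realType) (n : nat) (phi : R -> R) (rbar r0 : \bar R).
Hypothesis sm : smooth_metric_on (oball rbar `|` cball r0) (conformal_metric n phi).
Local Notation slope := (@slope R n phi).
Local Notation conf := (conf phi).
Local Notation g := (conformal_metric n phi).
Variables (psi psi1 psi2 : R -> R).
Hypothesis psi_jet : forall r, jet2 (fun t => psi (r + t)) (psi r) (psi1 r) (psi2 r / 2).
Variables (c : 'rV[R]_n.+1) (eps : R).
Implicit Types (S : set 'rV[R]_n.+1) (x y u v N : 'rV[R]_n.+1).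
Local Notation q := (test psi c eps).
Local Notation dq := (dtest psi1 c eps).

Lemma edot_sub u v : edot (u - v) (u - v) = edot u u - 2 * edot u v + edot v v.
Proof. by rewrite !edotBl !edotBr (edotC v u); ring. Qed.

Lemma jet2_dist x v N s (k : R) y v' N' s' (k' : R) :
  s @ (0 : R) --> k -> s' @ (0 : R) --> k' ->
  jet2 (fun t => edot (curve x v N s t - curve y v' N' s' t) (curve x v N s t - curve y v' N' s' t))
    (edot (x - y) (x - y)) (2 * edot (x - y) (v - v'))
    (edot (v - v') (v - v') + 2 * (k * edot (x - y) N - k' * edot (x - y) N')).
Proof.
move=> sk sk'; set u := x - y; set d := v - v'.
pose z (t : R) := s t *: N - s' t *: N'.
have zc : z t @[t --> (0 : R)] --> k *: N - k' *: N'.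
  by apply: cvgB; apply: cvgZr_tmp.
have fI := nbhs_filter (0 : R).
have cu (w : 'rV[R]_n.+1) : (fun _ : R => w) @ (0 : R) --> w by exact: cvg_cst.
have c1 := @edot_cvg R R n (nbhs (0 : R)) fI _ _ _ _ (cu u) zc.
have c2 := @edot_cvg R R n (nbhs (0 : R)) fI _ _ _ _ (cu d) zc.
have c3 := @edot_cvg R R n (nbhs (0 : R)) fI _ _ _ _ zc zc.
have cI := @cvg_idR R.
exists (fun t => edot d d + 2 * edot u (z t) + 2 * edot d (z t) * t + edot (z t) (z t) * (t * t)).
  have -> : k * edot u N - k' * edot u N' = edot u (k *: N - k' *: N') by rewrite edotBr !edotZr.
  move: c1 c2 c3; set Z := k *: N - k' *: N'.
  move: (edot u Z) (edot d Z) (edot Z Z) => a b e c1 c2 c3.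
  apply: (@cvg_eqr _ _ _ _ (edot d d + 2 * a + 2 * b * 0 + e * (0 * 0))); last by ring.
  apply: cvgD; first apply: cvgD; first apply: cvgD; first exact: cvg_cst.
  - by apply: cvgM; [exact: cvg_cst | exact: c1].
  - by apply: cvgM; [apply: cvgM; [exact: cvg_cst | exact: c2] | exact: cI].
  - by apply: cvgM; [exact: c3 | apply: cvgM; exact: cI].
near=> t.
have -> : curve x v N s t - curve y v' N' s' t = u + t *: d + (t ^+ 2) *: z t.
  by apply/rowP => i; rewrite !mxE; ring.
move: (z t) => w; clearbody u d.
rewrite !(edotDr, edotDl, edotZr, edotZl) (edotC d u) (edotC w u) (edotC w d).
move: (edot u u) (edot u d) (edot d d) (edot u w) (edot d w) (edot w w) => *; ring.
Unshelve. all: by end_near. Qed.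

Section Pair.
Variables (mu : R) (S S' : set 'rV[R]_n.+1) (x y : 'rV[R]_n.+1).
Hypothesis mu_eq : mu * (q x * q y) = edot (x - y) (x - y).
Hypothesis min_near : \forall z \near (x, y), S z.1 -> S' z.2 ->
  0 <= edot (z.1 - z.2) (z.1 - z.2) - mu * (q z.1 * q z.2).

(** The limit of the quadratic coefficient in [interior_curve]. *)
Definition bend (f : 'rV[R]_n.+1 -> R) x v : R :=
  - 'D_v (fun y => 'D_v f y) x / (2 * edot (gradient f x) (gradient f x)).

(** With [mu] the value of the quotient at the pair, [|x - y|^2 - mu * q x * q y] avoids
    differentiating a quotient: it vanishes at the pair and is nonnegative nearby. It is expanded
    along curves on the two hypersurfaces with independent velocities. *)
Lemma pair_variation f f' v v' : S x -> S' y -> interior_chart S x f -> interior_chart S' y f' ->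
  edot (gradient f x) v = 0 -> edot (gradient f' y) v' = 0 ->
  2 * edot (x - y) (v - v') - mu * (q x * edot (dq y) v' + edot (dq x) v * q y) = 0 /\
  0 <= edot (v - v') (v - v')
    + 2 * (bend f x v * edot (x - y) (gradient f x) - bend f' y v' * edot (x - y) (gradient f' y))
    - mu * (q x * (bend f' y v' * edot (dq y) (gradient f' y) +
         eps * (psi1 (edot y y) * edot v' v' + 2 * psi2 (edot y y) * edot y v' ^+ 2))
       + edot (dq x) v * edot (dq y) v'
       + (bend f x v * edot (dq x) (gradient f x) +
         eps * (psi1 (edot x x) * edot v v + 2 * psi2 (edot x x) * edot x v ^+ 2)) * q y).
Proof.
move=> Sx S'y ic ic' vN vN'.
set N := gradient f x in vN *; set N' := gradient f' y in vN' *.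
have [s sk sS] := interior_curve Sx ic vN; have [s' sk' sS'] := interior_curve S'y ic' vN'.
rewrite -/(bend f x v) in sk; rewrite -/(bend f' y v') in sk'.
have j1 := @jet2_dist x v N s _ y v' N' s' _ sk sk'.
have j2 := @jet2_test R n psi psi1 psi2 psi_jet c eps x v N s _ sk.
have j3 := @jet2_test R n psi psi1 psi2 psi_jet c eps y v' N' s' _ sk'.
have J := jet2D j1 (jet2Z (- mu) (jet2M j2 j3)).
rewrite mulNr mu_eq subrr in J.
suff hn : \forall t \near (0 : R), 0 <= edot (curve x v N s t - curve y v' N' s' t)
    (curve x v N s t - curve y v' N' s' t) + - mu * (q (curve x v N s t) * q (curve y v' N' s' t)).
  have [e1 e2] := jet2_ge0 J hn; rewrite mulNr in e1; rewrite mulNr in e2.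
  by split.
have cc : (fun t => (curve x v N s t, curve y v' N' s' t)) @ (0 : R) --> (x, y).
  have c1 := @curve_cvg R n x v N s _ sk; have c2 := @curve_cvg R n y v' N' s' _ sk'.
  exact: (cvg_pair c1 c2).
have := cc _ min_near; rewrite /nbhs /= => H.
near=> t.
have h1 : S (curve x v N s t) by near: t.
have h2 : S' (curve y v' N' s' t) by near: t.
have : S (curve x v N s t) -> S' (curve y v' N' s' t) ->
  0 <= edot (curve x v N s t - curve y v' N' s' t) (curve x v N s t - curve y v' N' s' t)
   - mu * (q (curve x v N s t) * q (curve y v' N' s' t)) by near: t; exact: H.
by move=> /(_ h1 h2); rewrite mulNr.
Unshelve. all: by end_near. Qed.

End Pair.

(* With [y] frozen, the two-point functional is again a test function of [x]. *)
Lemma pair_boundary mu S x y : compact_free_boundary_minimal g r0 S -> S x ->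
  ((enorm y)%:E <= r0)%E -> 0 < q x -> mu * (q x * q y) = edot (x - y) (x - y) ->
  x != y -> 0 < eps -> 0 < psi (edot x x) - 2 * edot x x * psi1 (edot x x) ->
  (\forall z \near x, S z -> 0 <= edot (z - y) (z - y) - mu * (q z * q y)) ->
  exists f, interior_chart S x f.
Proof.
move=> fbm Sx yr qx muE xy eps0 psi0 mn.
have [[f ic _]|[f [h [bc fx hx xr]]]] := fbm_points fbm Sx; first by exists f.
exfalso.
(* Sorting [|z - y|^2 - mu * q z * q y] by its dependence on [z] gives the linear part [c'] and the
   radial part [Psi], with parameter [1]. *)
pose k := mu * q y * eps.
pose Psi r := r + edot y y - k * psi r.
pose Psi1 r := 1 - k * psi1 r; pose Psi2 r := - (k * psi2 r).
have PJ r : jet2 (fun t => Psi (r + t)) (Psi r) (Psi1 r) (Psi2 r / 2).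
  have J := jet2D (jet2D (jet2_cst (r + edot y y)) (jet2_id R)) (jet2Z (- k) (psi_jet r)).
  have J' : jet2 (fun t => Psi (r + t)) (r + edot y y + 0 + - k * psi r) (0 + 1 + - k * psi1 r)
     (0 + 0 + - k * (psi2 r / 2)).
    by apply: jet2_near J; near=> t; rewrite /Psi /cst; ring.
  by apply: jet2_eq J' _ _ _; rewrite /Psi /Psi1 /Psi2; field.
pose c' := - (2 *: y + (mu * q y) *: c).
have tE z : test Psi c' 1 z = edot (z - y) (z - y) - mu * (q z * q y).
  rewrite /Psi /c' /k; move: (q y) => qy.
  rewrite edot_sub /test edotNl edotDl !edotZl mul1r (edotC y z).
  by move: (edot z z) (psi (edot z z)) (edot y y) (edot z y) (edot c z) => *; ring.
have t0 : test Psi c' 1 x = 0 by rewrite tE muE subrr.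
have tn : \forall z \near x, S z -> 0 <= test Psi c' 1 z.
  by apply: filterS mn => z hz Sz; rewrite tE; exact: hz.
have := boundary_inward PJ Sx bc fx hx t0 tn.
rewrite leNgt => /negP; apply.
have dd : 0 < edot (x - y) (x - y) by rewrite edot_gt0 subr_eq0.
have mq : mu * q y = edot (x - y) (x - y) / q x by rewrite -muE; field; rewrite gt_eqF.
have cx : edot c x = q x - eps * psi (edot x x) by rewrite /test addrK.
have -> : edot (dtest Psi1 c' 1 x) x = (edot x x - edot y y) +
   edot (x - y) (x - y) * eps / q x * (psi (edot x x) - 2 * edot x x * psi1 (edot x x)).
  have cE : edot c' x = - (2 * edot y x + mu * q y * edot c x).
    by rewrite /c' edotNl edotDl 2!edotZl.
  rewrite [edot (dtest _ _ _ _) _]edotDl edotZl cE cx /Psi1 /k mq.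
  have sub := edot_sub x y; rewrite (edotC y x).
  have {sub} -> : edot x y = (edot x x + edot y y - edot (x - y) (x - y)) / 2 by rewrite sub; field.
  move: (edot x x) (psi1 (edot x x)) (psi (edot x x)) (edot y y) (edot (x - y) (x - y)) (q x) qx.
  by move=> r a b r' d Q Q0; field; rewrite gt_eqF.
(* The first term is nonnegative since [x] lies on the boundary sphere and [y] in the closed ball;
   the second is positive by the condition on [psi]. *)
apply: ltr_wpDl; last by rewrite mulr_gt0 // divr_gt0 // mulr_gt0.
rewrite subr_ge0 -!enorm2 lerXn2r // ?nnegrE ?enorm_ge0 //.
by rewrite -lee_fin xr.
Unshelve. all: by end_near. Qed.

End TwoPoint.

Section PairInequality.
Variables (R : realType) (n : nat) (phi : R -> R) (rbar r0 : \bar R).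
Hypothesis sm : smooth_metric_on (oball rbar `|` cball r0) (conformal_metric n phi).
Local Notation slope := (@slope R n phi).
Local Notation conf := (conf phi).
Local Notation bracket := (@bracket R n phi).
Local Notation g := (conformal_metric n phi).
Variables (psi psi1 psi2 : R -> R).
Hypothesis psi_jet : forall r, jet2 (fun t => psi (r + t)) (psi r) (psi1 r) (psi2 r / 2).
Variables (c : 'rV[R]_n.+1) (eps : R).
Implicit Types (S : set 'rV[R]_n.+1) (x y u v N : 'rV[R]_n.+1).
Local Notation q := (test psi c eps).
Local Notation dq := (dtest psi1 c eps).
Local Notation excess := (excess psi psi1 psi2 phi).

(* A normal vector at [x], for a critical pair [(x, y)] of the two-point functional. *)
Definition pnormal x y := (2 * q x / edot (x - y) (x - y)) *: (x - y) - dq x.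

Lemma edot_subC x y : edot (y - x) (y - x) = edot (x - y) (x - y).
Proof. by rewrite -opprB edotNl edotNr opprK. Qed.

(** The difference of squared radii found here becomes the second half of the bracket. For [eps = 0]
    and [|x| = |y|] it shows that the normal is orthogonal to [x]. *)
Lemma edot_pnormal x y : x != y -> edot x (pnormal x y) =
  q x * (edot x x - edot y y) / edot (x - y) (x - y)
    + eps * (psi (edot x x) - 2 * edot x x * psi1 (edot x x)).
Proof.
move=> xy; have dd : edot (x - y) (x - y) != 0 by rewrite edot_eq0 subr_eq0.
have cx : edot x c = q x - eps * psi (edot x x) by rewrite /test edotC addrK.
have dqx : edot x (dq x) = edot x c + 2 * eps * psi1 (edot x x) * edot x x.
  by rewrite /dtest edotDr edotZr.
have -> : edot x (pnormal x y) = 2 * q x / edot (x - y) (x - y) * (edot x x - edot x y) - edot x (dq x).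
  by rewrite /pnormal -edotBr -edotZr -edotBr.
rewrite dqx cx.
have sub := edot_sub x y.
have {sub} -> : edot x y = (edot x x + edot y y - edot (x - y) (x - y)) / 2 by rewrite sub; field.
move: (edot x x) (psi (edot x x)) (psi1 (edot x x)) (edot y y) (q x) (edot (x - y) (x - y)) dd.
by move=> r a b r' Q d d0; field.
Qed.

Lemma frame_orthogonal m (E : 'M[R]_(m, n.+1)) N : (forall i, edot N (row i E) = 0) -> E *m N^T = 0.
Proof.
move=> h; apply/matrixP => i j; rewrite (ord1 j) [RHS]mxE -[RHS](h i) edotC edotE mxE.
by apply: eq_bigr => k _; rewrite !mxE.
Qed.

Lemma unitv_refl_sum (a b : 'rV[R]_n.+1) : edot a a = 1 -> edot b b = 1 ->
  b *m refl (a + b) = - a.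
Proof.
move=> aa bb; rewrite reflE; have [m0|m0] := eqVneq (a + b) 0.
  by rewrite m0 scaler0 subr0; apply/eqP; rewrite -addr_eq0 addrC m0.
have mm : edot (a + b) (a + b) != 0 by rewrite edot_eq0.
have -> : 2 * edot b (a + b) / edot (a + b) (a + b) = 1.
  have e : edot (a + b) (a + b) = 2 * edot b (a + b).
    by rewrite !edotDl !edotDr aa bb (edotC a b); ring.
  by rewrite -e divff.
by rewrite scale1r opprD addrC addrNK.
Qed.

Lemma sum_combination (I : finType) (K k1 k2 k3 k4 k5 : R) (t1 t2 t3 t4 t5 : I -> R) :
  \sum_i (K + k1 * t1 i + k2 * t2 i + k3 * t3 i + k4 * t4 i + k5 * t5 i) =
  #|I|%:R * K + k1 * (\sum_i t1 i) + k2 * (\sum_i t2 i) + k3 * (\sum_i t3 i)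
    + k4 * (\sum_i t4 i) + k5 * (\sum_i t5 i).
Proof. by rewrite !big_split /= sumr_const -!mulr_sumr -[K *+ _]mulr_natl. Qed.

(** The frame [E] at [x] is carried to [y] by [refl u], which matches the normals up to [e],
    followed by [refl m], which makes the match exact. The price of the correction is the middle
    term, quadratic in [e]. Minimality evaluates both Hessian traces, and their radial contributions
    complete the bracket. *)
Lemma pair_inequality mu S S' x y f f' :
  minimal g S -> minimal g S' -> S x -> S' y -> x != 0 -> y != 0 -> x != y ->
  ((enorm x)%:E <= r0)%E -> ((enorm y)%:E <= r0)%E ->
  interior_chart S x f -> interior_chart S' y f' -> 0 < q x -> 0 < q y ->
  mu * (q x * q y) = edot (x - y) (x - y) ->
  (\forall z \near (x, y), S z.1 -> S' z.2 ->
    0 <= edot (z.1 - z.2) (z.1 - z.2) - mu * (q z.1 * q z.2)) ->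
  0 <= n%:R * bracket (enorm x) (enorm y) * edot (pnormal x y) (pnormal x y)
      * edot (pnormal y x) (pnormal y x) * q x * q y
   + conf (enorm x) * conf (enorm y)
      * edot (pnormal x y *m refl (x - y) - pnormal y x) (pnormal x y *m refl (x - y) - pnormal y x)
      * (enorm (pnormal x y) * enorm (pnormal y x)) * q x * q y
   - eps * edot (x - y) (x - y) *
      (conf (enorm x) * excess x (pnormal x y) * edot (pnormal y x) (pnormal y x) * q y
       + conf (enorm y) * excess y (pnormal y x) * edot (pnormal x y) (pnormal x y) * q x).
Proof.
move=> mS mS' Sx S'y x0 y0 xy xr yr ic ic' qx qy muE mn.
set wx := pnormal x y; set wy := pnormal y x; set e := wx *m refl (x - y) - wy.
have dd : 0 < edot (x - y) (x - y) by rewrite edot_gt0 subr_eq0.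
have exc0 z : excess z 0 = 0 by rewrite /excess edot0l edot0r expr0n !(mulr0, subrr) addr0.
(* If one of the normals vanishes, every term does. *)
have [wx0|wx0] := eqVneq wx 0.
  by rewrite wx0 exc0 edot0l /enorm edot0l sqrtr0 !(mul0r, mulr0, addr0, subr0).
have [wy0|wy0] := eqVneq wy 0.
  by rewrite wy0 exc0 edot0l /enorm edot0l sqrtr0 !(mul0r, mulr0, addr0, subr0).
have [sf N0 _] := ic; have [sf' N0' _] := ic'.
set N := gradient f x in N0; set N' := gradient f' y in N0'.
have muy : mu * q y = edot (x - y) (x - y) / q x by rewrite -muE; field; rewrite gt_eqF.
have mux : mu * q x = edot (x - y) (x - y) / q y by rewrite -muE; field; rewrite gt_eqF.
have var := @pair_variation R n psi psi1 psi2 psi_jet c eps mu S S' x y muE mn f f'.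
have wxv v : edot wx v = 2 * q x / edot (x - y) (x - y) * edot (x - y) v - edot (dq x) v.
  by rewrite /wx /pnormal [LHS]edotBl edotZl.
have wyv v : edot wy v = - (2 * q y / edot (x - y) (x - y) * edot (x - y) v) - edot (dq y) v.
  by rewrite /wy /pnormal [LHS]edotBl edotZl edot_subC -(opprB x y) edotNl mulrN.
(* Moving [x] alone, the first variation says that [wx] annihilates the tangent space. *)
have tx v : edot N v = 0 -> edot wx v = 0.
  move=> vN; have [h _] := var v 0 Sx S'y ic ic' vN (edot0r _).
  rewrite wxv; move: h; rewrite subr0 edot0r mulr0 add0r mulrCA muy.
  move: (edot (x - y) v) (edot (dq x) v) (edot (x - y) (x - y)) dd => a b d d0 h.
  have -> : 2 * q x / d * a - b = q x / d * (2 * a - b * (d / q x)) by field; rewrite !gt_eqF.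
  by rewrite h mulr0.
have ty v : edot N' v = 0 -> edot wy v = 0.
  move=> vN; have [h _] := var 0 v Sx S'y ic ic' (edot0r _) vN.
  rewrite wyv; move: h; rewrite sub0r edotNr edot0r mul0r addr0 mulrA mux.
  move: (edot (x - y) v) (edot (dq y) v) (edot (x - y) (x - y)) dd => a b d d0 h.
  have -> : - (2 * q y / d * a) - b = q y / d * (2 * - a - (d / q y) * b) by field; rewrite !gt_eqF.
  by rewrite h mulr0.
have ex := tangent_multiplier N0 tx; have ey := tangent_multiplier N0' ty.
set lx := edot wx N / edot N N in ex; set ly := edot wy N' / edot N' N' in ey.
have lx0 : lx != 0 by apply: contraNneq wx0 => l0; rewrite ex l0 scale0r.
have ly0 : ly != 0 by apply: contraNneq wy0 => l0; rewrite ey l0 scale0r.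
have [E [EE Ew Esum]] := exists_frame wx0.
pose nx := unitv wx; pose ny := unitv wy.
have nxx : edot nx nx = 1 by exact: edot_unitv.
have nyy : edot ny ny = 1 by exact: edot_unitv.
(* Reflecting in [n1 - ny] would match the normals too, but that vector is nearly tangential when
   the normals nearly agree, and a tangent direction would be flipped. The sum [m] is then nearly
   normal, so [refl m] almost fixes tangent vectors. For [m = 0] the reflection is the identity and
   [n1 = - ny] already. *)
pose u := x - y; pose n1 := nx *m refl u; pose m := n1 + ny.
have n11 : edot n1 n1 = 1 by rewrite edot_refl.
pose M := refl u *m refl m; pose E' := E *m M.
have MM : M *m M^T = 1%:M.
  by rewrite /M trmx_mul !tr_refl mulmxA -(mulmxA (refl u)) refl_mul mulmx1 refl_mul.
have EE' : E' *m E'^T = 1%:M by rewrite /E' trmx_mul mulmxA -(mulmxA E) MM mulmx1.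
have nm : ny *m refl m = - n1 by exact: unitv_refl_sum.
have n1m : n1 *m refl m = - ny.
  by rewrite -[LHS]opprK -mulNmx -nm refl_involutive.
have rowx i : edot wx (row i E) = 0 := frame_row_orth i Ew.
have rowE' i : row i E' = row i E *m refl u *m refl m by rewrite /E' /M mulmxA !row_mul.
have px : 0 < enorm wx by rewrite enorm_gt0.
have py : 0 < enorm wy by rewrite enorm_gt0.
have wxn : wx = enorm wx *: nx by rewrite /nx /unitv scalerA divff ?scale1r // gt_eqF.
have wyn : wy = enorm wy *: ny by rewrite /ny /unitv scalerA divff ?scale1r // gt_eqF.
have nrow i : edot nx (row i E) = 0.
  by rewrite /nx /unitv edotZl rowx mulr0.
have rowy i : edot wy (row i E') = 0.
  rewrite wyn edotZl rowE' edot_reflr nm edotNl edot_refl nrow; ring.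
have rowN i : edot N (row i E) = 0.
  by have := rowx i; rewrite ex edotZl => /eqP; rewrite mulf_eq0 (negPf lx0) => /eqP.
have rowN' i : edot N' (row i E') = 0.
  by have := rowy i; rewrite ey edotZl => /eqP; rewrite mulf_eq0 (negPf ly0) => /eqP.
have trx := minimal_trace_radial sm mS Sx x0 xr ic EE (frame_orthogonal rowN).
have try := minimal_trace_radial sm mS' S'y y0 yr ic' EE' (frame_orthogonal rowN').
rewrite -/N in trx; rewrite -/N' in try.
have [a aE] : exists a, a = conf (enorm x) by exists (conf (enorm x)).
have [b bE] : exists b, b = conf (enorm y) by exists (conf (enorm y)).
rewrite -aE in trx; rewrite -bE in try; rewrite -aE -bE.
have a0 : 0 < a by rewrite aE conf_gt0.
have b0 : 0 < b by rewrite bE conf_gt0.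
have [Dx DxE] : exists D, D = slope (enorm x) by exists (slope (enorm x)).
have [Dy DyE] : exists D, D = slope (enorm y) by exists (slope (enorm y)).
rewrite -DxE in trx; rewrite -DyE in try.
set X := edot wx wx; set Y := edot wy wy.
have X0 : 0 < X by rewrite edot_gt0.
have Y0 : 0 < Y by rewrite edot_gt0.
(* The first-order conditions express [dq x] and [dq y] on the frames through [u]; the mixed terms
   of the second variation then combine to [- 2 * a * b * tau i]. This is how [refl u] enters. *)
pose tau i := edot (row i E) (row i E' *m refl u).
pose D2x i := 'D_(row i E) (fun z => 'D_(row i E) f z) x.
pose D2y i := 'D_(row i E') (fun z => 'D_(row i E') f' z) y.
rewrite -/(\sum_i D2x i) in trx; rewrite -/(\sum_i D2y i) in try.
set d := edot (x - y) (x - y) in muE muy mux dd *.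
set rx := edot x x; set ry := edot y y.
have I i : 0 <= a ^+ 2 + b ^+ 2 - 2 * a * b * tau i
    - d / q x * (lx * a ^+ 2 * D2x i / 2 + eps * a ^+ 2 * (psi1 rx + 2 * psi2 rx * edot x (row i E) ^+ 2))
    - d / q y * (ly * b ^+ 2 * D2y i / 2 + eps * b ^+ 2 * (psi1 ry + 2 * psi2 ry * edot y (row i E') ^+ 2)).
  have [_] := var (a *: row i E) (b *: row i E') Sx S'y ic ic'
    (etrans (edotZr _ _ _) (etrans (congr1 _ (rowN i)) (mulr0 _)))
    (etrans (edotZr _ _ _) (etrans (congr1 _ (rowN' i)) (mulr0 _))).
  rewrite /bend (second_derive_scale a (row i E) sf) (second_derive_scale b (row i E') sf') -/(D2x i) -/(D2y i) -/N -/N'.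
  have dqx : edot (dq x) (row i E) = 2 * q x / d * edot u (row i E).
    by have := wxv (row i E); rewrite rowx => /esym/eqP; rewrite subr_eq0 => /eqP <-.
  have dqy : edot (dq y) (row i E') = - (2 * q y / d * edot u (row i E')).
    by have := wyv (row i E'); rewrite rowy => /esym/eqP; rewrite subr_eq0 => /eqP <-.
  have dqN : edot (dq x) N = 2 * q x / d * edot u N - lx * edot N N.
    have := wxv N; rewrite /lx divfK ?edot_eq0 // => ->; rewrite -/d -/u; ring.
  have dqN' : edot (dq y) N' = - (2 * q y / d * edot u N') - ly * edot N' N'.
    have := wyv N'; rewrite /ly divfK ?edot_eq0 // => ->; rewrite -/d -/u; ring.
  rewrite -/u dqN dqN' !edotZr dqx dqy edot_sub !edotZl !edotZr.
  rewrite (frame_row_norm i EE) (frame_row_norm i EE').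
  have tE : tau i = edot (row i E) (row i E') - 2 * edot (row i E') u / d * edot (row i E) u.
    by rewrite /tau reflE edotBr edotZr.
  rewrite tE -/rx -/ry.
  have NN : 0 < edot N N by rewrite edot_gt0.
  have NN' : 0 < edot N' N' by rewrite edot_gt0.
  rewrite (edotC (row i E) u) (edotC (row i E') u).
  have muE' : mu = d / (q x * q y) by rewrite -muE; field; rewrite !gt_eqF.
  rewrite muE'.
  move=> h; apply: le_trans h _; rewrite le_eqVlt; apply/orP; left; apply/eqP.
  move: (edot u N) (edot u N') (edot N N) (edot N' N') NN NN' (D2x i) (D2y i) (psi1 rx) (psi2 rx)
    (psi1 ry) (psi2 ry) (edot x _) (edot y _) (edot (row i E) _) (edot u _) (edot u _).
  move: (q x) (q y) (qx) (qy) => Q Q' Q0 Q'0.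
  move=> *; field; by rewrite !gt_eqF.
have hx := edot_pnormal xy.
have hy := @edot_pnormal y x (ltac:(by rewrite eq_sym)).
rewrite -/wx -/rx -/ry -/d in hx; rewrite -/wy -/rx -/ry edot_subC -/d in hy.
have Sx2 : \sum_i edot x (row i E) ^+ 2 = rx - edot x wx ^+ 2 / X.
  by rewrite expr2 -Esum; apply: eq_bigr => i _; rewrite expr2.
have wxM : wx *m refl u *m refl m = - (enorm wx *: ny).
  have -> : wx *m refl u *m refl m = enorm wx *: (n1 *m refl m).
    by rewrite {1}wxn /n1 -!scalemxAl.
  by rewrite n1m scalerN.
have Sy2 : \sum_i edot y (row i E') ^+ 2 = ry - edot y wy ^+ 2 / Y.
  transitivity (\sum_i edot (y *m refl m *m refl u) (row i E) * edot (y *m refl m *m refl u) (row i E)).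
    by apply: eq_bigr => i _; rewrite rowE' expr2 !edot_reflr.
  rewrite Esum !edot_refl -/X -(edot_reflr _ _ u) -(edot_reflr _ _ m) wxM edotNr edotZr.
  congr (_ - _); have pX : X = enorm wx ^+ 2 by rewrite enorm2.
  have pY : Y = enorm wy ^+ 2 by rewrite enorm2.
  have yw : edot y wy = enorm wy * edot y ny by rewrite {1}wyn edotZr.
  rewrite pX pY yw; move: (enorm wx) (enorm wy) px py (edot y ny) => p p' p0 p'0 k.
  by field; rewrite !gt_eqF.
pose c' := edot n1 ny.
have mm : edot m m = 2 + 2 * c' by rewrite !edotDl !edotDr n11 nyy (edotC ny) -/c'; ring.
have tauE i : tau i = 1 - 2 * edot (row i E) (m *m refl u) ^+ 2 / edot m m.
  have tw w : edot w (w *m refl m) = edot w w - 2 * edot w m ^+ 2 / edot m m.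
    by rewrite reflE edotBr edotZr; congr (_ - _); ring.
  by rewrite /tau rowE' edot_reflr tw edot_refl (frame_row_norm i EE) -edot_reflr.
(* By [Esum] only the tangential part of [m] counts; its squared norm is [edot m m - (1 + c') ^+ 2],
   where [edot m m = 2 + 2 * c']. *)
have tauS : n%:R - \sum_i tau i <= 1 - c'.
  under eq_bigr do rewrite tauE.
  rewrite sumrB sumr_const card_ord opprB addrC subrK.
  have [m0|m0] := eqVneq m 0.
    rewrite big1 => [|i _]; last by rewrite m0 edot0l invr0 mulr0.
    have : 2 + 2 * c' = 0 by rewrite -mm m0 edot0l.
    by clear; lra.
  have m1 : edot m m != 0 by rewrite edot_eq0.
  have -> : \sum_i 2 * edot (row i E) (m *m refl u) ^+ 2 / edot m m =
      2 / edot m m * \sum_i edot (m *m refl u) (row i E) * edot (m *m refl u) (row i E).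
    rewrite mulr_sumr; apply: eq_bigr => i _; rewrite (edotC (row i E)) expr2; ring.
  rewrite Esum edot_refl.
  have -> : edot (m *m refl u) wx = enorm wx * (1 + c').
    by rewrite -edot_reflr {1}wxn -scalemxAl -/n1 edotZr /m edotDl n11 (edotC ny).
  rewrite -(enorm2 wx); move: m1; rewrite mm => m1.
  rewrite le_eqVlt; apply/orP; left; apply/eqP.
  by move: (enorm wx) px => p p0; field; rewrite m1 gt_eqF.
set ee := edot e e.
(* By the inequality between arithmetic and geometric means of the squared lengths, the loss in the
   trace is bounded by the squared mismatch of the normals. *)
have eeE : 2 * ((1 - c') * (enorm wx * enorm wy)) <= ee.
  have -> : ee = enorm wx ^+ 2 + enorm wy ^+ 2 - 2 * (enorm wx * enorm wy * c').
    have xw : edot (wx *m refl u) wy = enorm wx * (enorm wy * c').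
      by rewrite {1}wxn {1}wyn -scalemxAl edotZl edotZr.
    by rewrite /ee /e edot_sub edot_refl -!enorm2 xw; ring.
  have := sqr_ge0 (enorm wx - enorm wy); move: (enorm wx) (enorm wy) => p p'.
  by clear; rewrite sqrrB mulr2n; lra.
have sI : 0 <= n%:R * (a ^+ 2 + b ^+ 2) - 2 * a * b * (\sum_i tau i)
   - d / q x * (n%:R * a * Dx * edot x wx + eps * a ^+ 2 * (n%:R * psi1 rx + 2 * psi2 rx * (rx - edot x wx ^+ 2 / X)))
   - d / q y * (n%:R * b * Dy * edot y wy + eps * b ^+ 2 * (n%:R * psi1 ry + 2 * psi2 ry * (ry - edot y wy ^+ 2 / Y))).
  pose K := a ^+ 2 + b ^+ 2 - d / q x * (eps * a ^+ 2 * psi1 rx) - d / q y * (eps * b ^+ 2 * psi1 ry).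
  have J : 0 <= \sum_i (K + (- (2 * a * b)) * tau i + (- (d / q x * lx * a ^+ 2 / 2)) * D2x i
     + (- (d / q x * eps * a ^+ 2 * 2 * psi2 rx)) * edot x (row i E) ^+ 2
     + (- (d / q y * ly * b ^+ 2 / 2)) * D2y i
     + (- (d / q y * eps * b ^+ 2 * 2 * psi2 ry)) * edot y (row i E') ^+ 2).
    apply: sumr_ge0 => i _; apply: le_trans (I i) _; rewrite le_eqVlt; apply/orP; left; apply/eqP.
    rewrite /K; move: (d / q x) (d / q y) (tau i) (D2x i) (D2y i) (psi1 rx) (psi2 rx)
      (psi1 ry) (psi2 ry) (edot x _) (edot y _).
    by clear; move=> *; field.
  rewrite sum_combination card_ord Sx2 Sy2 in J.
  have hxN : a * lx * (\sum_i D2x i) = 2 * n%:R * Dx * edot x wx.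
    transitivity (lx * (a * \sum_i D2x i)); first by ring.
    by rewrite trx [in RHS]ex edotZr; ring.
  have hyN : b * ly * (\sum_i D2y i) = 2 * n%:R * Dy * edot y wy.
    transitivity (ly * (b * \sum_i D2y i)); first by ring.
    by rewrite try [in RHS]ey edotZr; ring.
  apply: le_trans J _; rewrite le_eqVlt; apply/orP; left; apply/eqP.
  rewrite (_ : (- (d / q x * lx * a ^+ 2 / 2)) * (\sum_i D2x i) = - (d / q x * a / 2 * (a * lx * (\sum_i D2x i))));
    last by move: (d / q x) (\sum_i D2x i); clear; move=> *; field.
  rewrite (_ : (- (d / q y * ly * b ^+ 2 / 2)) * (\sum_i D2y i) = - (d / q y * b / 2 * (b * ly * (\sum_i D2y i))));
    last by move: (d / q y) (\sum_i D2y i); clear; move=> *; field.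
  rewrite hxN hyN /K.
  move: (edot x wx) (edot y wy) (d / q x) (d / q y) (\sum_i tau i) (psi1 rx) (psi2 rx)
      (psi1 ry) (psi2 ry) (rx - _) (ry - _).
  by clear; move=> *; field.
have brE : bracket (enorm x) (enorm y) = (a - b) ^+ 2 - (a * Dx - b * Dy) * (rx - ry).
  by rewrite /rx /ry -!enorm2 aE bE DxE DyE.
have exE : excess x wx = n%:R * (psi1 rx * a + Dx * (psi rx - 2 * rx * psi1 rx)) * X
    + 2 * a * psi2 rx * (rx * X - edot x wx ^+ 2).
  by rewrite aE DxE.
have eyE : excess y wy = n%:R * (psi1 ry * b + Dy * (psi ry - 2 * ry * psi1 ry)) * Y
    + 2 * b * psi2 ry * (ry * Y - edot y wy ^+ 2).
  by rewrite bE DyE.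
rewrite brE exE eyE.
(* Denominators are cleared, and the slack in the bound of the trace by [ee] is added. *)
have fin : 0 <= X * Y * q x * q y * (n%:R * (a ^+ 2 + b ^+ 2) - 2 * a * b * (\sum_i tau i)
   - d / q x * (n%:R * a * Dx * edot x wx + eps * a ^+ 2 * (n%:R * psi1 rx + 2 * psi2 rx * (rx - edot x wx ^+ 2 / X)))
   - d / q y * (n%:R * b * Dy * edot y wy + eps * b ^+ 2 * (n%:R * psi1 ry + 2 * psi2 ry * (ry - edot y wy ^+ 2 / Y))))
   + q x * q y * (a * b) * (ee * (enorm wx * enorm wy) - 2 * (n%:R - \sum_i tau i) * (X * Y)).
  apply: addr_ge0; first by rewrite mulr_ge0 // !mulr_ge0 // ltW.
  rewrite mulr_ge0 ?mulr_ge0 //; try exact: ltW.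
  have pp : 0 < enorm wx * enorm wy by rewrite mulr_gt0.
  have -> : X * Y = (enorm wx * enorm wy) * (enorm wx * enorm wy) by rewrite /X /Y -!enorm2; ring.
  rewrite subr_ge0 [leLHS]mulrA ler_pM2r //; apply: le_trans eeE.
  by rewrite -mulrA ler_pM2l // ler_pM2r.
apply: le_trans fin _; rewrite le_eqVlt; apply/orP; left; apply/eqP.
move: hx hy; set sx := edot x wx; set sy := edot y wy => hx hy.
have hxd : d * sx = q x * (rx - ry) + d * eps * (psi rx - 2 * rx * psi1 rx).
  by rewrite hx; move: dd; clear; move: d (q x) (psi rx) (psi1 rx) => *; field; rewrite gt_eqF.
have hyd : d * sy = q y * (ry - rx) + d * eps * (psi ry - 2 * ry * psi1 ry).
  by rewrite hy; move: dd; clear; move: d (q y) (psi ry) (psi1 ry) => *; field; rewrite gt_eqF.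
move: hxd hyd qx qy X0 Y0; clear.
move: (\sum_i tau i) (enorm wx * enorm wy) => T w.
clearbody X Y d rx ry ee sx sy.
move: (q x) (q y) (psi rx) (psi1 rx) (psi2 rx) (psi ry) (psi1 ry) (psi2 ry).
move=> Q Q' p p1 p2 p' p1' p2' hx hy Q0 Q'0 X0 Y0.
have -> : d / Q * (n%:R * a * Dx * sx + eps * a ^+ 2 * (n%:R * p1 + 2 * p2 * (rx - sx ^+ 2 / X))) =
  (n%:R * a * Dx * (d * sx) + d * (eps * a ^+ 2 * (n%:R * p1 + 2 * p2 * (rx - sx ^+ 2 / X)))) / Q.
  by field; rewrite !gt_eqF.
have -> : d / Q' * (n%:R * b * Dy * sy + eps * b ^+ 2 * (n%:R * p1' + 2 * p2' * (ry - sy ^+ 2 / Y))) =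
  (n%:R * b * Dy * (d * sy) + d * (eps * b ^+ 2 * (n%:R * p1' + 2 * p2' * (ry - sy ^+ 2 / Y)))) / Q'.
  by field; rewrite !gt_eqF.
by rewrite hx hy; field; rewrite !gt_eqF.
Qed.

End PairInequality.

(** * Limits of critical pairs *)

Section CompactSublevel.
Variable R : realType.

(** [f] is continuous at points of [K] only, so the set where it is nonnegative need not be closed;
    a cluster point found in [K] is examined directly. *)
Lemma compact_sublevel (T : topologicalType) (K : set T) (f : T -> R) : compact K ->
  (forall x, K x -> {for x, continuous f}) -> compact (K `&` [set x | 0 <= f x]).
Proof.
move=> cK cf F PF FK.
have FK1 : F K by apply: filterS FK => x [].
have [p [Kp clp]] := cK F PF FK1.
exists p; split=> //; split=> //=.
rewrite leNgt; apply/negP => fp.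
have nb : nbhs p [set x | f x < 0] by apply: (cvgr_lt (f p) (cf p Kp)).
by have [x [[_ /= h1] /= h2]] := clp _ _ FK nb; move: h2; rewrite ltNge h1.
Qed.

(* If the two inequalities have a solution for every small positive parameter, then they have
   one for the parameter [0]: the set of solutions is compact, so the parameter has a minimum on
   it. *)
Lemma limit_parameter (T : topologicalType) (K : set T) (h1 h2 : T * R -> R) (e : R) : compact K -> 0 < e ->
  (forall x t, K x -> 0 <= t -> t <= e -> {for (x, t), continuous h1}) ->
  (forall x t, K x -> 0 <= t -> t <= e -> {for (x, t), continuous h2}) ->
  (forall t, 0 < t -> t <= e -> exists2 x, K x & 0 <= h1 (x, t) /\ 0 <= h2 (x, t)) ->
  exists2 x, K x & 0 <= h1 (x, 0) /\ 0 <= h2 (x, 0).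
Proof.
move=> cK e0 c1 c2 sol.
pose C := ((K `*` `[0, e]%classic) `&` [set z | 0 <= h1 z]) `&` [set z | 0 <= h2 z].
have inC x t : C (x, t) -> [/\ K x, 0 <= t, t <= e, 0 <= h1 (x, t) & 0 <= h2 (x, t)].
  by move=> [[[/= Kx]]]; rewrite in_itv /= => /andP[t0 te] ? ?.
have cC : compact C.
  apply: (@compact_sublevel _ _ h2); last first.
    by move=> [x t] [[/= Kx]]; rewrite in_itv /= => /andP[t0 te] _; exact: c2.
  apply: (@compact_sublevel _ _ h1); last first.
    by move=> [x t] [/= Kx]; rewrite in_itv /= => /andP[t0 te]; exact: c1.
  by apply: compact_setX => //; exact: segment_compact.
have mem t : 0 < t -> t <= e -> exists x, C (x, t).
  move=> t0 te; have [x Kx [a b]] := sol t t0 te; exists x; split=> //; split=> //.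
  by split=> //=; rewrite in_itv /= te ltW.
have [x0 Cx0] := mem e e0 (lexx _).
have [||[x t] Cxt tmin] := @compact_argmin R _ C snd _ cC.
- by exists (x0, e).
- by move=> z _; exact: cvg_snd.
have [Kx t0 te a b] := inC _ _ Cxt.
have [t00|tp] := eqVneq t 0; first by rewrite t00 in a b; exists x.
have tp' : 0 < t by rewrite lt_def tp.
have [|y Cy] := mem (t / 2) (divr_gt0 tp' (ltr0Sn _ _)); first by lra.
by have /= := tmin _ Cy; lra.
Qed.

End CompactSublevel.

Section Localization.
Variables (R : realType) (n : nat).
Implicit Types (S : set 'rV[R]_n.+1) (c x y : 'rV[R]_n.+1).

Lemma continuous_fst (T U V : topologicalType) (f : T -> V) (z : T * U) :
  {for z.1, continuous f} -> {for z, continuous (fun z => f z.1)}.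
Proof. by move=> cf; exact: (@cvg_comp _ _ _ fst f _ _ _ (@cvg_fst _ _ _ _ _) cf). Qed.

Lemma continuous_snd (T U V : topologicalType) (f : U -> V) (z : T * U) :
  {for z.2, continuous f} -> {for z, continuous (fun z => f z.2)}.
Proof. by move=> cf; exact: (@cvg_comp _ _ _ snd f _ _ _ (@cvg_snd _ _ _ _ _) cf). Qed.

Lemma dist_continuous (z : 'rV[R]_n.+1 * 'rV[R]_n.+1) :
  {for z, continuous (fun w : 'rV[R]_n.+1 * 'rV[R]_n.+1 => edot (w.1 - w.2) (w.1 - w.2))}.
Proof.
have h : (fun w : 'rV[R]_n.+1 * 'rV[R]_n.+1 => w.1 - w.2) @ z --> z.1 - z.2.
  apply: (@cvgB _ _ _ (nbhs z) (nbhs_filter z)); [exact: cvg_fst | exact: cvg_snd].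
exact: (@edot_cvg R _ n (nbhs z) (nbhs_filter z) _ _ _ _ h h).
Qed.

(** [m] is fixed before [psi] and [eps], so the weight may be adapted to the region [m <= edot c x].
    Comparison with the fixed pair [(p, p')] bounds the quotient at the minimum; as distances are
    bounded below and [q] above, both values of [q] are bounded below. *)
Lemma localization S S' c m0 : compact S -> compact S' -> 0 < m0 ->
  (forall x, S x -> S' x -> edot c x <= - m0) ->
  (exists2 x, S x & 0 < edot c x) -> (exists2 x, S' x & 0 < edot c x) ->
  exists m, [/\ 0 < m, exists2 x, S x & m <= edot c x &
   forall (psi : R -> R) (B : R), 0 < B -> (forall r, {for r, continuous psi}) ->
     (forall r, 0 <= r -> 0 < psi r) ->
     (forall x, S x \/ S' x -> psi (edot x x) <= B) ->
     exists2 e, 0 < e & forall eps, 0 < eps -> eps <= e ->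
       let q := test psi c eps in
       exists z, [/\ S z.1 /\ S' z.2, m <= edot c z.1 /\ m <= edot c z.2, z.1 != z.2,
        0 < q z.1 /\ 0 < q z.2 &
        \forall w \near z, S w.1 -> S' w.2 -> 0 <= edot (w.1 - w.2) (w.1 - w.2) -
          edot (z.1 - z.2) (z.1 - z.2) / (q z.1 * q z.2) * (q w.1 * q w.2)]].
Proof.
move=> cS cS' m00 sep [p Sp pc] [p' Sp' pc'].
pose T := ('rV[R]_n.+1 * 'rV[R]_n.+1)%type.
pose dd (z : T) := edot (z.1 - z.2) (z.1 - z.2).
have cSS : compact (S `*` S') by exact: compact_setX.
(* Once [eps * B <= m0 / 2], all pairs with nonnegative values of [q] lie in this fixed compact set,
   and by [sep] its pairs consist of distinct points. *)
pose K0 : set T := ((S `*` S') `&` [set z | 0 <= edot c z.1 + m0 / 2]) `&` [set z | 0 <= edot c z.2 + m0 / 2].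
have lin1 (z : T) : {for z, continuous (fun z : T => edot c z.1 + m0 / 2)}.
  apply: (@continuousD _ _ _ (fun z : T => edot c z.1)); last exact: cst_continuous.
  by apply: continuous_fst; exact: edot_continuous.
have lin2 (z : T) : {for z, continuous (fun z : T => edot c z.2 + m0 / 2)}.
  apply: (@continuousD _ _ _ (fun z : T => edot c z.2)); last exact: cst_continuous.
  by apply: continuous_snd; exact: edot_continuous.
have cK0 : compact K0.
  by apply: compact_sublevel => //; apply: compact_sublevel.
have K0p : K0 (p, p').
  by split; [split|] => //=; rewrite addr_ge0 // ?divr_ge0 // ltW.
have K0d z : K0 z -> 0 < dd z.
  move=> [[[/= Sz S'z] z1] z2]; rewrite /dd edot_gt0 subr_eq0; apply/eqP => e.
  have := sep z.1 Sz; rewrite {1}e => /(_ S'z); move: z1; rewrite /=; move: m00; lra.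
have [d0 d00 d0P] := compact_pos (ex_intro _ _ K0p) cK0 (fun z _ => @dist_continuous z) K0d.
(* The reciprocal of the functional at [(p, p')] without weight; a positive weight can only increase
   it. *)
pose th := edot c p * edot c p' / dd (p, p').
have th0 : 0 < th by rewrite divr_gt0 ?mulr_gt0 ?K0d.
have [Q1 Q10 Q1P] := compact_bounded (ex_intro _ _ Sp) cS (fun x _ => @edot_continuous R n c x).
have [Q2 Q20 Q2P] := compact_bounded (ex_intro _ _ Sp') cS' (fun x _ => @edot_continuous R n c x).
pose Q := Q1 + Q2 + 1.
have Q0 : 0 < Q by rewrite !addr_gt0.
(* Chosen to give [q >= 2 * m] at the minimum; one [m] is then spent on the weight. *)
pose m := Num.min (th * d0 / (2 * Q)) (edot c p).
have m_gt0 : 0 < m by rewrite lt_min pc andbT divr_gt0 // mulr_gt0.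
have mQ : 2 * m * Q <= th * d0.
  have : m <= th * d0 / (2 * Q) by rewrite ge_min lexx.
  rewrite ler_pdivlMr; last by rewrite mulr_gt0.
  by rewrite [m * _]mulrA (mulrC m).
exists m; split=> //; first by exists p => //; rewrite ge_min lexx orbT.
move=> psi B B0 psic psi0 psiB.
clearbody m; have mm : 0 < Num.min (m0 / 2) (Num.min 1 m) by rewrite !lt_min m_gt0 divr_gt0 //= ltr01.
exists (Num.min (m0 / 2) (Num.min 1 m) / B); first by rewrite divr_gt0.
move=> eps eps0 epsB q.
have epsB' : eps * B <= Num.min (m0 / 2) (Num.min 1 m) by rewrite -ler_pdivlMr.
have eB1 : eps * B <= m0 / 2 by apply: le_trans epsB' _; rewrite ge_min lexx.
have eB2 : eps * B <= 1 by apply: le_trans epsB' _; rewrite !ge_min lexx orbT.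
have eB3 : eps * B <= m by apply: le_trans epsB' _; rewrite !ge_min lexx !orbT.
have qlo x : edot c x < q x.
  by rewrite /q /test ltrDl mulr_gt0 // psi0 // edot_ge0.
have qhi x : S x \/ S' x -> q x <= edot c x + eps * B.
  by move=> Sx; rewrite /q /test lerD2l ler_pM2l // psiB.
have qQ x : S x \/ S' x -> q x <= Q.
  move=> Sx; apply: le_trans (qhi x Sx) _; apply: lerD => //.
  case: Sx => h; [have := Q1P x h | have := Q2P x h]; move=> hh;
    apply: le_trans (ler_norm _) _; apply: le_trans hh _; [by rewrite lerDl ltW | by rewrite lerDr ltW].
have cq (x : 'rV[R]_n.+1) : {for x, continuous q} by exact: test_continuous.
pose K : set T := ((S `*` S') `&` [set z | 0 <= q z.1]) `&` [set z | 0 <= q z.2].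
have cq1 (z : T) : {for z, continuous (fun z : T => q z.1)} by apply: continuous_fst; exact: cq.
have cq2 (z : T) : {for z, continuous (fun z : T => q z.2)} by apply: continuous_snd; exact: cq.
have cK : compact K by apply: compact_sublevel => //; apply: compact_sublevel.
have KK0 z : K z -> K0 z.
  move=> [[[/= Sz S'z] z1] z2]; split; [split|] => //=.
    by have := qhi z.1 (or_introl Sz); move: z1; rewrite /=; lra.
  by have := qhi z.2 (or_intror S'z); move: z2; rewrite /=; lra.
have Kp : K (p, p').
  by split; [split|] => //=; apply: le_trans (ltW (qlo _)); exact: ltW.
(* The reciprocal of the functional is maximised, since it remains continuous where [q] vanishes. *)
have [|z Kz zmin] := @compact_argmin R _ K (fun z => - (q z.1 * q z.2 / dd z)) (ex_intro _ _ Kp) cK.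
  move=> z Kz; apply: continuousN; apply: continuousM; first exact: continuousM.
  by apply: continuousV; [rewrite gt_eqF // K0d //; exact: KK0 | exact: dist_continuous].
have dz := K0d z (KK0 z Kz).
have [[[/= Sz S'z] q1 q2]] := Kz.
rewrite /= in q1 q2.
have big : th <= q z.1 * q z.2 / dd z.
  have := zmin _ Kp; rewrite lerN2 => h; apply: le_trans h.
  rewrite /th ler_pM2r ?invr_gt0 ?K0d //.
  by apply: ler_pM; rewrite ?ltW.
have qq : th * d0 <= q z.1 * q z.2.
  move: big; rewrite ler_pdivlMr // => h; apply: le_trans h.
  by rewrite ler_pM2l // d0P //; exact: KK0.
have Qz1 := qQ z.1 (or_introl Sz); have Qz2 := qQ z.2 (or_intror S'z).
have z1m : 2 * m <= q z.1.
  rewrite -(ler_pM2r Q0); apply: le_trans mQ _; apply: le_trans qq _.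
  by apply: ler_wpM2l.
have z2m : 2 * m <= q z.2.
  rewrite -(ler_pM2r Q0); apply: le_trans mQ _; apply: le_trans qq _.
  by rewrite mulrC; apply: ler_wpM2l.
have q1p : 0 < q z.1 by apply: lt_le_trans z1m; rewrite mulr_gt0.
have q2p : 0 < q z.2 by apply: lt_le_trans z2m; rewrite mulr_gt0.
exists z; split=> //.
- have := qhi z.1 (or_introl Sz); have := qhi z.2 (or_intror S'z).
  by split; lra.
- by rewrite -subr_eq0 -edot_gt0.
have n1 : \forall w \near z, 0 < q w.1 by apply: (cvgr_gt (q z.1) (cq1 z)).
have n2 : \forall w \near z, 0 < q w.2 by apply: (cvgr_gt (q z.2) (cq2 z)).
near=> w; move=> Sw S'w.
have w1 : 0 < q w.1 by near: w.
have w2 : 0 < q w.2 by near: w.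
have Kw : K w by split; [split|] => //=; exact: ltW.
have dw := K0d w (KK0 w Kw).
have := zmin w Kw; rewrite lerN2 ler_pdivrMr // => h.
rewrite subr_ge0 -/(dd w) -/(dd z).
have qp : 0 < q z.1 * q z.2 by rewrite mulr_gt0.
rewrite mulrAC ler_pdivrMr //.
apply: le_trans (_ : dd z * (q z.1 * q z.2 / dd z * dd w) <= _); first by rewrite ler_pM2l.
rewrite le_eqVlt; apply/orP; left; apply/eqP; field; by rewrite gt_eqF.
Unshelve. all: by end_near. Qed.

End Localization.

Section ContinuityAt.
Variables (R : realType) (T : topologicalType) (z0 : T).

Definition cont_at (V : topologicalType) (f : T -> V) := f z @[z --> z0] --> f z0.

Let FF : Filter (nbhs z0) := nbhs_filter z0.

Lemma cont_cst (V : topologicalType) (a : V) : cont_at (fun=> a).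
Proof. exact: (@cvg_cst _ a _ (nbhs z0) FF). Qed.

Section Scalars.
Variables f h : T -> R.
Hypotheses (cf : cont_at f) (ch : cont_at h).

Lemma cont_add : cont_at (fun z => f z + h z).
Proof. exact: (@cvgD _ _ _ (nbhs z0) FF _ _ _ _ cf ch). Qed.

Lemma cont_sub : cont_at (fun z => f z - h z).
Proof. exact: (@cvgB _ _ _ (nbhs z0) FF _ _ _ _ cf ch). Qed.

Lemma cont_mul : cont_at (fun z => f z * h z).
Proof. exact: (@cvgM _ _ (nbhs z0) FF _ _ _ _ cf ch). Qed.

Lemma cont_div : h z0 != 0 -> cont_at (fun z => f z / h z).
Proof.
move=> h0; have cV : (fun z => (h z)^-1) @ z0 --> (h z0)^-1 by apply: cvgV.
exact: (@cvgM _ _ (nbhs z0) FF _ _ _ _ cf cV).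
Qed.

End Scalars.

Lemma cont_comp (U V : topologicalType) (F : U -> V) (f : T -> U) : cont_at f ->
  {for f z0, continuous F} -> cont_at (fun z => F (f z)).
Proof. by move=> cf cF; exact: (@cvg_comp _ _ _ f F _ _ _ cf cF). Qed.

Section Vectors.
Variable n : nat.
Variables (X Y : T -> 'rV[R]_n.+1) (k : T -> R).
Hypotheses (cX : cont_at X) (cY : cont_at Y) (ck : cont_at k).

Lemma cont_addv : cont_at (fun z => X z + Y z).
Proof. exact: (@cvgD _ _ _ (nbhs z0) FF _ _ _ _ cX cY). Qed.

Lemma cont_subv : cont_at (fun z => X z - Y z).
Proof. exact: (@cvgB _ _ _ (nbhs z0) FF _ _ _ _ cX cY). Qed.

Lemma cont_scalev : cont_at (fun z => k z *: X z).
Proof. exact: (@cvgZ _ _ _ (nbhs z0) FF _ _ _ _ ck cX). Qed.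

Lemma cont_edot : cont_at (fun z => edot (X z) (Y z)).
Proof. exact: (@edot_cvg R _ n (nbhs z0) FF _ _ _ _ cX cY). Qed.

Lemma cont_enorm : cont_at (fun z => enorm (X z)).
Proof. exact: (@enorm_cvg R _ n (nbhs z0) FF _ _ cX). Qed.

End Vectors.
End ContinuityAt.

Section PairContinuity.
Variables (R : realType) (n : nat) (phi : R -> R) (rbar r0 : \bar R).
Hypothesis sm : smooth_metric_on (oball rbar `|` cball r0) (conformal_metric n phi).
Local Notation slope := (@slope R n phi).
Local Notation conf := (conf phi).
Local Notation bracket := (@bracket R n phi).
Variables (psi psi1 psi2 : R -> R).
Hypothesis (cpsi : forall r, {for r, continuous psi}) (cpsi1 : forall r, {for r, continuous psi1})
  (cpsi2 : forall r, {for r, continuous psi2}).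
Variable c : 'rV[R]_n.+1.
Variables (T : topologicalType) (z0 : T) (X Y : T -> 'rV[R]_n.+1) (e : T -> R).
Hypotheses (cX : cont_at z0 X) (cY : cont_at z0 Y) (ce : cont_at z0 e).
Local Notation excess := (excess psi psi1 psi2 phi).

Lemma cont_test : cont_at z0 (fun z => test psi c (e z) (X z)).
Proof.
apply: cont_add; first by apply: cont_edot => //; exact: cont_cst.
apply: cont_mul => //; apply: (@cont_comp _ _ _ _ psi (fun z => edot (X z) (X z))) => //.
exact: cont_edot.
Qed.

Lemma cont_dtest : cont_at z0 (fun z => dtest psi1 c (e z) (X z)).
Proof.
apply: cont_addv; first exact: cont_cst.
apply: cont_scalev => //; apply: cont_mul.
  by apply: cont_mul => //; exact: cont_cst.
apply: (@cont_comp _ _ _ _ psi1 (fun z => edot (X z) (X z))) => //.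
exact: cont_edot.
Qed.

Lemma cont_pnormal : X z0 != Y z0 -> cont_at z0 (fun z => pnormal psi psi1 c (e z) (X z) (Y z)).
Proof.
move=> xy; have cu : cont_at z0 (fun z => X z - Y z) by exact: cont_subv.
apply: cont_subv; last exact: cont_dtest.
apply: cont_scalev => //; apply: cont_div; first by apply: cont_mul; [exact: cont_cst | exact: cont_test].
  exact: cont_edot.
by rewrite edot_eq0 subr_eq0.
Qed.

Lemma cont_conf : X z0 != 0 -> ((enorm (X z0))%:E <= r0)%E -> cont_at z0 (fun z => conf (enorm (X z))).
Proof.
move=> x0 xr; apply: (@cont_comp _ _ _ _ conf (fun z => enorm (X z))); first exact: cont_enorm.
by apply: (conf_continuous sm) => //; rewrite enorm_gt0.
Qed.

Lemma cont_slope : X z0 != 0 -> ((enorm (X z0))%:E <= r0)%E -> cont_at z0 (fun z => slope (enorm (X z))).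
Proof.
move=> x0 xr; apply: (@cont_comp _ _ _ _ slope (fun z => enorm (X z))); first exact: cont_enorm.
by apply: (slope_continuous sm) => //; rewrite enorm_gt0.
Qed.

Lemma cont_sqr (f : T -> R) : cont_at z0 f -> cont_at z0 (fun z => f z ^+ 2).
Proof.
move=> cf; have -> : (fun z => f z ^+ 2) = (fun z => f z * f z) by apply/funext => z; exact: expr2.
exact: cont_mul.
Qed.

Lemma cont_excess (W : T -> 'rV[R]_n.+1) : cont_at z0 W -> X z0 != 0 ->
  ((enorm (X z0))%:E <= r0)%E -> cont_at z0 (fun z => excess (X z) (W z)).
Proof.
move=> cW x0 xr.
have cr : cont_at z0 (fun z => edot (X z) (X z)) by exact: cont_edot.
have cA := cont_conf x0 xr; have cD := cont_slope x0 xr.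
have c0 : cont_at z0 (fun z => psi (edot (X z) (X z))) by apply: (@cont_comp _ _ _ _ psi) => //.
have c1 : cont_at z0 (fun z => psi1 (edot (X z) (X z))) by apply: (@cont_comp _ _ _ _ psi1) => //.
have c2 : cont_at z0 (fun z => psi2 (edot (X z) (X z))) by apply: (@cont_comp _ _ _ _ psi2) => //.
have cw : cont_at z0 (fun z => edot (W z) (W z)) by exact: cont_edot.
have cxw : cont_at z0 (fun z => edot (X z) (W z)) by exact: cont_edot.
apply: cont_add.
  apply: cont_mul => //; apply: cont_mul; first exact: cont_cst.
  apply: cont_add; first exact: cont_mul.
  apply: cont_mul => //; apply: cont_sub => //; apply: cont_mul => //.
  by apply: cont_mul => //; exact: cont_cst.
apply: cont_mul; first by apply: cont_mul => //; apply: cont_mul => //; exact: cont_cst.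
by apply: cont_sub; [exact: cont_mul | exact: cont_sqr].
Qed.

Lemma cont_bracket : X z0 != 0 -> ((enorm (X z0))%:E <= r0)%E ->
  Y z0 != 0 -> ((enorm (Y z0))%:E <= r0)%E ->
  cont_at z0 (fun z => slope (enorm (Y z))) -> cont_at z0 (fun z => conf (enorm (Y z))) ->
  cont_at z0 (fun z => bracket (enorm (X z)) (enorm (Y z))).
Proof.
move=> x0 xr y0 yr cD' cA'.
have cA := cont_conf x0 xr; have cD := cont_slope x0 xr.
apply: cont_sub; first by apply: cont_sqr; exact: cont_sub.
apply: cont_mul; first by apply: cont_sub; exact: cont_mul.
by apply: cont_sub; apply: cont_sqr; exact: cont_enorm.
Qed.

End PairContinuity.

Section Defect.
Variables (R : realType) (n : nat) (psi psi1 : R -> R) (c : 'rV[R]_n.+1).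
Implicit Types x y : 'rV[R]_n.+1.

(* The failure, to first order in the parameter, of the reflection exchanging [x] and [y] to
   exchange the normals. *)
Definition defect x y : 'rV[R]_n.+1 :=
  (2 * psi1 (edot y y)) *: y - (2 * psi1 (edot x x)) *: x
  + (2 / edot (x - y) (x - y) *
      (2 * psi1 (edot x x) * edot x (x - y) - (psi (edot x x) - psi (edot y y)))) *: (x - y).

(** For [eps = 0] the reflection exchanges the normals exactly, and both normals are affine in
    [eps]. The mismatch in [pair_inequality] is thus linear in [eps], and its square carries
    [eps ^+ 2]. *)
Lemma pnormal_defect eps x y : x != y ->
  pnormal psi psi1 c eps x y *m refl (x - y) - pnormal psi psi1 c eps y x = eps *: defect x y.
Proof.
move=> xy; have dd : edot (x - y) (x - y) != 0 by rewrite edot_eq0 subr_eq0.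
rewrite reflE.
have -> : edot (pnormal psi psi1 c eps x y) (x - y) = 2 * test psi c eps x -
    (edot c (x - y) + 2 * eps * psi1 (edot x x) * edot x (x - y)).
  rewrite /pnormal [LHS]edotBl edotZl divfK //; congr (_ - _).
  by rewrite /dtest [LHS]edotDl edotZl.
have -> : edot c (x - y) = edot c x - edot c y by rewrite edotBr.
rewrite /pnormal (edot_subC x y) /dtest /defect /test.
move: (edot (x - y) (x - y)) dd (edot x (x - y)) (edot c x) (edot c y) (psi (edot x x))
  (psi (edot y y)) (psi1 (edot x x)) (psi1 (edot y y)) => d d0 a b b' p p' p1 p1'.
apply/rowP => i; rewrite !mxE; by field.
Qed.

Lemma pnormal0 x y : pnormal psi psi1 c 0 x y = (2 * edot c x / edot (x - y) (x - y)) *: (x - y) - c.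
Proof. by rewrite /pnormal /test /dtest mulr0 !mul0r scale0r !addr0. Qed.

(** Shows that the normals do not degenerate in the limit as long as both points lie in the open
    half space. *)
Lemma edot_pnormal0 x y : x != y -> edot (pnormal psi psi1 c 0 x y) (pnormal psi psi1 c 0 x y) =
  edot c c + 4 * edot c x * edot c y / edot (x - y) (x - y).
Proof.
move=> xy; have dd : edot (x - y) (x - y) != 0 by rewrite edot_eq0 subr_eq0.
rewrite pnormal0 [LHS]edot_sub !edotZl !edotZr (edotC (x - y) c).
have -> : edot c (x - y) = edot c x - edot c y by rewrite edotBr.
by move: (edot (x - y) (x - y)) dd (edot c c) (edot c x) (edot c y) => d d0 *; field.
Qed.

End Defect.

Lemma near_pair1 (T U : topologicalType) (x : T) (y : U) (P : T * U -> Prop) :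
  (\forall w \near (x, y), P w) -> \forall z \near x, P (z, y).
Proof.
move=> [[A B] [/= nA nB] sub]; apply: filterS nA => z Az; apply: (sub (z, y)).
by split=> //=; exact: nbhs_singleton nB.
Qed.

Lemma near_pair2 (T U : topologicalType) (x : T) (y : U) (P : T * U -> Prop) :
  (\forall w \near (x, y), P w) -> \forall z \near y, P (x, z).
Proof.
move=> [[A B] [/= nA nB] sub]; apply: filterS nB => z Az; apply: (sub (x, z)).
by split=> //=; exact: nbhs_singleton nA.
Qed.

(** * The limit pair and the contradiction *)

Section Separation.
Variables (R : realType) (n : nat) (phi : R -> R) (rbar r0 : \bar R).
Hypothesis n_gt0 : (0 < n)%N.
Hypothesis sm : smooth_metric_on (oball rbar `|` cball r0) (conformal_metric n phi).
Local Notation slope := (@slope R n phi).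
Local Notation conf := (conf phi).
Local Notation bracket := (@bracket R n phi).
Local Notation g := (conformal_metric n phi).
Variables S S' : set 'rV[R]_n.+1.
Hypotheses (fbm : compact_free_boundary_minimal g r0 S) (fbm' : compact_free_boundary_minimal g r0 S').
Variables (c : 'rV[R]_n.+1) (m : R).
Hypothesis m_gt0 : 0 < m.
Implicit Types x y : 'rV[R]_n.+1.

Let U x := (S x \/ S' x) /\ m <= edot c x.

Let U_neq0 x : U x -> x != 0.
Proof.
by move=> [_ mx]; apply: contraTneq mx => ->; rewrite edot0r -ltNge.
Qed.

Let U_norm x : U x -> ((enorm x)%:E <= r0)%E.
Proof.
have [_ _ [Sr _] _ _] := fbm; have [_ _ [Sr' _] _ _] := fbm'.
by move=> [[Sx|Sx] _]; [exact: Sr | exact: Sr'].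
Qed.

Section Weight.
Variables (psi psi1 psi2 : R -> R).
Hypothesis psi_jet : forall r, jet2 (fun t => psi (r + t)) (psi r) (psi1 r) (psi2 r / 2).
Hypothesis (cpsi1 : forall r, {for r, continuous psi1}) (cpsi2 : forall r, {for r, continuous psi2}).
Hypothesis psi_conv : forall x, S x \/ S' x -> 0 < psi (edot x x) - 2 * edot x x * psi1 (edot x x).
Hypothesis bracket_le0 : forall x y, U x -> U y -> bracket (enorm x) (enorm y) <= 0.
Hypothesis excess_gt0 : forall x y, U x -> U y -> x != y ->
  0 <= bracket (enorm x) (enorm y) -> 0 < excess psi psi1 psi2 phi x (pnormal psi psi1 c 0 x y).
Variable e : R.
Hypothesis e_gt0 : 0 < e.
Hypothesis localized : forall eps, 0 < eps -> eps <= e ->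
  let q := test psi c eps in
  exists z, [/\ S z.1 /\ S' z.2, m <= edot c z.1 /\ m <= edot c z.2, z.1 != z.2,
   0 < q z.1 /\ 0 < q z.2 &
   \forall w \near z, S w.1 -> S' w.2 -> 0 <= edot (w.1 - w.2) (w.1 - w.2) -
     edot (z.1 - z.2) (z.1 - z.2) / (q z.1 * q z.2) * (q w.1 * q w.2)].
Hypothesis disjoint : forall x, S x -> S' x -> m <= edot c x -> False.

Let T := ('rV[R]_n.+1 * 'rV[R]_n.+1)%type.
Local Notation q := (test psi c).
Local Notation nor := (pnormal psi psi1 c).
Local Notation exc := (excess psi psi1 psi2 phi).

Let lower_terms (w : T * R) : R :=
  conf (enorm w.1.1) * exc w.1.1 (nor w.2 w.1.1 w.1.2)
      * edot (nor w.2 w.1.2 w.1.1) (nor w.2 w.1.2 w.1.1) * q w.2 w.1.2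
  + conf (enorm w.1.2) * exc w.1.2 (nor w.2 w.1.2 w.1.1)
      * edot (nor w.2 w.1.1 w.1.2) (nor w.2 w.1.1 w.1.2) * q w.2 w.1.1.

(** What is left of the inequality after dropping the nonpositive bracket term and dividing by the
    parameter. At parameter [0] it still carries information on the excess, which [h1] has lost. *)
Let h2 (w : T * R) : R :=
  w.2 * (conf (enorm w.1.1) * conf (enorm w.1.2)
    * edot (defect psi psi1 w.1.1 w.1.2) (defect psi psi1 w.1.1 w.1.2)
    * (enorm (nor w.2 w.1.1 w.1.2) * enorm (nor w.2 w.1.2 w.1.1)) * q w.2 w.1.1 * q w.2 w.1.2)
  - edot (w.1.1 - w.1.2) (w.1.1 - w.1.2) * lower_terms w.

(* [h1] is the right hand side of [pair_inequality], with the parameter as third variable. *)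
Let h1 (w : T * R) : R :=
  n%:R * bracket (enorm w.1.1) (enorm w.1.2)
    * edot (nor w.2 w.1.1 w.1.2) (nor w.2 w.1.1 w.1.2)
    * edot (nor w.2 w.1.2 w.1.1) (nor w.2 w.1.2 w.1.1) * q w.2 w.1.1 * q w.2 w.1.2
  + w.2 * h2 w.

Let K (z : T) := [/\ S z.1, S' z.2, m <= edot c z.1 & m <= edot c z.2].

Let KU z : K z -> U z.1 /\ U z.2.
Proof. by move=> [a b d f]; split; split => //; [left | right]. Qed.

Let K_neq z : K z -> z.1 != z.2.
Proof. by move=> [a b d f]; apply/eqP => eq; apply: (disjoint a) => //; rewrite eq. Qed.

Let K_compact : compact K.
Proof.
have [_ cS _ _ _] := fbm; have [_ cS' _ _ _] := fbm'.
have -> : K = ((S `*` S') `&` [set z | 0 <= edot c z.1 - m]) `&` [set z | 0 <= edot c z.2 - m].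
  apply/seteqP; split => z /=; rewrite !subr_ge0.
    by move=> [a b d f]; split => //; split.
  by move=> [[[a b] d] f].
apply: compact_sublevel; last first.
  move=> z _; apply: continuousB; last exact: cst_continuous.
  by apply: continuous_snd; exact: edot_continuous.
apply: compact_sublevel; last first.
  move=> z _; apply: continuousB; last exact: cst_continuous.
  by apply: continuous_fst; exact: edot_continuous.
exact: compact_setX.
Qed.

Let cpsi r : {for r, continuous psi} := jet_continuous (psi_jet r).

Let solution t : 0 < t -> t <= e -> exists2 z, K z & 0 <= h1 (z, t) /\ 0 <= h2 (z, t).
Proof.
move=> t0 te; have [[x y] [[/= Sx S'y] [mx my] /= xy [qx qy] near_min]] := localized t0 te.
have Kz : K (x, y) by split.
have [Ux Uy] := KU Kz; rewrite /= in Ux Uy.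
have [_ _ _ mS _] := fbm; have [_ _ _ mS' _] := fbm'.
set mu := _ / _ in near_min.
have muE : mu * (q t x * q t y) = edot (x - y) (x - y) by rewrite divfK // mulf_neq0 // gt_eqF.
have [f ic] : exists f, interior_chart S x f.
  apply: (pair_boundary psi_jet fbm Sx (U_norm Uy) qx muE xy t0 (psi_conv (or_introl Sx))).
  by apply: filterS (near_pair1 near_min) => z h Sz; apply: h.
have [f' ic'] : exists f, interior_chart S' y f.
  have muE' : mu * (q t y * q t x) = edot (y - x) (y - x) by rewrite (mulrC (q t y)) muE -edot_subC.
  have yx : y != x by rewrite eq_sym.
  apply: (pair_boundary psi_jet fbm' S'y (U_norm Ux) qy muE' yx t0 (psi_conv (or_intror S'y))).
  apply: filterS (near_pair2 near_min) => z h Sz.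
  by rewrite -edot_subC (mulrC (q t z)); apply: h.
exists (x, y) => //.
have ineq := pair_inequality sm psi_jet mS mS' Sx S'y (U_neq0 Ux) (U_neq0 Uy) xy (U_norm Ux)
  (U_norm Uy) ic ic' qx qy muE near_min.
have h1_ge0 : 0 <= h1 ((x, y), t).
  apply: le_trans ineq _; rewrite le_eqVlt; apply/orP; left; apply/eqP.
  rewrite (pnormal_defect psi psi1 c t xy) edotZl edotZr /h1 /h2 /lower_terms /=.
  move: (exc x _) (exc y _) (edot (defect _ _ _ _) _) (bracket _ _) (enorm (nor _ _ _) * enorm _)
    (edot (nor t x y) (nor t x y)) (edot (nor t y x) (nor t y x)) (edot (x - y) (x - y))
    (conf _) (conf _) (q t x) (q t y).
  by clear; move=> *; ring.
split=> //.
move: h1_ge0; rewrite {1}/h1 /= => h; rewrite -(pmulr_rge0 _ t0); apply: le_trans h _.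
rewrite gerDr -2!mulrA -[_ * _ * (_ * _)]mulrA.
have br := bracket_le0 Ux Uy.
rewrite mulr_le0_ge0 //; last by rewrite !mulr_ge0 ?edot_ge0 // ltW.
by rewrite mulr_ge0_le0 // ler0n.
Qed.

Section ContinuityOfTheInequalities.
Variables (z : T) (t : R).
Hypothesis Kz : K z.

Let X (w : T * R) := w.1.1.
Let Y (w : T * R) := w.1.2.
Let p (w : T * R) := w.2.
Let cont (V : topologicalType) (f : T * R -> V) := cont_at (z, t) f.

Let cX : cont X.
Proof. by apply: (@cont_comp _ _ _ _ fst (fst : T * R -> T)); [exact: cvg_fst | exact: cvg_fst]. Qed.

Let cY : cont Y.
Proof. by apply: (@cont_comp _ _ _ _ snd (fst : T * R -> T)); [exact: cvg_fst | exact: cvg_snd]. Qed.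

Let cp : cont p.
Proof. exact: cvg_snd. Qed.

Let X0 : X (z, t) != 0. Proof. by have [/U_neq0] := KU Kz. Qed.
Let Y0 : Y (z, t) != 0. Proof. by have [_ /U_neq0] := KU Kz. Qed.
Let Xr : ((enorm (X (z, t)))%:E <= r0)%E. Proof. by have [/U_norm] := KU Kz. Qed.
Let Yr : ((enorm (Y (z, t)))%:E <= r0)%E. Proof. by have [_ /U_norm] := KU Kz. Qed.
Let XY : X (z, t) != Y (z, t). Proof. exact: K_neq. Qed.
Let YX : Y (z, t) != X (z, t). Proof. by rewrite eq_sym. Qed.

Let cqX : cont (fun w => q (p w) (X w)) := cont_test cpsi cX cp.
Let cqY : cont (fun w => q (p w) (Y w)) := cont_test cpsi cY cp.
Let cNX : cont (fun w => nor (p w) (X w) (Y w)) := cont_pnormal cpsi cpsi1 cX cY cp XY.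
Let cNY : cont (fun w => nor (p w) (Y w) (X w)) := cont_pnormal cpsi cpsi1 cY cX cp YX.
Let cNXX := cont_edot cNX cNX.
Let cNYY := cont_edot cNY cNY.
Let cA := cont_conf sm cX X0 Xr.
Let cB := cont_conf sm cY Y0 Yr.
Let cEX := cont_excess sm cpsi cpsi1 cpsi2 cX cNX X0 Xr.
Let cEY := cont_excess sm cpsi cpsi1 cpsi2 cY cNY Y0 Yr.
Let cbr := cont_bracket sm cX cY X0 Xr Y0 Yr (cont_slope sm cY Y0 Yr) cB.
Let cd := cont_edot (cont_subv cX cY) (cont_subv cX cY).

Let cdefect : cont (fun w => defect psi psi1 (X w) (Y w)).
Proof.
have crx := cont_edot cX cX; have cry := cont_edot cY cY.
have h1x : cont (fun w => 2 * psi1 (edot (X w) (X w))).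
  by apply: cont_mul; [exact: cont_cst | apply: (@cont_comp _ _ _ _ psi1) => //].
have h1y : cont (fun w => 2 * psi1 (edot (Y w) (Y w))).
  by apply: cont_mul; [exact: cont_cst | apply: (@cont_comp _ _ _ _ psi1) => //].
have hx : cont (fun w => psi (edot (X w) (X w))) by apply: (@cont_comp _ _ _ _ psi).
have hy : cont (fun w => psi (edot (Y w) (Y w))) by apply: (@cont_comp _ _ _ _ psi).
have cu := cont_subv cX cY.
apply: (cont_addv (cont_subv (cont_scalev cY h1y) (cont_scalev cX h1x)) (cont_scalev cu _)).
apply: cont_mul.
  apply: cont_div; [exact: cont_cst | exact: cd | by rewrite edot_eq0 subr_eq0].
apply: cont_sub; last exact: cont_sub.
by apply: cont_mul => //; exact: (cont_edot cX (cont_subv cX cY)).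
Qed.

Let cont_h2 : cont h2.
Proof.
apply: cont_sub.
  apply: (cont_mul cp); apply: (cont_mul _ cqY); apply: (cont_mul _ cqX).
  apply: cont_mul; last exact: (cont_mul (cont_enorm cNX) (cont_enorm cNY)).
  exact: (cont_mul (cont_mul cA cB) (cont_edot cdefect cdefect)).
apply: (cont_mul cd); apply: cont_add.
  exact: (cont_mul (cont_mul (cont_mul cA cEX) cNYY) cqY).
exact: (cont_mul (cont_mul (cont_mul cB cEY) cNXX) cqX).
Qed.

Let cont_h1 : cont h1.
Proof.
apply: cont_add; last exact: (cont_mul cp cont_h2).
apply: (cont_mul _ cqY); apply: (cont_mul _ cqX); apply: (cont_mul _ cNYY); apply: (cont_mul _ cNXX).
by apply: cont_mul; [exact: cont_cst | exact: cbr].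
Qed.

Lemma cont_h12 : cont h1 /\ cont h2. Proof. by []. Qed.

End ContinuityOfTheInequalities.

Lemma no_critical_pair : False.
Proof.
have c1 z t : K z -> 0 <= t -> t <= e -> {for (z, t), continuous h1}.
  by move=> Kz _ _; have [] := cont_h12 t Kz.
have c2 z t : K z -> 0 <= t -> t <= e -> {for (z, t), continuous h2}.
  by move=> Kz _ _; have [] := cont_h12 t Kz.
have [[x y] Kz [/= ge1 ge2]] := limit_parameter K_compact e_gt0 c1 c2 solution.
have [Ux Uy] := KU Kz; have xy := K_neq Kz; rewrite /= in Ux Uy xy.
have yx : y != x by rewrite eq_sym.
have dd : 0 < edot (x - y) (x - y) by rewrite edot_gt0 subr_eq0.
have dd' : 0 < edot (y - x) (y - x) by rewrite edot_gt0 subr_eq0.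
have [[_ mx] [_ my]] := (Ux, Uy).
have qx : 0 < q 0 x by rewrite /test mul0r addr0; apply: lt_le_trans mx.
have qy : 0 < q 0 y by rewrite /test mul0r addr0; apply: lt_le_trans my.
have cx : 0 < edot c x by apply: lt_le_trans mx.
have cy : 0 < edot c y by apply: lt_le_trans my.
have nx : 0 < edot (nor 0 x y) (nor 0 x y).
  by rewrite edot_pnormal0 // ltr_wpDl ?edot_ge0 // divr_gt0 // !mulr_gt0.
have ny : 0 < edot (nor 0 y x) (nor 0 y x).
  by rewrite edot_pnormal0 // ltr_wpDl ?edot_ge0 // divr_gt0 // !mulr_gt0.
(* At parameter [0], [h1] is the bracket times positive factors, while [h2] is minus a combination
   of the two excesses with positive coefficients. *)
have br : 0 <= bracket (enorm x) (enorm y).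
  have n0 : 0 < n%:R :> R by rewrite ltr0n.
  move: ge1; rewrite /h1 /= mul0r addr0 (pmulr_lge0 _ qy) (pmulr_lge0 _ qx).
  by rewrite (pmulr_lge0 _ ny) (pmulr_lge0 _ nx) (pmulr_rge0 _ n0).
have ex := excess_gt0 Ux Uy xy br.
have ey : 0 < exc y (nor 0 y x) by apply: excess_gt0 => //; rewrite bracketC.
move: ge2; rewrite /h2 /= mul0r sub0r oppr_ge0 leNgt => /negP; apply.
rewrite mulr_gt0 // addr_gt0 //.
  by rewrite !mulr_gt0 // conf_gt0.
by rewrite !mulr_gt0 // conf_gt0.
Qed.

End Weight.
End Separation.

(** * Choice of the weight *)

Section Disjointness.
Variables (R : realType) (n : nat) (phi : R -> R) (rbar r0 : \bar R).
Hypothesis n_gt0 : (0 < n)%N.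
Hypothesis r0_le : (r0 <= rbar)%E.
Hypothesis sm : smooth_metric_on (oball rbar `|` cball r0) (conformal_metric n phi).
Local Notation slope := (@slope R n phi).
Local Notation conf := (conf phi).
Local Notation bracket := (@bracket R n phi).
Local Notation g := (conformal_metric n phi).
Implicit Types (S : set 'rV[R]_n.+1) (c x y : 'rV[R]_n.+1).

Lemma pnormal0_neq0 psi psi1 c x y : x != y -> 0 < edot c x -> 0 < edot c y ->
  pnormal psi psi1 c 0 x y != 0.
Proof.
move=> xy cx cy; have dd : 0 < edot (x - y) (x - y) by rewrite edot_gt0 subr_eq0.
rewrite -edot_gt0 edot_pnormal0 // ltr_wpDl ?edot_ge0 // divr_gt0 // !mulr_gt0 //.
Qed.

Lemma no_separation S S' c m0 :
  ricci_largest_radially (oball rbar) g \/ ricci_constant (oball rbar) g ->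
  compact_free_boundary_minimal g r0 S -> compact_free_boundary_minimal g r0 S' ->
  0 < m0 -> (forall x, S x -> S' x -> edot c x <= - m0) ->
  (exists2 x, S x & 0 < edot c x) -> (exists2 x, S' x & 0 < edot c x) -> False.
Proof.
move=> ric fbm fbm' m00 sep pS pS'.
have [_ cS [Sr _] _ _] := fbm; have [_ cS' [Sr' _] _ _] := fbm'.
have [m [m_gt0 [p Sp mp] loc]] := localization cS cS' m00 sep pS pS'.
have disj x : S x -> S' x -> m <= edot c x -> False.
  by move=> Sx S'x mx; have := sep x Sx S'x; move: m_gt0 m00 mx; lra.
pose V x := S x \/ S' x; pose U x := V x /\ m <= edot c x.
have U0 x : U x -> x != 0.
  by move=> [_ mx]; apply: contraTneq mx => ->; rewrite edot0r -ltNge.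
have Vr x : V x -> ((enorm x)%:E <= r0)%E by move=> [/Sr|/Sr'].
have Ur x : U x -> ((enorm x)%:E <= r0)%E by move=> [/Vr].
have up x : U x -> 0 < edot c x by move=> [_]; exact: lt_le_trans.
have cV : compact V by exact: compactU.
have V0 : V !=set0 by exists p; left.
case: (slope_alternative n_gt0 r0_le sm ric) => [mono|cst].
(* The exponent needs bounds on the profile away from the origin, and [U] provides them: it is
   compact, excludes the origin, and does not depend on the weight. *)
- have cU : compact U.
    have -> : U = V `&` [set x | 0 <= edot c x - m].
      by apply/seteqP; split => x [Vx /=]; rewrite ?subr_ge0 // => h; split; rewrite //= subr_ge0.
    apply: compact_sublevel => // x _; apply: continuousB; last exact: cst_continuous.
    exact: edot_continuous.
  have Un0 : U !=set0 by exists p; split=> //; left.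
  have [L L1 LP] := large_exponent sm Un0 cU U0 Ur.
  have L0 : 0 < L by exact: lt_le_trans L1.
  have cpsi r : {for r, continuous (expw L)} := jet_continuous (expw_jet L r).
  have [||e e0 he] := loc (expw L) 1 ltr01 cpsi.
  + by move=> r _; exact: expw_gt0.
  + by move=> x _; apply: expw_le1; [exact: ltW | exact: edot_ge0].
  apply: (no_critical_pair n_gt0 sm fbm fbm' m_gt0 (expw_jet L) _ _ _ _ _ e0 he disj).
  + by move=> r; apply: (@continuousM _ _ (cst (- L))) => //; exact: cst_continuous.
  + by move=> r; apply: (@continuousM _ _ (cst (L ^+ 2))) => //; exact: cst_continuous.
  + move=> x _; have := expw_gt0 L (edot x x); have := edot_ge0 x.
    move: (edot x x) (expw L _) => rho E rho0 E0.
    have -> : E - 2 * rho * (- L * E) = E * (1 + 2 * rho * L) by ring.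
    by rewrite mulr_gt0 // ltr_wpDr // !mulr_ge0 // ltW.
  + move=> x y Ux Uy; have [->|ne] := eqVneq (enorm x) (enorm y); first by rewrite /bracket !subrr.
    by apply/ltW/(bracket_lt0 sm mono); rewrite ?enorm_gt0 ?U0 ?Ur.
  (* A nonnegative bracket forces equal radii; the limiting normal is then orthogonal to [x], as the
     choice of [L] requires. *)
  + move=> x y Ux Uy xy; have [exy _|ne] := eqVneq (enorm x) (enorm y); last first.
      by rewrite leNgt (bracket_lt0 sm mono) ?enorm_gt0 ?U0 ?Ur.
    apply: LP => //; first by apply: pnormal0_neq0; rewrite ?up.
    rewrite edot_pnormal // -!enorm2 exy subrr mulr0 !mul0r addr0 expr0n /=.
    by rewrite divr_ge0 // mulr_ge0 // ?sqr_ge0 ?edot_ge0.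
have cN (x : 'rV[R]_n.+1) : V x -> {for x, continuous (fun x : 'rV[R]_n.+1 => - edot x x)}.
  by move=> _; apply: continuousN; exact: sqnorm_continuous.
have [z Vz zmax] := compact_argmin V0 cV cN.
have {}zmax x : V x -> edot x x <= edot z z by move=> /zmax; rewrite lerN2.
have z0 : z != 0.
  have Up : U p by split=> //; left.
  rewrite -edot_gt0; apply: lt_le_trans (zmax p Up.1).
  by rewrite edot_gt0 U0.
have zz : 0 < edot z z by rewrite edot_gt0.
(* With [b = edot z z + eta], affinity of the profile turns [conf (enorm x) + slope (enorm x) * (b -
   edot x x)] into [conf (enorm z) + eta * slope (enorm z)], at least half of [conf (enorm z)]. The
   condition on the weight reads [edot x x < b], whence the maximum over both hypersurfaces. *)
have [eta [eta0 _ etaP]] := small_factor (2 * `|slope (enorm z)|) (conf_gt0 phi (enorm z)).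
pose b := edot z z + eta.
have b0 : 0 < b by rewrite addr_gt0.
have cpsi r : {for r, continuous (affw b)} := jet_continuous (affw_jet b r).
have [|||e e0 he] := loc (affw b) (edot z z + b) _ cpsi.
- by rewrite addr_gt0.
- by move=> r r_ge0; rewrite /affw ltr_wpDl.
- by move=> x Vx; rewrite /affw lerD2r zmax.
have aff x y : U x -> U y -> slope (enorm x) = slope (enorm y) /\
    conf (enorm x) - slope (enorm x) * edot x x = conf (enorm y) - slope (enorm y) * edot y y.
  by move=> Ux Uy; rewrite -!enorm2; apply: (conf_affine sm cst); rewrite ?enorm_gt0 ?U0 ?Ur.
apply: (no_critical_pair n_gt0 sm fbm fbm' m_gt0 (psi1 := fun=> 1) (psi2 := fun=> 0) (affw_jet b) _ _ _ _ _ e0 he disj).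
- by move=> r; exact: cst_continuous.
- by move=> r; exact: cst_continuous.
- by move=> x /zmax; rewrite /affw /b; move: eta0; lra.
(* An affine profile satisfies [A - B = k * (rx - ry)], so its bracket is identically zero. *)
- move=> x y Ux Uy; have [sE cE] := aff x y Ux Uy.
  rewrite /bracket -sE in cE *; rewrite !enorm2.
  move: cE; move: (edot x x) (edot y y) (conf (enorm x)) (conf (enorm y)) (slope _) => rx ry A B k E.
  have -> : A = B + k * (rx - ry) by move: E; lra.
  by rewrite le_eqVlt; apply/orP; left; apply/eqP; ring.
move=> x y Ux Uy xy _.
have w0 := pnormal0_neq0 (affw b) (fun=> 1) xy (up x Ux) (up y Uy).
have zp : 0 < enorm z by rewrite enorm_gt0.
have xp : 0 < enorm x by rewrite enorm_gt0 U0.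
have [sE cE] := conf_affine sm cst xp (Ur x Ux) zp (Vr z Vz).
rewrite !enorm2 sE in cE.
rewrite /excess mulr0 !mul0r addr0 mulr_gt0 ?edot_gt0 // mulr_gt0 ?ltr0n //.
rewrite mul1r mulr1 sE /affw /b.
have A0 := conf_gt0 phi (enorm z).
have h := ler_norm (- slope (enorm z)); rewrite normrN in h.
have h2 : - (eta * slope (enorm z)) <= eta * `|slope (enorm z)|.
  by rewrite -mulrN ler_pM2l.
move: cE etaP A0 h2.
move: (edot x x) (edot z z) (conf (enorm x)) (conf (enorm z)) (`|slope (enorm z)|) (slope (enorm z)) => rx rz A B k' k.
nra.
Qed.

End Disjointness.

Theorem theorem1p2 (R : realType) (n : nat) (rbar r0 : \bar R) (phi : R -> R)
    (Sigma0 Sigma1 : set 'rV[R]_n.+1) (a : 'rV[R]_n.+1) :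
  (1 <= n)%N ->
  (0 < rbar)%E ->
  (0 < r0)%E -> (r0 <= rbar)%E ->
  smooth_metric_on (oball rbar `|` cball r0) (conformal_metric n phi) ->
  ricci_largest_radially (oball rbar) (conformal_metric n phi) \/
    ricci_constant (oball rbar) (conformal_metric n phi) ->
  compact_free_boundary_minimal (conformal_metric n phi) r0 Sigma0 ->
  compact_free_boundary_minimal (conformal_metric n phi) r0 Sigma1 ->
  enorm a = 1 ->
  Sigma0 `&` Sigma1 `&` [set x | cball r0 x /\ 0 <= edot x a] !=set0.
Proof.
move=> n_gt0 _ _ r0_le sm ric fbm fbm' a1.
have a0 : a != 0 by rewrite -enorm_gt0 a1.
apply: contrapT => empty.
have sep x : Sigma0 x -> Sigma1 x -> edot a x < 0.
  move=> Sx S'x; rewrite ltNge; apply/negP => ax; apply: empty; exists x.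
  by have [_ _ [Sr _] _ _] := fbm; split=> //; split; [exact: Sr | rewrite edotC].
have [c [_ [m m0 mP] pS pS']] := tilt n_gt0 sm fbm fbm' a0 sep.
exact: (no_separation n_gt0 r0_le sm ric fbm fbm' m0 mP pS pS').
Qed.
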